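(* Let $\nu_0,\nu_1\in\mathcal{P}_2(\mathbb{R}^d)$ and $t>1$. Let $(\mathcal{P})$ denote the problem (and its optimal value) $$\min_{\mu\in\mathcal{P}_2(\mathbb{R}^d)}\left\{\frac{W_2^2(\mu,\nu_1)}{2(t-1)}-\frac{W_2^2(\mu,\nu_0)}{2t}\right\},$$ and let $(\mathcal{P}^* )$ denote the problem (and its optimal value) $$\inf\left\{\int u^*\,\mathrm{d}\nu_1+\int u\,\mathrm{d}\nu_0 ~:~ u-\frac{t-1}{t}\frac{|\cdot|^2}{2}\ \text{is convex and l.s.c.}\right\}.$$ Then the optimal values satisfy $$(\mathcal{P})=(\mathcal{P}^* )-\int\frac{|x|^2}{2}\,\mathrm{d}\nu_0(x)-\int\frac{|x|^2}{2}\,\mathrm{d}\nu_1(x).$$ Moreover: (1) $\mu$ solves $(\mathcal{P})$ if and only if $\mu=T(t)_\#\nu_1$, where $T(t)=\nabla u^*+t(\mathrm{Id}-\nabla u^* )$ and $u$ solves $(\mathcal{P}^* )$. (2) Conversely, $u$ solves $(\mathcal{P}^* )$ if and only if $-(t-1)u^*+t\frac{|\cdot|^2}{2}$ and $tu-(t-1)\frac{|\cdot|^2}{2}$ are optimal Brenier potentials from $\nu_1$ to $\mu$ and from $\nu_0$ to $\mu$, respectively, and $\mu$ solves $(\mathcal{P})$.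
   Context: $\mathcal{P}_2(\mathbb{R}^d)$ is the set of Borel probability measures on $\mathbb{R}^d$ with finite second moment; $\Gamma(\mu,\nu)$ is the set of couplings with first marginal $\mu$ and second marginal $\nu$; $W_2^2(\mu,\nu)=\min_{\gamma\in\Gamma(\mu,\nu)}\int|x-y|^2\,\mathrm{d}\gamma(x,y)$. Functions $u$ in $(\mathcal{P}^* )$ take values in $(-\infty,+\infty]$ and are proper (not identically $+\infty$); $u^*$ is the Legendre transform $u^*(y)=\sup_x\langle x,y\rangle-u(x)$. For $u$ admissible in $(\mathcal{P}^* )$, $u$ is strongly convex, so $u^*$ is finite and $C^1$ with $\nabla u^*$ Lipschitz of constant $t/(t-1)$, and the push-forward $T(t)_\#\nu_1$ is well defined. $\mathrm{Id}$ is the identity map. An optimal Brenier potential from $\mu$ to $\nu$ ($\mu,\nu\in\mathcal{P}_2(\mathbb{R}^d)$) is any lower semi-continuous convex function $v:\mathbb{R}^d\to(-\infty,\infty]$ which attains the infimum of $\int v\,\mathrm{d}\mu+\int v^*\,\mathrm{d}\nu$ over all lower semi-continuous convex functions $v:\mathbb{R}^d\to(-\infty,\infty]$ (this infimum equals $-\frac12W_2^2(\mu,\nu)+\int\frac{|x|^2}{2}\mathrm{d}\mu+\int\frac{|x|^2}{2}\mathrm{d}\nu$). In (1) the right-hand condition is read as: there is a solution $u$ of $(\mathcal{P}^* )$ with $\mu=T(t)_\#\nu_1$; in (2) as: there is a solution $\mu$ of $(\mathcal{P})$ such that the two functions are optimal Brenier potentials. *)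

(* Defs.v *)
From mathcomp Require Import all_boot all_order all_algebra.
From mathcomp Require Import all_classical all_reals all_analysis.

Set Implicit Arguments.
Unset Strict Implicit.
Unset Printing Implicit Defensive.

Import Order.TTheory GRing.Theory Num.Theory.
Import numFieldNormedType.Exports.

Local Open Scope classical_set_scope.
Local Open Scope ring_scope.

(** The library norm on ['rV[R]_d] is the sup norm: it is used only through
    the topology it induces, and the Euclidean structure is defined here. *)
Definition dotv (R : realType) (d : nat) (x y : 'rV[R]_d) : R :=
  \sum_(i < d) x ord0 i * y ord0 i.

Definition sqnorm (R : realType) (d : nat) (x : 'rV[R]_d) : R := dotv x x.

(** R^d with its Borel sigma-algebra. Its carrier is convertible to
    ['rV[R]_d], on which the topological and linear structures live. *)
Definition borelRd (R : realType) (d : nat) :=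
  g_sigma_algebraType (@open 'rV[R]_d).

Section extended_valued_functions.
Context (R : realType) (d : nat).
Implicit Types (u v : 'rV[R]_d -> \bar R).
Local Open Scope ereal_scope.

Definition proper_fun u : Prop :=
  (forall x, u x != -oo) /\ exists x, u x != +oo.

Definition convex_efun u : Prop :=
  forall (x y : 'rV[R]_d) (s : R), (0 <= s <= 1)%R ->
    u (s *: x + (1 - s) *: y)%R <= s%:E * u x + (1 - s)%:E * u y.

Definition legendre u (y : 'rV[R]_d) : \bar R :=
  ereal_sup [set (dotv x y)%:E - u x | x in [set: 'rV[R]_d]].

(** Gradient of the real-valued part of [u]; meaningful where [u] is finite
    and differentiable, e.g. everywhere for the Legendre transform of a
    strongly convex function. *)
Definition gradient u (x : 'rV[R]_d) : 'rV[R]_d :=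
  \row_(i < d) 'D_(delta_mx ord0 i) (fun z => fine (u z)) x.

End extended_valued_functions.

Section wasserstein.
Context (R : realType) (d : nat).
Implicit Types (mu nu : probability (borelRd R d) R).
Local Open Scope ereal_scope.

Definition second_moment mu : \bar R := \int[mu]_x (sqnorm x)%:E.

Definition in_P2 mu : Prop := second_moment mu < +oo.

Definition coupling mu nu
    (gamma : probability (borelRd R d * borelRd R d)%type R) : Prop :=
  (forall A : set (borelRd R d), measurable A -> gamma (fst @^-1` A) = mu A) /\
  (forall A : set (borelRd R d), measurable A -> gamma (snd @^-1` A) = nu A).

Definition W2sq mu nu : \bar R :=
  ereal_inf [set \int[gamma]_z (sqnorm (z.1 - z.2 : 'rV[R]_d)%R)%:E
            | gamma in coupling mu nu].

(** Properness is required because for v = +oo (where v^* = -oo) the sum of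
    integrals below is of the undefined form oo - oo; for a proper l.s.c.
    convex v, both v and v^* are bounded below by affine functions, so that
    the sum is well defined in (-oo, +oo] when mu and nu are in P_2. *)
Definition closed_convex (v : 'rV[R]_d -> \bar R) : Prop :=
  [/\ proper_fun v, convex_efun v & lower_semicontinuous v].

Definition kantorovich_cost mu nu (v : 'rV[R]_d -> \bar R) : \bar R :=
  \int[mu]_x v x + \int[nu]_y legendre v y.

Definition brenier_potential mu nu (v : 'rV[R]_d -> \bar R) : Prop :=
  closed_convex v /\
  forall w, closed_convex w ->
    kantorovich_cost mu nu v <= kantorovich_cost mu nu w.

End wasserstein.

Section extrapolation.
Context (R : realType) (d : nat).
Implicit Types (nu mu : probability (borelRd R d) R) (t : R).
Implicit Types (u : 'rV[R]_d -> \bar R).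
Local Open Scope ereal_scope.

Definition primal_cost (nu0 nu1 : probability (borelRd R d) R) t mu :
    \bar R :=
  ((2 * (t - 1))^-1)%:E * W2sq mu nu1 - ((2 * t)^-1)%:E * W2sq mu nu0.

Definition primal_value (nu0 nu1 : probability (borelRd R d) R) t : \bar R :=
  ereal_inf [set primal_cost nu0 nu1 t mu | mu in @in_P2 R d].

Definition solves_primal (nu0 nu1 : probability (borelRd R d) R) t mu : Prop :=
  in_P2 mu /\
  forall mu', in_P2 mu' ->
    primal_cost nu0 nu1 t mu <= primal_cost nu0 nu1 t mu'.

Definition admissible t u : Prop :=
  let w x := u x - ((t - 1) / t * (sqnorm x / 2))%:E in
  [/\ proper_fun u, convex_efun w & lower_semicontinuous w].

Definition dual_cost (nu0 nu1 : probability (borelRd R d) R) u : \bar R :=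
  \int[nu1]_y legendre u y + \int[nu0]_x u x.

Definition dual_value (nu0 nu1 : probability (borelRd R d) R) t : \bar R :=
  ereal_inf [set dual_cost nu0 nu1 u | u in admissible t].

Definition solves_dual (nu0 nu1 : probability (borelRd R d) R) t u : Prop :=
  admissible t u /\
  forall u', admissible t u' -> dual_cost nu0 nu1 u <= dual_cost nu0 nu1 u'.

Definition extrapolation_map t u (y : borelRd R d) : borelRd R d :=
  let p := gradient (legendre u) y in (p + t *: ((y : 'rV[R]_d) - p))%R.

(** Measures are functions on all subsets, only meaningful on the measurable
    ones. *)
Definition is_pushforward (T : borelRd R d -> borelRd R d) nu mu : Prop :=
  forall A : set (borelRd R d), measurable A -> mu A = pushforward nu T A.

End extrapolation.

(* Main.v *)
Require Import Defs.
From HB Require Import structures.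
From mathcomp Require Import all_boot all_order all_algebra.
From mathcomp Require Import all_classical all_reals all_analysis.
From mathcomp Require Import measurable_realfun.
From mathcomp Require Import ring lra.
Import Order.TTheory GRing.Theory Num.Theory.
Import numFieldNormedType.Exports.
Local Open Scope classical_set_scope.
Local Open Scope ring_scope.

(** Write c = (t - 1) / t and w = u^*. An admissible u is c-strongly convex,
so w is finite, convex and lies below its quadratic expansions of curvature
1 / c; its gradient p is Lipschitz and
    u z >= <z, y> - w y + c/2 |z - p y|^2,
where the quadratic remainder, lost in weak duality, is what the whole proof
keeps track of ([admissible_legendre]).

A dual competitor gives a primal one. Let T = t Id - (t - 1) p and
mu = T_# nu1. The coupling (T, Id) bounds W2(mu, nu1) from above, and
Kantorovich duality with the potential v = t u - (t - 1)|.|^2/2 bounds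
W2(mu, nu0) from below, because v^*(T y) <= t w y - (t - 1)/2 |p y|^2. The sum
of the two estimates is that the primal cost of mu is at most the dual cost of
u minus half the second moments ([primal_le_dual]).

The opposite inequality requires an upper bound on W2(mu, nu0), that is, a
coupling. Let g be a coupling of the masses of a finite partition of nu1 with
those of a finite partition of nu0, and let B y be the mean of the nu0-variable
given the cell of y. Any coupling of mu and nu1 can be glued to nu0 along g,
and the score S = \int (<y, B y> - c/2 |B y|^2) dnu1 satisfies, up to second
moments,
    primal cost >= S + (2 t (t - 1))^-1 \int |x - (t y - (t - 1) B y)|^2,
    dual cost   >= S + c/2 \int |B y - p y|^2
([primal_ge_score], [dual_ge_score]). There is no gap: some score comes
arbitrarily close to the infimum of the dual cost ([approximate_duality]).
After quantization this is a finite dimensional convex problem, whose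
constraints are replaced by a quadratic penalty; the penalized functional has a
minimizer and its first-order conditions produce both g and nearly optimal
potentials ([finite_duality]).

Applied to a dual solution u, the two remainders force x to be close to T y in
every nearly optimal coupling of mu and nu1 ([primal_stability]). This yields
the value of the primal problem, the optimality of T_# nu1, and the fact that
a primal solution is T_# nu1 for every dual solution u, because then
W2(mu, T_# nu1) = 0.

A dual solution exists ([dual_attained]): the transforms of a minimizing
sequence, normalised at the origin, are locally equi-Lipschitz and have a
pointwise convergent subsequence; dominated convergence handles the integrals
of the transforms and Fatou's lemma those of the functions themselves.

For the Brenier potentials, the forward one has gradient T, so that equality
in the Fenchel inequality along the graph of T makes it optimal. For the
backward one, the Kantorovich functional K from nu0 to mu and the dual cost D
satisfy K(t u - (t - 1)|.|^2/2) <= t D(u) + C, while the reverse inequality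
holds with the same C when u is replaced by any admissible function; hence
minimizing one amounts to minimizing the other. *)

(** * Euclidean vectors and lower semi-continuity *)

Section Euclidean.
Context {R : realType} {d : nat}.
Implicit Types (x y z : 'rV[R]_d) (a : R).

Lemma dotvC x y : dotv x y = dotv y x.
Proof. by apply: eq_bigr => i _; rewrite mulrC. Qed.

Lemma dotvDl x y z : dotv (x + y) z = dotv x z + dotv y z.
Proof. by rewrite -big_split; apply: eq_bigr => i _; rewrite mxE mulrDl. Qed.

Lemma dotvZl a x y : dotv (a *: x) y = a * dotv x y.
Proof. by rewrite /dotv mulr_sumr; apply: eq_bigr => i _; rewrite mxE mulrA. Qed.

Lemma dotvNl x y : dotv (- x) y = - dotv x y.
Proof. by rewrite -scaleN1r dotvZl mulN1r. Qed.

Lemma dotvDr x y z : dotv x (y + z) = dotv x y + dotv x z.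
Proof. by rewrite dotvC dotvDl !(dotvC x). Qed.

Lemma dotvZr a x y : dotv x (a *: y) = a * dotv x y.
Proof. by rewrite dotvC dotvZl (dotvC x). Qed.

Lemma dotvNr x y : dotv x (- y) = - dotv x y.
Proof. by rewrite dotvC dotvNl (dotvC x). Qed.

Lemma dot0v y : dotv 0 y = 0 :> R.
Proof. by rewrite -(scale0r (0 : 'rV[R]_d)) dotvZl mul0r. Qed.

Lemma dotv0 y : dotv y 0 = 0 :> R.
Proof. by rewrite dotvC dot0v. Qed.

Definition dotvE := (dotvDl, dotvDr, dotvNl, dotvNr, dotvZl, dotvZr, dot0v, dotv0).

Lemma sqnorm_ge0 x : 0 <= sqnorm x.
Proof. by apply: sumr_ge0 => i _; rewrite -expr2 sqr_ge0. Qed.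

Lemma sqnormN x : sqnorm (- x) = sqnorm x.
Proof. by rewrite /sqnorm !dotvE opprK. Qed.

Lemma sqnorm0 : sqnorm (0 : 'rV[R]_d) = 0.
Proof. by rewrite /sqnorm dot0v. Qed.

Lemma sqnormZ a x : sqnorm (a *: x) = a ^+ 2 * sqnorm x.
Proof. by rewrite /sqnorm !dotvE mulrA expr2. Qed.

Lemma sqnormD x y : sqnorm (x + y) = sqnorm x + 2 * dotv x y + sqnorm y.
Proof. rewrite /sqnorm !dotvE (dotvC y x); ring. Qed.

Lemma sqnormB x y : sqnorm (x - y) = sqnorm x - 2 * dotv x y + sqnorm y.
Proof. by rewrite sqnormD sqnormN dotvNr; ring. Qed.

Lemma sqnorm_coord x i : x ord0 i ^+ 2 <= sqnorm x.
Proof.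
rewrite /sqnorm /dotv (bigD1 i) //= -expr2 lerDl.
by apply: sumr_ge0 => j _; rewrite -expr2 sqr_ge0.
Qed.

Lemma sqnorm_eq0 x : (sqnorm x == 0) = (x == 0).
Proof.
apply/eqP/eqP => [x0|->]; last exact: sqnorm0.
apply/rowP => i; rewrite mxE; apply/eqP.
by rewrite -sqrf_eq0 eq_le sqr_ge0 -x0 sqnorm_coord.
Qed.

(** Young's inequality, from |a x - y|^2 >= 0. *)
Lemma dotv_young a x y : 0 < a -> 2 * dotv x y <= a * sqnorm x + a^-1 * sqnorm y.
Proof.
move=> a0; have := sqnorm_ge0 (a *: x - y).
rewrite sqnormB sqnormZ dotvZl => h.
have -> : a * sqnorm x + a^-1 * sqnorm y =
  a^-1 * (a ^+ 2 * sqnorm x + sqnorm y) by field; lra.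
by rewrite ler_pdivlMl //; lra.
Qed.

Lemma sqnormD_le x y : sqnorm (x + y) <= 2 * sqnorm x + 2 * sqnorm y.
Proof. by have := sqnorm_ge0 (x - y); rewrite sqnormB sqnormD; lra. Qed.

Lemma sqnormB_le x y : sqnorm (x - y) <= 2 * sqnorm x + 2 * sqnorm y.
Proof. by have := sqnormD_le x (- y); rewrite sqnormN. Qed.

Lemma coord_cont i : continuous (fun x : 'rV[R]_d => x ord0 i : R).
Proof. exact: coord_continuous. Qed.

Lemma dotv_cont (T : topologicalType) (f g : T -> 'rV[R]_d) :
  continuous f -> continuous g -> continuous (fun s => dotv (f s) (g s)).
Proof.
move=> cf cg x; rewrite /dotv.
apply: cvg_big => [|i _]; first exact: add_continuous.
apply: cvgM.
  apply: (@continuous_comp _ _ _ f (fun z : 'rV[R]_d => z ord0 i : R)).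
    exact: cf.
  exact: coord_cont.
apply: (@continuous_comp _ _ _ g (fun z : 'rV[R]_d => z ord0 i : R)).
  exact: cg.
exact: coord_cont.
Qed.

Lemma sqnorm_cont : continuous (fun x : 'rV[R]_d => sqnorm x).
Proof. by apply: dotv_cont => x; exact: cvg_id. Qed.

Lemma dotvr_cont y : continuous (fun x : 'rV[R]_d => dotv y x).
Proof. by apply: (@dotv_cont _ (cst y) id); [exact: cst_continuous|move=> x; exact: cvg_id]. Qed.

Lemma contZ (T : topologicalType) a (f : T -> R) :
  continuous f -> continuous (fun s => a * f s).
Proof. by move=> cf s; exact: (cvgM (@cvg_cst _ a _ (nbhs s) _) (cf s)). Qed.

Lemma contN (T : topologicalType) (f : T -> R) :
  continuous f -> continuous (fun s => - f s).
Proof. by move=> cf s; exact: (cvgN (cf s)). Qed.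

Lemma half_sqnorm_cont a : continuous (fun s : 'rV[R]_d => a * (sqnorm s / 2)).
Proof.
rewrite (_ : (fun _ => _) = fun s => (a / 2) * sqnorm s).
  by apply: contZ; exact: sqnorm_cont.
by apply/funext => s; rewrite mulrCA mulrC.
Qed.

Lemma dotvl_cont y : continuous (fun s : 'rV[R]_d => dotv s y).
Proof.
by apply: (@dotv_cont _ id (cst y)); [move=> s; exact: cvg_id|exact: cst_continuous].
Qed.

Lemma sqnormB_cont x : continuous (fun z : 'rV[R]_d => sqnorm (z - x)).
Proof.
move=> z.
apply: (@continuous_comp _ _ _ (fun z => z - x) (fun z : 'rV[R]_d => sqnorm z)).
  exact: (cvgB (@cvg_id _ (nbhs z)) (@cvg_cst _ x _ (nbhs z) _)).
exact: sqnorm_cont.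
Qed.

(** Compactness is known for the sup norm, which the Euclidean norm dominates. *)
Lemma ball_compact x (r : R) : compact [set z | sqnorm (z - x) <= r].
Proof.
apply: bounded_closed_compact.
  exists (1 + r + `|x|); split=> [|M rM z /= zx]; first exact: num_real.
  apply: (le_trans _ (ltW rM)).
  rewrite -(subrK x z) (le_trans (ler_normD _ _)) // lerD2r.
  rewrite [leLHS]/Num.norm /=.
  have r0 : 0 <= r by apply: le_trans zx; exact: sqnorm_ge0.
  rewrite mx_normrE; apply/bigmax_leP; split => /= [|[i j] _]; first lra.
  rewrite (ord1 i) /=; have := sqnorm_coord (z - x) j => h.
  have := sqr_ge0 (`|(z - x) ord0 j| - 1).
  by rewrite -(real_normK (num_real _)) in h; nra.
rewrite (_ : mkset _ = (fun z => sqnorm (z - x)) @^-1` [set s | s <= r]) //.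
have cf := sqnormB_cont x.
by move/continuous_closedP : cf; apply; exact: closed_le.
Qed.

End Euclidean.

Section Semicontinuity.
Context {R : realType}.
Local Open Scope ereal_scope.

Lemma between_lte (a : R) (e : \bar R) : a%:E < e ->
  exists2 b : R, (a < b)%R & b%:E < e.
Proof.
case: e => [r||] //=.
  by rewrite lte_fin => ar; exists ((a + r) / 2)%R; rewrite ?lte_fin; lra.
by move=> _; exists (a + 1)%R; [lra|rewrite ltry].
Qed.

Lemma lscD_cont (T : topologicalType) (w : T -> \bar R) (g : T -> R) :
  lower_semicontinuous w -> continuous g ->
  lower_semicontinuous (fun x => w x + (g x)%:E).
Proof.
move=> lw cg x a axw.
have : (a - g x)%:E < w x by rewrite EFinB lteBlDr.
move=> /between_lte[b ab bw].
have [V Vx Vw] := lw x b bw.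
exists (V `&` [set z | (a - b < g z)%R]).
  apply: filterI => //.
  have h : (a - b < g x)%R by lra.
  exact: (cvgr_gt (g x) (cg x)).
move=> z [/Vw bwz /= gz].
have -> : a%:E = (b%:E + (a - b)%:E) by rewrite -EFinD; congr (_%:E); lra.
by apply: lteD; rewrite ?lte_fin.
Qed.

Lemma lsc_cst (T : topologicalType) (e : \bar R) :
  lower_semicontinuous (fun _ : T => e).
Proof. by move=> x a ae; exists setT => //; exact: filterT. Qed.

Lemma lsc_ereal_sup (T : topologicalType) (I : Type) (f : I -> T -> \bar R) :
  (forall i, lower_semicontinuous (f i)) ->
  lower_semicontinuous (fun x => ereal_sup [set f i x | i in [set: I]]).
Proof.
move=> lf x a /ereal_sup_gt[_ [i _ <-]] /(lf i x a)[V Vx Va].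
exists V => // y /Va h; apply: lt_le_trans h _.
by apply: ereal_sup_ubound; exists i.
Qed.

(** The traces on [K] of the sublevel sets above the infimum generate a proper
    filter, and a cluster point of this filter is a minimizer. *)
Lemma lsc_compact_min (T : topologicalType) (K : set T) (F : T -> \bar R) :
  compact K -> K !=set0 -> lower_semicontinuous F ->
  exists2 p, K p & forall z, K z -> F p <= F z.
Proof.
move=> cK [k0 Kk0] lF; pose m := ereal_inf (F @` K).
have mF z : K z -> m <= F z by move=> Kz; apply: ereal_inf_lbound; exists z.
have [moo|moo] := eqVneq m +oo.
  exists k0 => // z Kz; move: (mF z Kz); rewrite moo leye_eq => /eqP ->.
  by rewrite leey.
pose G := filter_from [set r : R | m < r%:E] (fun r => K `&` [set x | F x <= r%:E]).
have GF : ProperFilter G.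
  apply: filter_from_proper.
    apply: filter_from_filter.
      move: moo; case: (m) => [r||] // _; last by exists 0%R => /=; rewrite ltNyr.
      by exists (r + 1)%R => /=; rewrite lte_fin; lra.
    move=> i j /= mi mj; exists (Order.min i j); 
      first by rewrite /Order.min; case: ifP.
    move=> x /= [Kx h]; split; (split=> //); apply: le_trans h _;
    by rewrite lee_fin ge_min lexx ?orbT.
  move=> r /= /ereal_inf_lt[_ [x Kx <-] xr]; exists x; split=> //.
  exact: ltW.
have [p [Kp pG]] : K `&` cluster G !=set0.
  apply: cK.
  move: moo; case Em : (m) => [r||] // _.
    by exists (r + 1)%R; [rewrite /= Em lte_fin; lra|move=> x []].
  by exists 0%R; [rewrite /= Em ltNyr|move=> x []].
exists p => // z Kz; apply: le_trans (mF z Kz).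
rewrite leNgt; apply/negP => mFp.
have [r mr rF] : exists2 r : R, m < r%:E & r%:E < F p.
  move: mFp moo; case: (m) => [s||] // h _.
    by have [b sb bF] := between_lte _ _ h; exists b; rewrite ?lte_fin.
  move: h; case: (F p) => [s||] // _.
    by exists (s - 1)%R; rewrite ?ltNyr // lte_fin; lra.
  by exists 0%R; rewrite ?ltNyr ?ltry.
have [V Vp VF] := lF p r rF.
have [x [[_ /= xr] /VF]] := pG _ V (ex_intro2 _ _ r mr (fun=> id)) Vp.
by rewrite ltNge xr.
Qed.

End Semicontinuity.

(** * Strongly convex functions and their Legendre transforms *)

Section StronglyConvex.
Context {R : realType} {d : nat}.
Implicit Types (x y z p h : 'rV[R]_d) (c r s : R) (u v : 'rV[R]_d -> \bar R).

Definition strongly_admissible c u : Prop :=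
  let w x := (u x - (c * (sqnorm x / 2))%:E)%E in
  [/\ proper_fun u, convex_efun w & lower_semicontinuous w].

(** [w] is convex with gradient [p] and curvature at most [k]: the condition is
    stated by first-order bounds, which survive pointwise limits of [w] and [p]. *)
Definition smooth_convex (k : R) (w : 'rV[R]_d -> R) (p : 'rV[R]_d -> 'rV[R]_d) :=
  forall y h, w y + dotv (p y) h <= w (y + h)
              <= w y + dotv (p y) h + k / 2 * sqnorm h.

Lemma strongly_admissible_lsc c u :
  strongly_admissible c u -> lower_semicontinuous u.
Proof.
move=> [_ _ lu].
have -> : u = fun x => (u x - (c * (sqnorm x / 2))%:E + (c * (sqnorm x / 2))%:E)%E.
  by apply/funext => x; rewrite subeK.
by apply: lscD_cont => //; exact: half_sqnorm_cont.
Qed.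

Lemma strongly_admissible_convex c u x y rx ry s : strongly_admissible c u ->
  u x = rx%:E -> u y = ry%:E -> 0 <= s <= 1 ->
  (u (s *: x + (1 - s) *: y)%R
   <= (s * rx + (1 - s) * ry - c / 2 * (s * (1 - s)) * sqnorm (x - y))%:E)%E.
Proof.
move=> [_ cu _] ux uy s01; have := cu x y s s01.
rewrite ux uy -!EFinB -!EFinM -EFinD leeBlDr // -EFinD => /le_trans; apply.
rewrite lee_fin sqnormB sqnormD !sqnormZ !dotvE.
by rewrite le_eqVlt; apply/orP; left; apply/eqP; field.
Qed.

(** A strongly convex function tilted by a linear form is coercive, so that
    it has a minimizer [p], around which it grows quadratically. *)
Lemma strongly_admissible_min c u y : 0 < c -> strongly_admissible c u ->
  exists p r, u p = r%:E /\
    forall z, ((r + dotv (z - p) y + c / 2 * sqnorm (z - p))%:E <= u z)%E.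
Proof.
move=> c0 au; have lu := strongly_admissible_lsc _ _ au.
have [[uNoo [x0 ux0]] _ _] := au.
have [r0 ur0] : exists r0, u x0 = r0%:E.
  by move: (uNoo x0) ux0; case: (u x0) => [r||] // _ _; exists r.
pose F z := (u z + (- dotv z y)%:E)%E.
have lF : lower_semicontinuous F.
  by apply: lscD_cont => //; apply: contN; exact: dotvl_cont.
have Ffin z r : u z = r%:E -> F z = (r - dotv z y)%:E.
  by move=> uz; rewrite /F uz -EFinD.
have finF z : (F z <= F x0)%E -> exists r, u z = r%:E.
  rewrite (Ffin _ _ ur0) /F; move: (uNoo z).
  by case: (u z) => [r _ _||] //; exists r.
have minball (rho : R) : 1 <= rho -> exists p r, [/\ u p = r%:E,
    r - dotv p y <= r0 - dotv x0 y &
    forall z, sqnorm (z - x0) <= rho -> ((r - dotv p y)%:E <= F z)%E].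
  move=> rho1; have Kx0 : [set z | sqnorm (z - x0) <= rho] x0.
    by rewrite /= subrr sqnorm0; lra.
  have [|p Kp pm] := lsc_compact_min _ _ F (ball_compact x0 rho) _ lF.
    by exists x0.
  have [r ur] := finF _ (pm _ Kx0).
  exists p, r; split => // [|z zK].
    by have := pm _ Kx0; rewrite (Ffin _ _ ur) (Ffin _ _ ur0) lee_fin.
  by rewrite -(Ffin _ _ ur); exact: pm.
have [p1 [r1 [ur1 r10 min1]]] := minball 1 (lexx _).
(* The minimum over the unit ball bounds the slope of F at x0; beyond the
   radius rho the quadratic gain of strong convexity exceeds that slope. *)
pose D := (r0 - dotv x0 y) - (r1 - dotv p1 y).
have D0 : 0 <= D by rewrite subr_ge0.
pose rho := 1 + 2 * D / c.
have rho1 : 1 <= rho by rewrite lerDl divr_ge0 ?(ltW c0) // mulr_ge0.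
have [|p [r [ur rr0 minp]]] := minball (rho ^+ 2); first by nra.
(* Far from x0, a point z is compared with the point q at distance 1 from x0
   on the segment from x0 to z. *)
have glob z rz : u z = rz%:E -> r - dotv p y <= rz - dotv z y.
  move=> uz; have [zK|zK] := leP (sqnorm (z - x0)) (rho ^+ 2).
    by have := minp z zK; rewrite (Ffin _ _ uz) lee_fin.
  apply: le_trans rr0 _.
  pose l := Num.sqrt (sqnorm (z - x0)).
  have l2 : l ^+ 2 = sqnorm (z - x0) by rewrite sqr_sqrtr // sqnorm_ge0.
  have l0 : 0 <= l by exact: sqrtr_ge0.
  have lrho : rho < l by rewrite -l2 in zK; nra.
  have ln0 : l != 0 by rewrite gt_eqF //; lra.
  have s01 : 0 <= l^-1 <= 1.
    by rewrite invr_ge0 l0 /= invf_le1 ?lt0r ?ln0 //=; lra.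
  have := strongly_admissible_convex _ _ _ _ _ _ _ au uz ur0 s01.
  set q := _ + _ *: x0 => uq.
  have qx : q - x0 = l^-1 *: (z - x0).
    by apply/rowP => i; rewrite !mxE; ring.
  have := min1 q; rewrite qx sqnormZ -l2 exprVn mulVf ?expf_neq0 // => /(_ (lexx _)).
  rewrite /F => h1.
  have : ((r1 - dotv p1 y)%:E <= (l^-1 * rz + (1 - l^-1) * r0 -
     c / 2 * (l^-1 * (1 - l^-1)) * sqnorm (z - x0))%:E + (- dotv q y)%:E)%E.
    by apply: le_trans h1 _; rewrite leeD2r.
  rewrite -EFinD lee_fin -l2 /q !dotvE => h2.
  have h3 : l * (r1 - dotv p1 y) <= (rz - dotv z y) + (l - 1) * (r0 - dotv x0 y)
      - c / 2 * (l - 1) * l.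
    have -> : rz - dotv z y + (l - 1) * (r0 - dotv x0 y) - c / 2 * (l - 1) * l =
      l * (l^-1 * rz + (1 - l^-1) * r0 - c / 2 * (l^-1 * (1 - l^-1)) * l ^+ 2 -
      (l^-1 * dotv z y + (1 - l^-1) * dotv x0 y)) by field.
    by rewrite ler_wpM2l.
  have h4 : 2 * D <= c * (l - 1).
    by rewrite -ler_pdivrMl // mulrC; rewrite /rho in lrho; lra.
  rewrite /D in h4.
  by nra.
exists p, r; split=> // z.
have := uNoo z; case uz : (u z) => [rz||] // _; last by rewrite leey.
rewrite lee_fin.
set D' := c / 2 * sqnorm (z - p).
have D'0 : 0 <= D' by rewrite mulr_ge0 ?sqnorm_ge0 //; lra.
(* Strong convexity on the segment from p to z, divided by s: the quadratic
   term is recovered by letting s tend to 0. *)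
have key s : 0 < s -> s < 1 -> r - dotv p y + (1 - s) * D' <= rz - dotv z y.
  move=> s0 s1; have s01 : 0 <= s <= 1 by lra.
  have := strongly_admissible_convex _ _ _ _ _ _ _ au uz ur s01.
  set q := _ + _ *: p => uq.
  have [rq uqE] : exists rq, u q = rq%:E.
    by move: (uNoo q) uq; case: (u q) => [rq _ _||] //; exists rq.
  have := glob q rq uqE; move: uq; rewrite uqE lee_fin /q !dotvE /D'.
  set Q := sqnorm _ => h1 h2.
  have : s * (r - dotv p y + (1 - s) * (c / 2 * Q)) <= s * (rz - dotv z y).
    by nra.
  by rewrite ler_pM2l.
rewrite !dotvE.
suff : r - dotv p y + D' <= rz - dotv z y by lra.
rewrite leNgt; apply/negP => lt.
set g := r - dotv p y + D' - (rz - dotv z y).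
have g0 : 0 < g by rewrite subr_gt0.
(* This s makes the defect s * D' at most g / 2. *)
have := key (g / (2 * (D' + g))).
rewrite divr_gt0 ?ltr_pdivrMr ?mul1r; [|lra..].
move=> /(_ erefl); have -> : g < 2 * (D' + g) by lra.
move=> /(_ erefl); rewrite mulrBl mul1r.
have : g / (2 * (D' + g)) * D' <= g / 2.
  have -> : g / (2 * (D' + g)) * D' = g / 2 * (D' / (D' + g)) by field; lra.
  by rewrite ler_piMr ?ler_pdivrMr ?mul1r; lra.
rewrite {3}/g; lra.
Qed.

Lemma legendreE u y p r : u p = r%:E ->
  (forall z, ((r + dotv (z - p) y)%:E <= u z)%E) ->
  legendre u y = (dotv p y - r)%:E.
Proof.
move=> up hu; apply/eqP; rewrite eq_le; apply/andP; split.
  apply: ge_ereal_sup => _ [x _ <-].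
  have := hu x; case: (u x) => [rx||] //; last by rewrite leNye.
  by rewrite -EFinB !lee_fin !dotvE (dotvC x) (dotvC p); lra.
by apply: ereal_sup_ubound; exists p => //; rewrite up -EFinB.
Qed.

End StronglyConvex.

Section Smooth.
Context {R : realType} {d : nat}.
Implicit Types (x y z h : 'rV[R]_d) (c k r s : R) (u v : 'rV[R]_d -> \bar R).
Implicit Types (w : 'rV[R]_d -> R) (p : 'rV[R]_d -> 'rV[R]_d).

(** The first-order bounds squeeze the difference quotients, which identifies
    the abstract [p] with the gradient defined by partial derivatives. *)
Lemma smooth_gradient k w p f y : smooth_convex k w p ->
  (forall z, f z = (w z)%:E) -> gradient f y = p y.
Proof.
move=> sm fw; apply/rowP => i; rewrite mxE.
have -> : (fun z => fine (f z)) = w by apply/funext => z; rewrite fw.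
rewrite /derive; apply: cvg_lim => //.
pose e : 'rV[R]_d := delta_mx ord0 i.
have pe : dotv (p y) e = p y ord0 i.
  rewrite /dotv (bigD1 i) //= big1 ?addr0 => [|j /negPf ji]; rewrite /e mxE eqxx.
    by rewrite eqxx mulr1.
  by rewrite ji mulr0.
have bnd s : s != 0 ->
    `|s^-1 *: (w (s *: e + y) - w y) - p y ord0 i| <= `|k / 2 * sqnorm e| * `|s|.
  move=> s0; have := sm y (s *: e); rewrite (addrC y) dotvZr pe sqnormZ.
  move=> /andP[h1 h2].
  have -> : s^-1 *: (w (s *: e + y) - w y) - p y ord0 i =
      s^-1 * (w (s *: e + y) - w y - s * p y ord0 i).
    by rewrite [RHS]mulrBr mulKf.
  rewrite normrM normfV ler_pdivrMl ?normr_gt0 // ger0_norm; last by lra.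
  rewrite mulrCA -expr2 real_normK ?num_real // mulrC.
  have := ler_norm (k / 2 * sqnorm e); have := sqr_ge0 s; nra.
apply/cvgrPdist_le => eps eps0.
pose M := `|k / 2 * sqnorm e| + 1.
have M0 : 0 < M by rewrite ltr_wpDl.
have : \forall s \near (0 : R)^', `|s| < eps / M.
  apply: dnbhs0_lt; exact: divr_gt0.
have : \forall s \near (0 : R)^', s != 0 by exact: nbhs_dnbhs_neq.
apply: filterS2 => s s0 sM; rewrite distrC.
apply: le_trans (bnd s s0) _.
have h : M * `|s| <= eps by rewrite mulrC -ler_pdivlMr // ltW.
by apply: le_trans h; rewrite ler_wpM2r // lerDl.
Qed.

(** The minimizer of u - <., y> is the gradient of the transform at [y]; the
    quadratic growth around it gives at once the smoothness of the transform and
    the Fenchel inequality with a quadratic remainder. *)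
Lemma strongly_admissible_legendre c u : 0 < c -> strongly_admissible c u ->
  let w y := fine (legendre u y) in let p := gradient (legendre u) in
  [/\ forall y, legendre u y = (w y)%:E,
      smooth_convex c^-1 w p,
      forall y z, ((dotv z y - w y + c / 2 * sqnorm (z - p y))%:E <= u z)%E &
      forall y, u (p y) = (dotv (p y) y - w y)%:E].
Proof.
move=> c0 au /=.
have [q qP] := choice (fun y => strongly_admissible_min c u y c0 au).
have [r rP] := choice qP.
have uq y : u (q y) = (r y)%:E by have [] := rP y.
have QG y z : ((r y + dotv (z - q y) y + c / 2 * sqnorm (z - q y))%:E <= u z)%E.
  by have [_] := rP y; apply.
have lE y : legendre u y = (dotv (q y) y - r y)%:E.
  apply: legendreE => // z; apply: le_trans (QG y z).
  by rewrite lee_fin lerDl mulr_ge0 ?sqnorm_ge0 //; lra.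
have wE y : legendre u y = (fine (legendre u y))%:E by rewrite lE.
have sm : smooth_convex c^-1 (fun y => fine (legendre u y)) q.
  move=> y h; rewrite !lE /=; apply/andP; split.
    have := QG (y + h) (q y); rewrite uq lee_fin !dotvE.
    by have := mulr_ge0 (ltW c0) (sqnorm_ge0 (q y - q (y + h))); lra.
  have := QG y (q (y + h)); rewrite uq lee_fin !dotvE.
  have := dotv_young c (q (y + h) - q y) h c0; rewrite !dotvE; lra.
have pq : gradient (legendre u) = q.
  by apply/funext => y; exact: smooth_gradient sm wE.
rewrite pq; split=> // [y z|y].
  by apply: le_trans (QG y z); rewrite lE lee_fin /= !dotvE; lra.
by rewrite uq lE /= opprB addrC subrK.
Qed.

(** At the point y + k^-1 (p (y + h) - p y), the lower affine bound from
    [y + h] lies below the upper quadratic bound from [y]; Young's inequality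
    then gives the Lipschitz constant 2 k. *)
Lemma smooth_lipschitz k w p y h : 0 < k -> smooth_convex k w p ->
  sqnorm (p (y + h) - p y) <= 4 * k ^+ 2 * sqnorm h.
Proof.
move=> k0 sm; pose D := p (y + h) - p y; pose m := k^-1 *: D - h.
have /andP[h1 _] := sm (y + h) m.
have /andP[_ h2] := sm y (h + m).
have /andP[h3 _] := sm y h.
rewrite addrA in h2.
have hm : h + m = k^-1 *: D by rewrite /m addrC subrK.
have : dotv D m <= k / 2 * sqnorm (h + m).
  have -> : dotv D m = dotv (p (y + h)) m - dotv (p y) m by rewrite /D !dotvE.
  by move: h2; rewrite dotvDr; lra.
rewrite hm sqnormZ /m dotvDr dotvNr dotvZr -/(sqnorm D) -/D => h4.
have := dotv_young (2 * k)^-1 D h ltac:(rewrite invr_gt0; lra); rewrite invrK => h5.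
have {}h4 : k^-1 * sqnorm D / 2 <= dotv D h.
  have e : k / 2 * (k^-1 ^+ 2 * sqnorm D) = k^-1 * sqnorm D / 2 by field; lra.
  by rewrite e in h4; lra.
rewrite invfM in h5.
have : k^-1 * sqnorm D <= 4 * k * sqnorm h by lra.
by rewrite ler_pdivrMl // expr2; lra.
Qed.

Lemma smooth_growth k w p y : 0 < k -> smooth_convex k w p ->
  sqnorm (p y) <= 2 * sqnorm (p 0) + 8 * k ^+ 2 * sqnorm y.
Proof.
move=> k0 sm; have := smooth_lipschitz k w p 0 y k0 sm; rewrite add0r => h.
rewrite -(subrK (p 0) (p y)); apply: le_trans (sqnormD_le _ _) _.
lra.
Qed.

Lemma mx_norm_sqnorm_le x r : 0 <= r -> sqnorm x <= r ^+ 2 -> `|x| <= r.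
Proof.
move=> r0 xr; rewrite /Num.norm /= mx_normrE.
apply/bigmax_leP; split => //= -[i j] _ /=; rewrite (ord1 i).
have := sqnorm_coord x j; rewrite -(real_normK (num_real (x ord0 j))) => h.
by rewrite -(@ler_pXn2r _ 2) ?nnegrE //; apply: le_trans xr.
Qed.

Lemma sqnorm_mx_norm_le x : sqnorm x <= d%:R * `|x| ^+ 2.
Proof.
rewrite /sqnorm /dotv.
apply: (@le_trans _ _ (\sum_(i < d) `|x| ^+ 2)).
  apply: ler_sum => i _; rewrite -expr2 -(real_normK (num_real (x ord0 i))).
  rewrite ler_pXn2r ?nnegrE // [leRHS]/Num.norm /= mx_normrE.
  by apply: (le_bigmax _ (fun ij : 'I_1 * 'I_d => `|x ij.1 ij.2|) (ord0, i)).
by rewrite sumr_const card_ord mulr_natl.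
Qed.

Lemma smooth_continuous k w p : 0 < k -> smooth_convex k w p -> continuous p.
Proof.
move=> k0 sm y; apply/(@cvgrPdist_le R 'rV[R]_d _ (nbhs y) (nbhs_filter (y : 'rV[R]_d))) => eps eps0.
pose M := 2 * k * (d%:R + 1).
have M0 : 0 < M by rewrite !mulr_gt0 // ltr_wpDl.
near=> z; have yz : `|y - z| <= eps / M.
  by near: z; exact: (@cvgr_dist_le R 'rV[R]_d _ (nbhs y) (nbhs_filter (y : 'rV[R]_d)) id y
    cvg_id _ (divr_gt0 eps0 M0)).
apply: mx_norm_sqnorm_le; first exact: ltW.
have := smooth_lipschitz k w p z (y - z) k0 sm; rewrite (addrC z) subrK => h.
apply: le_trans h _.
have := sqnorm_mx_norm_le (y - z) => h2.
have h3 : M * `|y - z| <= eps by rewrite mulrC -ler_pdivlMr.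
have h4 : (M * `|y - z|) ^+ 2 <= eps ^+ 2.
  by rewrite ler_pXn2r ?nnegrE ?mulr_ge0 // ?ltW.
apply: le_trans h4; apply: (@le_trans _ _ (4 * k ^+ 2 * (d%:R * `|y - z| ^+ 2))).
  by apply: ler_wpM2l h2; rewrite mulr_ge0 ?sqr_ge0.
rewrite (_ : (M * _) ^+ 2 = 4 * k ^+ 2 * ((d%:R + 1) ^+ 2 * `|y - z| ^+ 2)).
  apply: ler_wpM2l; first by rewrite mulr_ge0 ?sqr_ge0.
  apply: ler_wpM2r; first exact: sqr_ge0.
  by have : 0 <= d%:R :> R by []; nra.
by rewrite /M; ring.
Unshelve. all: by end_near. Qed.

End Smooth.

Section ClosedConvex.
Context {R : realType} {d : nat}.
Implicit Types (x y z h : 'rV[R]_d) (c k r s t : R) (u v : 'rV[R]_d -> \bar R).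
Implicit Types (w : 'rV[R]_d -> R) (p : 'rV[R]_d -> 'rV[R]_d).
Local Open Scope ereal_scope.

Definition sup_affine (I : Type) (a : I -> R) (b : I -> 'rV[R]_d) z : \bar R :=
  ereal_sup [set (a i + dotv (b i) z)%R%:E | i in [set: I]].

Lemma sup_affine_ge I (a : I -> R) b i z :
  (a i + dotv (b i) z)%R%:E <= sup_affine I a b z.
Proof. by apply: ereal_sup_ubound; exists i. Qed.

Lemma sup_affine_lsc I (a : I -> R) b : lower_semicontinuous (sup_affine I a b).
Proof.
apply: lsc_ereal_sup => i.
rewrite (_ : (fun _ => _) = fun z => (a i)%:E + (dotv (b i) z)%:E).
  by apply: lscD_cont; [exact: lsc_cst|exact: dotvr_cont].
by apply/funext => z; rewrite EFinD.
Qed.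

Lemma sup_affine_convex I (a : I -> R) b : convex_efun (sup_affine I a b).
Proof.
move=> x y s s01; apply: ge_ereal_sup => _ [i _ <-].
have -> : (a i + dotv (b i) (s *: x + (1 - s) *: y))%R%:E =
    s%:E * (a i + dotv (b i) x)%R%:E + (1 - s)%:E * (a i + dotv (b i) y)%R%:E.
  by rewrite -!EFinM -EFinD !dotvE; congr _%:E; ring.
move: s01 => /andP[s0 s1].
by apply: leeD; apply: lee_wpmul2l; rewrite ?lee_fin ?subr_ge0 //; exact: sup_affine_ge.
Qed.

(** The way in which closed convex functions are produced below: convexity and
    lower semi-continuity are inherited from the affine functions. *)
Lemma closed_convex_sup_affine I (a : I -> R) b (i0 : I) z0 :
  sup_affine I a b z0 < +oo -> closed_convex (sup_affine I a b).
Proof.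
move=> fin; split; [|exact: sup_affine_convex|exact: sup_affine_lsc].
split=> [z|]; last by exists z0; rewrite lt_eqF.
by rewrite gt_eqF // (lt_le_trans _ (sup_affine_ge I a b i0 z)) // ltNyr.
Qed.

Lemma legendre_lsc u : lower_semicontinuous (legendre u).
Proof.
apply: (@lsc_ereal_sup _ _ _ (fun x y => (dotv x y)%:E - u x)) => x.
rewrite (_ : (fun _ => _) = fun y => - u x + (dotv x y)%:E); last first.
  by apply/funext => y; rewrite addeC.
by apply: lscD_cont; [exact: lsc_cst|exact: dotvr_cont].
Qed.

Lemma closed_convexZ a v : (0 < a)%R -> closed_convex v ->
  closed_convex (fun x => a%:E * v x).
Proof.
move=> a0 [[vN [x0 vx0]] cv lv]; split.
- split=> [x|].
    by have := vN x; case: (v x) => [r||] //; rewrite gt0_muley ?lte_fin.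
  exists x0; move: vx0 (vN x0); case: (v x0) => [r||] //.
- move=> x y s s01; have := cv x y s s01 => h.
  have -> : s%:E * (a%:E * v x) + (1 - s)%:E * (a%:E * v y) =
     a%:E * (s%:E * v x + (1 - s)%:E * v y).
    rewrite !muleA -!EFinM (mulrC s) (mulrC (1 - s)%R) !EFinM -!muleA muleDr //.
    move: s01 (vN x) (vN y) => /andP[s0 s1].
    have D0 (r : R) z : (0 <= r)%R -> v z != -oo -> r%:E * v z != -oo.
      move=> r0; case: (v z) => [q||] // _.
      by move: r0; rewrite le_eqVlt => /orP[/eqP <-|r0]; rewrite ?mul0e // gt0_muley ?lte_fin.
    move=> vx vy; have := D0 s x s0 vx; have := D0 (1 - s)%R y ltac:(by rewrite subr_ge0) vy.
    by case: (s%:E * v x); case: ((1 - s)%:E * v y).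
  by apply: lee_wpmul2l; rewrite ?lee_fin // ltW.
- move=> x b bx; have h : (a^-1 * b)%:E < v x.
    by rewrite EFinM lte_pdivrMl.
  have [V Vx Vv] := lv x _ h; exists V => // y /Vv.
  by rewrite EFinM lte_pdivrMl.
Qed.

End ClosedConvex.

(** * Admissible functions and Brenier potentials *)

Section Duality.
Context {R : realType} {d : nat}.
Implicit Types (x y z h : 'rV[R]_d) (c k r s t : R) (u v : 'rV[R]_d -> \bar R).
Implicit Types (w : 'rV[R]_d -> R) (p : 'rV[R]_d -> 'rV[R]_d).
Local Open Scope ereal_scope.

(** Converse of [strongly_admissible_legendre]. With the quadratic remainder,
    u - c|.|^2/2 is a supremum of affine functions, whence strong convexity; the
    transform of u is w because the supremum defining u is attained at p y. *)
Lemma smooth_legendre c w p : (0 < c)%R -> smooth_convex c^-1 w p ->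
  let u := legendre (EFin \o w) in
  [/\ strongly_admissible c u, forall y, legendre u y = (w y)%:E &
     forall y z, (dotv z y - w y + c / 2 * sqnorm (z - p y))%:E <= u z].
Proof.
move=> c0 sm u.
have uge y z : (dotv z y - w y)%:E <= u z.
  by apply: ereal_sup_ubound; exists y => //=; rewrite -EFinB dotvC.
have QG y z : (dotv z y - w y + c / 2 * sqnorm (z - p y))%:E <= u z.
  (* the maximiser of the quadratic lower bound on <z, .> - w *)
  apply: le_trans (uge (y + c *: (z - p y))%R z); rewrite lee_fin.
  have /andP[_] := sm y (c *: (z - p y))%R.
  rewrite sqnormZ !dotvE -[sqnorm (z - p y)]/(dotv _ _) !dotvE (dotvC (p y) z).
  have -> a : (c^-1 / 2 * (c ^+ 2 * a) = c / 2 * a)%R by field; lra.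
  lra.
have up y : u (p y) = (dotv (p y) y - w y)%:E.
  apply/eqP; rewrite eq_le uge andbT; apply: ge_ereal_sup => _ [z _ <-] /=.
  have /andP[+ _] := sm y (z - y)%R.
  rewrite (addrC y) subrK !dotvE -EFinB lee_fin (dotvC z); lra.
have lu y : legendre u y = (w y)%:E.
  rewrite (legendreE _ _ _ _ (up y)); first by congr _%:E; lra.
  by move=> z; apply: le_trans (uge y z); rewrite lee_fin !dotvE; lra.
have ue : (fun z => u z - (c * (sqnorm z / 2))%:E) = sup_affine _
    (fun y => - w y + c / 2 * sqnorm (p y))%R (fun y => y - c *: p y)%R.
  apply/funext => z; apply/eqP; rewrite eq_le; apply/andP; split.
    rewrite leeBlDr //; apply: ge_ereal_sup => _ [y _ <-] /=.
    apply: le_trans (leeD2r _ (sup_affine_ge _ _ (fun y => y - c *: p y)%R y z)).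
    rewrite -EFinB -EFinD lee_fin !dotvE.
    have := mulr_ge0 (ltW c0) (sqnorm_ge0 (z - p y)).
    by rewrite sqnormB (dotvC z (p y)); lra.
  apply: ge_ereal_sup => _ [y _ <-]; rewrite leeBrDr //.
  apply: le_trans (QG y z); rewrite -EFinD lee_fin sqnormB !dotvE.
  by rewrite (dotvC y z) (dotvC (p y) z); lra.
split=> //; split; last 2 first.
- by rewrite ue; exact: sup_affine_convex.
- by rewrite ue; exact: sup_affine_lsc.
split=> [z|]; last by exists (p 0%R); rewrite up.
by rewrite gt_eqF // (lt_le_trans _ (uge 0%R z)) // ltNyr.
Qed.

Lemma subgradient_closed_convex w p :
  (forall y h, w y + dotv (p y) h <= w (y + h))%R -> closed_convex (EFin \o w).
Proof.
move=> sg.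
have -> : EFin \o w = sup_affine _ (fun y => w y - dotv (p y) y)%R p.
  apply/funext => z; apply/eqP; rewrite eq_le; apply/andP; split => /=.
    by apply: le_trans (sup_affine_ge _ _ p z z); rewrite lee_fin; lra.
  apply: ge_ereal_sup => _ [y _ <-] /=; rewrite lee_fin.
  by have := sg y (z - y)%R; rewrite (addrC y) subrK !dotvE; lra.
apply: (closed_convex_sup_affine _ _ _ 0%R 0%R).
apply: (@le_lt_trans _ _ (w 0%R)%:E); last by rewrite ltry.
apply: ge_ereal_sup => _ [y _ <-] /=; rewrite lee_fin.
by have := sg y (- y)%R; rewrite subrr !dotvE; lra.
Qed.

(** Equality in the Fenchel inequality along the graph of a subgradient. *)
Lemma legendre_subgradient w p y :
  (forall y h, w y + dotv (p y) h <= w (y + h))%R ->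
  legendre (EFin \o w) (p y) = (dotv (p y) y - w y)%:E.
Proof.
move=> sg; rewrite (legendreE _ _ y (w y)) ?(dotvC y) // => z.
by rewrite lee_fin; have := sg y (z - y)%R; rewrite (addrC y) subrK dotvC.
Qed.

(** The candidate Brenier potential attached to [u]. Admissibility of [u] means
    exactly that it is closed and convex, and [depotential] is the inverse map. *)
Definition potential t u x := t%:E * u x - ((t - 1) * (sqnorm x / 2))%:E.
Definition depotential t v x := t^-1%:E * v x + ((t - 1) / t * (sqnorm x / 2))%:E.

Lemma depotentialK t v : (1 < t)%R -> potential t (depotential t v) = v.
Proof.
move=> t1; apply/funext => x; rewrite /potential /depotential.
have e : (t * t^-1 = 1)%R by field; lra.
case: (v x) => [r||].
- apply: (congr1 EFin (_ : t * (t^-1 * r + (t - 1) / t * (sqnorm x / 2)) -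
    (t - 1) * (sqnorm x / 2) = r)%R); field; lra.
- rewrite gt0_muley ?lte_fin ?invr_gt0; [|lra].
  by rewrite addye // gt0_muley ?lte_fin; [|lra]; rewrite addye.
- rewrite gt0_muleNy ?lte_fin ?invr_gt0; [|lra].
  by rewrite addNye gt0_muleNy ?lte_fin; [|lra]; rewrite addNye.
Qed.

Lemma potentialK t u : (1 < t)%R -> depotential t (potential t u) = u.
Proof.
move=> t1; apply/funext => x; rewrite /potential /depotential.
case: (u x) => [r||].
- apply: (congr1 EFin (_ : t^-1 * (t * r - (t - 1) * (sqnorm x / 2)) +
    (t - 1) / t * (sqnorm x / 2) = r)%R); field; lra.
- rewrite gt0_muley ?lte_fin; [|lra].
  by rewrite addye // gt0_muley ?lte_fin ?invr_gt0; [|lra]; rewrite addye.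
- rewrite gt0_muleNy ?lte_fin; [|lra].
  by rewrite addNye gt0_muleNy ?lte_fin ?invr_gt0; [|lra]; rewrite addNye.
Qed.

Lemma potentialE t u x : (1 < t)%R -> 
  potential t u x = t%:E * (u x - ((t - 1) / t * (sqnorm x / 2))%:E).
Proof.
move=> t1; rewrite /potential; case: (u x) => [r||].
- apply: (congr1 EFin (_ : t * r - (t - 1) * (sqnorm x / 2) =
    t * (r - (t - 1) / t * (sqnorm x / 2)))%R); field; lra.
- by rewrite gt0_muley ?lte_fin ?addye ?gt0_muley ?lte_fin //; lra.
- by rewrite gt0_muleNy ?lte_fin ?addNye ?gt0_muleNy ?lte_fin //; lra.
Qed.

Lemma admissible_potential t u : (1 < t)%R ->
  admissible t u <-> closed_convex (potential t u).
Proof.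
move=> t1; have t0 : (0 < t)%R by lra.
split=> [[pu cu lu]|cv].
  have : closed_convex (fun x => u x - ((t - 1) / t * (sqnorm x / 2))%:E).
    split=> //; move: pu => [uN [x0 ux0]]; split=> [x|].
      by have := uN x; case: (u x).
    by exists x0; move: ux0; case: (u x0).
  move/(closed_convexZ _ _ t0); congr closed_convex.
  by apply/funext => x; rewrite potentialE.
have := closed_convexZ _ _ (ltac:(by rewrite invr_gt0) : 0 < t^-1)%R cv.
have -> : (fun x => t^-1%:E * potential t u x) = 
   (fun x => u x - ((t - 1) / t * (sqnorm x / 2))%:E).
  apply/funext => x; rewrite potentialE // muleA -EFinM mulVf ?mul1e //; lra.
move=> [[uN [x0 ux0]] cw lw]; split=> //; split=> [x|].
  by have := uN x; case: (u x).
by exists x0; move: ux0; case: (u x0).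
Qed.

Lemma legendre_gtNy u y : (exists x, u x != +oo) -> -oo < legendre u y.
Proof.
move=> [x ux]; apply: (@lt_le_trans _ _ ((dotv x y)%:E - u x)).
  by move: ux; case: (u x) => [r||] // _; rewrite ltNyr.
by apply: ereal_sup_ubound; exists x.
Qed.

Lemma legendre_ge u y x r : u x = r%:E -> (dotv x y - r)%:E <= legendre u y.
Proof. by move=> ux; apply: ereal_sup_ubound; exists x => //; rewrite ux. Qed.

Lemma fenchel_young u x y : proper_fun u -> (dotv x y)%:E <= legendre u x + u y.
Proof.
move=> [uN uy]; have := legendre_gtNy u x uy; have := uN y.
case uyE : (u y) => [r||] // _ h.
  by rewrite -leeBlDr // -EFinB dotvC; exact: legendre_ge.
by rewrite addey ?leey // gt_eqF.
Qed.

(** The difference of the two sides is a sum of a Fenchel gap and of a square: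
    the quadratic part of the infimal convolution is bounded at a given [x]. *)
Lemma legendre_depotential t v x y : (1 < t)%R -> proper_fun v ->
  legendre (depotential t v) y <=
  t^-1%:E * legendre v x + (sqnorm (t *: y - x) / (2 * t * (t - 1)))%:E.
Proof.
move=> t1 [vN vy]; have t0 : (0 < t)%R by lra.
apply: ge_ereal_sup => _ [z _ <-]; rewrite /depotential.
have := legendre_gtNy v x vy; have := vN z; case vz : (v z) => [r||] // _ lN.
  have := legendre_ge v x z r vz; move: lN; case: (legendre v x) => [l||] // _; last first.
    by move=> _; rewrite gt0_muley ?lte_fin ?invr_gt0 // addye // leey.
  rewrite lee_fin => h.
  suff : (dotv z y - (t^-1 * r + (t - 1) / t * (sqnorm z / 2)) <=
    t^-1 * l + sqnorm (t *: y - x) / (2 * t * (t - 1)))%R by rewrite -lee_fin.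
  rewrite -subr_ge0.
  have -> : (t^-1 * l + sqnorm (t *: y - x) / (2 * t * (t - 1)) -
    (dotv z y - (t^-1 * r + (t - 1) / t * (sqnorm z / 2))) =
    t^-1 * (l - (dotv z x - r)) +
    (2 * t * (t - 1))^-1 * sqnorm (t *: y - x - (t - 1) *: z))%R.
    rewrite !sqnormB !sqnormZ !dotvE (dotvC y z) (dotvC x z); field.
    by rewrite !gt_eqF ?mulr_gt0 //; lra.
  rewrite addr_ge0 ?mulr_ge0 ?sqnorm_ge0 ?invr_ge0 ?mulr_ge0 ?subr_ge0 //; lra.
by rewrite gt0_muley ?lte_fin ?invr_gt0 // addye // leNye.
Qed.

End Duality.

Section Extrapolation.
Context {R : realType} {d : nat}.
Implicit Types (x y z h : 'rV[R]_d) (u v : 'rV[R]_d -> \bar R).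
Variables (t : R) (t1 : 1 < t) (u : 'rV[R]_d -> \bar R) (au : admissible t u).
Local Notation w := (fun y => fine (legendre u y)).
Local Notation p := (gradient (legendre u)).
Local Notation c := ((t - 1) / t).

Lemma c_gt0 : 0 < c.
Proof. have t1' := t1; apply: divr_gt0; lra. Qed.

Lemma admissible_legendre :
  [/\ forall y, legendre u y = (w y)%:E,
      smooth_convex c^-1 w p,
      forall y z, ((dotv z y - w y + c / 2 * sqnorm (z - p y))%:E <= u z)%E &
      forall y, u (p y) = (dotv (p y) y - w y)%:E].
Proof. exact: strongly_admissible_legendre c_gt0 au. Qed.

(** The Fenchel inequality with remainder for [u], multiplied by [t], is a
    Fenchel inequality for the potential at T y. *)
Lemma legendre_potential y :
  (legendre (potential t u) (extrapolation_map t u y) <=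
  (t * w y - (t - 1) / 2 * sqnorm (p y))%:E)%E.
Proof.
have t1' := t1; have [_ _ QG _] := admissible_legendre.
apply: ge_ereal_sup => _ [z _ <-]; rewrite /potential.
have := QG y z; have [[uN _] _ _] := au.
have := uN z; case: (u z) => [r||] // _; last first.
  by rewrite gt0_muley ?lte_fin ?addye ?leNye //; lra.
rewrite lee_fin sqnormB (dotvC z (p y)) => h.
have t0 : 0 < t by lra.
suff : dotv z (extrapolation_map t u y) - (t * r - (t - 1) * (sqnorm z / 2)) <=
   t * w y - (t - 1) / 2 * sqnorm (p y) by rewrite -lee_fin.
rewrite /extrapolation_map !dotvE (dotvC z (p y)).
have : t * (dotv z y - w y + (t - 1) / t / 2 * (sqnorm z - 2 * dotv (p y) z + sqnorm (p y))) <= t * r.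
  by rewrite ler_pM2l.
have -> : t * (dotv z y - w y + (t - 1) / t / 2 * (sqnorm z - 2 * dotv (p y) z + sqnorm (p y)))
 = t * (dotv z y - w y) + (t - 1) / 2 * (sqnorm z - 2 * dotv (p y) z + sqnorm (p y)).
  by field; lra.
rewrite (dotvC z); lra.
Qed.

(** The finite version of the Brenier potential from nu1, with gradient T. *)
Definition forward_potential y : R := - ((t - 1) * w y) + t * (sqnorm y / 2).

(** Since w has curvature at most t / (t - 1), subtracting (t - 1) w from
    t|.|^2/2 leaves a convex function. *)
Lemma forward_potential_subgradient y h :
  forward_potential y + dotv (extrapolation_map t u y : 'rV[R]_d) h <= forward_potential (y + h).
Proof.
have t1' := t1; have [_ sm _ _] := admissible_legendre.
have /andP[_] := sm y h; rewrite /forward_potential /extrapolation_map.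
rewrite sqnormD !dotvE.
have t0 : 0 < t - 1 by lra.
rewrite -(ler_pM2l t0).
have -> : (t - 1) * (w y + dotv (p y) h + c^-1 / 2 * sqnorm h) =
  (t - 1) * (w y + dotv (p y) h) + t / 2 * sqnorm h by field; lra.
lra.
Qed.

End Extrapolation.

(** * Integrals of functions bounded below by an integrable one *)

Section Expectation.
Context {disp : measure_display} {T : measurableType disp} {R : realType}.
Variable P : probability T R.
Implicit Types (f g : T -> R) (F G : T -> \bar R).

Definition intg f := P.-integrable setT (EFin \o f).
Definition Ex f : R := Rintegral P setT f.

Lemma intg_measurable f : intg f -> measurable_fun setT f.
Proof. by move=> /measurable_int /measurable_EFinP. Qed.

Lemma intgD f g : intg f -> intg g -> intg (fun x => f x + g x).
Proof.
move=> hf hg; rewrite /intg (_ : _ \o _ = (EFin \o f) \+ (EFin \o g))%E //.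
exact: integrableD.
Qed.

Lemma intgZ a f : intg f -> intg (fun x => a * f x).
Proof. by move=> hf; apply: (integrableZl measurableT a hf). Qed.

Lemma intgN f : intg f -> intg (fun x => - f x).
Proof. by move=> hf; exact: integrableN hf. Qed.

Lemma intgB f g : intg f -> intg g -> intg (fun x => f x - g x).
Proof. by move=> hf hg; apply: intgD => //; exact: intgN. Qed.

Lemma intg_cst a : intg (fun _ => a).
Proof. by apply: finite_measure_integrable_cst. Qed.

Lemma intg_sum (I : Type) (s : seq I) (f : I -> T -> R) :
  (forall i, intg (f i)) -> intg (fun x => \sum_(i <- s) f i x).
Proof.
move=> hf; elim: s => [|i s IH].
  by under [X in intg X]eq_fun do rewrite big_nil; exact: intg_cst.
by under [X in intg X]eq_fun do rewrite big_cons; exact: intgD.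
Qed.

Lemma le_intg f g : measurable_fun setT f -> (forall x, `|f x| <= g x) ->
  intg g -> intg f.
Proof.
move=> mf fg hg; apply: (le_integrable measurableT _ _ hg).
  exact/measurable_EFinP.
move=> x _ /=; rewrite lee_fin; apply: le_trans (fg x) _; exact: ler_norm.
Qed.

Lemma ExE f : intg f -> (\int[P]_x (f x)%:E)%E = (Ex f)%:E.
Proof. by move=> hf; rewrite /Ex /Rintegral fineK //; exact: integrable_fin_num. Qed.

Lemma ExD f g : intg f -> intg g -> Ex (fun x => f x + g x) = Ex f + Ex g.
Proof. by move=> hf hg; rewrite /Ex RintegralD. Qed.

Lemma ExB f g : intg f -> intg g -> Ex (fun x => f x - g x) = Ex f - Ex g.
Proof. by move=> hf hg; rewrite /Ex RintegralB. Qed.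

Lemma ExZ a f : intg f -> Ex (fun x => a * f x) = a * Ex f.
Proof. by move=> hf; rewrite /Ex RintegralZl. Qed.

Lemma ExN f : intg f -> Ex (fun x => - f x) = - Ex f.
Proof.
move=> hf; rewrite -mulN1r -ExZ //; congr Ex.
by apply/funext => x; rewrite mulN1r.
Qed.

Lemma Ex_cst a : Ex (fun _ => a) = a.
Proof.
rewrite /Ex Rintegral_cst //.
by rewrite -[RHS]mulr1; exact: (congr1 (fun e : \bar R => a * fine e) (probability_setT P)).
Qed.

Lemma Ex_sum (I : Type) (s : seq I) (f : I -> T -> R) :
  (forall i, intg (f i)) -> Ex (fun x => \sum_(i <- s) f i x) = \sum_(i <- s) Ex (f i).
Proof.
move=> hf; elim: s => [|i s IH].
  by rewrite big_nil; under [X in Ex X]eq_fun do rewrite big_nil; exact: Ex_cst.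
rewrite big_cons -IH; under [X in Ex X]eq_fun do rewrite big_cons.
by rewrite ExD //; exact: intg_sum.
Qed.

Lemma Ex_le f g : intg f -> intg g -> (forall x, f x <= g x) -> Ex f <= Ex g.
Proof. by move=> hf hg fg; apply: le_Rintegral. Qed.

Lemma Ex_ge0 f : (forall x, 0 <= f x) -> 0 <= Ex f.
Proof. by move=> f0; apply: Rintegral_ge0. Qed.

Local Open Scope ereal_scope.

(** Monotonicity without integrability: the integral of an extended-valued
    function is a difference of integrals of nonnegative functions, each of
    which is monotone. *)
Lemma integral_le F G : measurable_fun setT F -> measurable_fun setT G ->
  (forall x, F x <= G x) -> \int[P]_x F x <= \int[P]_x G x.
Proof.
move=> mF mG FG; rewrite [leLHS]integralE [leRHS]integralE.
apply: leeB; apply: ge0_le_integral => //;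
  try exact: measurable_funepos; try exact: measurable_funeneg.
- move=> x _; have /(_ x) := @funepos_le _ _ setT F G (fun y _ => FG y).
  by rewrite inE; apply.
- move=> x _; have /(_ x) := @funeneg_le _ _ setT F G (fun y _ => FG y).
  by rewrite inE; apply.
Qed.

(** The functions for which the integral is additive although it may be [+oo]:
    the form oo - oo cannot occur. *)
Definition minorized F := measurable_fun setT F /\
  exists2 q : T -> R, intg q & forall x, (q x)%:E <= F x.

Lemma integral_ge0_addq F q : measurable_fun setT F -> (forall x, 0 <= F x) ->
  intg q -> \int[P]_x (F x + (q x)%:E) = \int[P]_x F x + (Ex q)%:E.
Proof.
move=> mF F0 hq.
have mq := intg_measurable _ hq.
have mFq : measurable_fun setT (fun x => F x + (q x)%:E).
  by apply: emeasurable_funD => //; exact/measurable_EFinP.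
have [Foo|Foo] := ltP (\int[P]_x F x) +oo.
  have iF : P.-integrable setT F.
    apply/integrableP; split => //.
    by under eq_integral do rewrite gee0_abs //.
  by rewrite (integralD measurableT iF hq) ExE.
have {}Foo : \int[P]_x F x = +oo by apply/eqP; rewrite -leye_eq.
rewrite Foo addye //.
(* F has an infinite integral and H differs from it by an integrable
   function: its negative part stays integrable, its positive part does not. *)
pose H x := F x + (q x)%:E.
have hn : intg (fun x => `|q x|%R) by exact: integrable_norm hq.
have mH : measurable_fun setT H by [].
have Hn : \int[P]_x H^\- x < +oo.
  apply: le_lt_trans (_ : \int[P]_x (`|q x|%R)%:E < _); last by rewrite ExE // ltry.
  apply: ge0_le_integral => //.
  - exact: measurable_funeneg.
  - exact: measurable_int hn.
  - move=> x _; rewrite funenegE ge_max lee_fin normr_ge0 andbT /H.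
    have := F0 x; case: (F x) => [r||] //; last by rewrite leNye.
    by rewrite -EFinD -EFinN !lee_fin => r0; have := ler_norm (- q x)%R; rewrite normrN; lra.
have Hp : \int[P]_x H^\+ x = +oo.
  apply/eqP; rewrite -leye_eq leNgt; apply/negP => lt.
  suff : \int[P]_x F x < +oo by rewrite Foo ltxx.
  apply: le_lt_trans (_ : \int[P]_x (H^\+ x + (`|q x|%R)%:E) < _).
    apply: ge0_le_integral => //.
    - by apply: emeasurable_funD; [exact: measurable_funepos|exact: measurable_int hn].
    - move=> x _; apply: (@le_trans _ _ (H x + (`|q x|%R)%:E)).
        rewrite /H; have := F0 x; case: (F x) => [r||] // _.
        by rewrite -!EFinD lee_fin; have := ler_norm (- q x)%R; rewrite normrN; lra.
      by rewrite leeD2r // funeposE le_max lexx.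
  rewrite ge0_integralD //; [|exact: measurable_funepos|exact: measurable_int hn].
  by rewrite ExE // lte_add_pinfty // ltry.
by rewrite integralE Hp addye //; move: Hn; case: (\int[P]_x H^\- x).
Qed.

Lemma minorized_addq F q : minorized F -> intg q -> minorized (fun x => F x + (q x)%:E).
Proof.
move=> [mF [r hr rF]] hq; split.
  by apply: emeasurable_funD => //; exact: measurable_int hq.
by exists (fun x => r x + q x)%R; [exact: intgD|move=> x; rewrite EFinD leeD2r].
Qed.

Lemma integral_addq F q : minorized F -> intg q ->
  \int[P]_x (F x + (q x)%:E) = \int[P]_x F x + (Ex q)%:E.
Proof.
move=> [mF [r hr rF]] hq.
have hN : intg (fun x => - r x)%R by exact: intgN.
have mG : measurable_fun setT (fun x => F x + (- r x)%:E).
  by apply: emeasurable_funD => //; exact: measurable_int hN.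
have G0 x : 0 <= F x + (- r x)%:E by rewrite EFinN sube_ge0.
have e x : F x = F x + (- r x)%:E + (r x)%:E by rewrite EFinN subeK.
have -> : \int[P]_x F x = \int[P]_x (F x + (- r x)%:E + (r x)%:E).
  by apply: eq_integral => x _; exact: e.
have -> : \int[P]_x (F x + (q x)%:E) =
    \int[P]_x (F x + (- r x)%:E + (r x + q x)%:E).
  by apply: eq_integral => x _; rewrite EFinD addeA -e.
rewrite (integral_ge0_addq _ _ mG G0 hr).
rewrite (integral_ge0_addq _ _ mG G0 (intgD _ _ hr hq)).
by rewrite ExD // EFinD addeA.
Qed.

Lemma minorized_gtNy F : minorized F -> -oo < \int[P]_x F x.
Proof.
move=> [mF [r hr rF]]; apply: (@lt_le_trans _ _ (\int[P]_x (r x)%:E)).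
  by rewrite ExE // ltNyr.
by apply: integral_le => //; exact: measurable_int hr.
Qed.

Lemma integral_minorizedD F G : minorized F -> minorized G ->
  \int[P]_x (F x + G x) = \int[P]_x F x + \int[P]_x G x.
Proof.
move=> hF hG; have [mF [r hr rF]] := hF; have [mG [s hs sG]] := hG.
have hrN : intg (fun x => - r x)%R by exact: intgN.
have hsN : intg (fun x => - s x)%R by exact: intgN.
have := integral_addq _ _ hF hrN; have := integral_addq _ _ hG hsN.
set IF := \int[P]_x F x; set IG := \int[P]_x G x => eG eF.
have F0 x : 0 <= F x + (- r x)%:E by rewrite EFinN sube_ge0.
have G0 x : 0 <= G x + (- s x)%:E by rewrite EFinN sube_ge0.
have mF' : measurable_fun setT (fun x => F x + (- r x)%:E).
  by apply: emeasurable_funD => //; exact: measurable_int hrN.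
have mG' : measurable_fun setT (fun x => G x + (- s x)%:E).
  by apply: emeasurable_funD => //; exact: measurable_int hsN.
have hrs : intg (fun x => r x + s x)%R by exact: intgD.
have -> : \int[P]_x (F x + G x) = \int[P]_x
    ((F x + (- r x)%:E) + (G x + (- s x)%:E) + (r x + s x)%:E).
  apply: eq_integral => x _; case: (F x) => [a||]; case: (G x) => [b||] //.
  apply: (congr1 EFin (_ : (a + b = a + - r x + (b + - s x) + (r x + s x))%R)); lra.
rewrite integral_ge0_addq //; last 2 first.
- exact: emeasurable_funD.
- by move=> x; rewrite adde_ge0.
rewrite ge0_integralD // eF eG ExD // EFinD addeACA.
rewrite !ExN //; clear eF eG; case: (IF) => [a||]; case: (IG) => [b||] //.
apply: (congr1 EFin (_ : (a + b + (- Ex r - Ex s) + (Ex r + Ex s) = a + b)%R)); lra.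
Qed.

Lemma minorizedZ a F : (0 <= a)%R -> minorized F -> minorized (fun x => a%:E * F x).
Proof.
move=> a0 [mF [r hr rF]]; split; first exact: measurable_funeM.
exists (fun x => a * r x)%R; first exact: intgZ.
by move=> x; rewrite EFinM lee_wpmul2l.
Qed.

Lemma integral_minorizedZ a F : (0 <= a)%R -> minorized F ->
  \int[P]_x (a%:E * F x) = a%:E * \int[P]_x F x.
Proof.
move=> a0 hF; have [mF [r hr rF]] := hF.
have F0 x : 0 <= F x + (- r x)%:E by rewrite EFinN sube_ge0.
have hrN : intg (fun x => - r x)%R by exact: intgN.
have mG : measurable_fun setT (fun x => F x + (- r x)%:E).
  by apply: emeasurable_funD => //; exact: measurable_int hrN.
have -> : \int[P]_x (a%:E * F x) =
    \int[P]_x (a%:E * (F x + (- r x)%:E) + (a * r x)%:E).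
  apply: eq_integral => x _; rewrite EFinM -muleDr ?fin_num_adde_defl //.
  by rewrite EFinN subeK.
rewrite integral_ge0_addq //; last 3 first.
- exact: measurable_funeM.
- by move=> x; rewrite mule_ge0.
- exact: intgZ.
rewrite ge0_integralZl_EFin // integral_addq // ExZ //.
rewrite muleDr ?fin_num_adde_defl // -addeA -EFinM -EFinD.
by rewrite ExN // mulrN addNr adde0.
Qed.

End Expectation.

(** * Laws of random vectors *)

Section Law.
Context {d1 d2 : measure_display} {T : measurableType d1} {U : measurableType d2}.
Context {R : realType}.
Variables (P : probability T R) (X : T -> U) (mu : probability U R).

(** Laws are specified by their values on measurable sets only, as a
    pushforward measure need not agree with a given one elsewhere. *)
Definition has_law := measurable_fun setT X /\
  forall A, measurable A -> P (X @^-1` A) = mu A.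

Local Open Scope ereal_scope.

Hypothesis law : has_law.

Lemma law_integral_ge0 (f : U -> \bar R) : measurable_fun setT f ->
  (forall x, 0 <= f x) -> \int[mu]_x f x = \int[P]_x f (X x).
Proof.
move=> mf f0; have [mX PX] := law.
have := @ge0_integral_pushforward _ _ _ _ R _ mX P setT f measurableT mf (fun y _ => f0 y).
rewrite preimage_setT => <-.
by apply: eq_measure_integral => A mA _; exact: esym (PX _ mA).
Qed.

Lemma law_integral (f : U -> \bar R) : measurable_fun setT f ->
  \int[mu]_x f x = \int[P]_x f (X x).
Proof.
move=> mf.
have mp := measurable_funepos mf; have mn := measurable_funeneg mf.
have ep := law_integral_ge0 _ mp (funepos_ge0 f).
have en := law_integral_ge0 _ mn (funeneg_ge0 f).
rewrite [LHS]integralE [RHS]integralE ep en.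
by congr (_ - _); apply: eq_integral => x _; rewrite ?funeposE ?funenegE.
Qed.

Lemma law_intg (f : U -> R) : intg mu f -> intg P (fun x => f (X x)).
Proof.
move=> hf; have mf := measurable_int _ hf; have [mX _] := law.
apply/integrableP; split.
  by apply: (measurableT_comp mf mX).
have /integrableP[_] := hf; congr (_ < _).
by rewrite (law_integral_ge0 (fun x => `|(f x)%:E|)) //; exact: measurableT_comp.
Qed.

Lemma law_intg_inv (f : U -> R) : measurable_fun setT f ->
  intg P (fun x => f (X x)) -> intg mu f.
Proof.
move=> mf hf; apply/integrableP; split; first exact/measurable_EFinP.
have /integrableP[_] := hf; congr (_ < _).
rewrite (law_integral_ge0 (fun x => `|(f x)%:E|)) //.
by apply: measurableT_comp => //; exact/measurable_EFinP.
Qed.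

Lemma law_Ex (f : U -> R) : measurable_fun setT f ->
  Ex P (fun x => f (X x)) = Ex mu f.
Proof.
move=> mf; rewrite /Ex /Rintegral (law_integral (EFin \o f)) //.
exact/measurable_EFinP.
Qed.

End Law.

Section RandomVectors.
Context {R : realType} {d : nat} {disp : measure_display} {T : measurableType disp}.
Implicit Types (X Y : T -> 'rV[R]_d) (x y : 'rV[R]_d).

(** Coordinatewise measurability, the form that sums and scalar products
    preserve directly. *)
Definition mvec X := forall i, measurable_fun setT (fun w => X w ord0 i).

Lemma mvecD X Y : mvec X -> mvec Y -> mvec (fun w => X w + Y w).
Proof.
move=> hX hY i; under eq_fun do rewrite mxE.
exact: measurable_funD (hX i) (hY i).
Qed.

Lemma mvecZ a X : mvec X -> mvec (fun w => a *: X w).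
Proof.
move=> hX i; under eq_fun do rewrite mxE.
by apply: measurable_funM => //; exact: hX.
Qed.

Lemma measurable_dotv X Y : mvec X -> mvec Y ->
  measurable_fun setT (fun w => dotv (X w) (Y w)).
Proof.
move=> hX hY; rewrite /dotv; apply: measurable_sum => i.
exact: measurable_funM (hX i) (hY i).
Qed.

Variable P : probability T R.

Definition L2 X := mvec X /\ intg P (fun w => sqnorm (X w)).

Lemma L2_sqnorm X : L2 X -> intg P (fun w => sqnorm (X w)). Proof. by case. Qed.

Lemma L2_dotv X Y : L2 X -> L2 Y -> intg P (fun w => dotv (X w) (Y w)).
Proof.
move=> [mX hX] [mY hY]; apply: (le_intg _ _ _ _ _ (intgD _ _ _ hX hY)).
  exact: measurable_dotv.
move=> w; have := sqnorm_ge0 (X w - Y w); have := sqnorm_ge0 (X w + Y w).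
rewrite sqnormB sqnormD => h1 h2; have := sqnorm_ge0 (X w); have := sqnorm_ge0 (Y w).
by rewrite ler_norml; lra.
Qed.

Lemma L2D X Y : L2 X -> L2 Y -> L2 (fun w => X w + Y w).
Proof.
move=> hX hY; split; first by apply: mvecD; [case: hX|case: hY].
under eq_fun do rewrite sqnormD.
apply: intgD; last exact: L2_sqnorm.
by apply: intgD; [exact: L2_sqnorm|apply: intgZ; exact: L2_dotv].
Qed.

Lemma L2Z a X : L2 X -> L2 (fun w => a *: X w).
Proof.
move=> [mX hX]; split; first exact: mvecZ.
by under eq_fun do rewrite sqnormZ; exact: intgZ.
Qed.

Lemma L2B X Y : L2 X -> L2 Y -> L2 (fun w => X w - Y w).
Proof.
move=> hX hY; have := L2D _ _ hX (L2Z (-1) _ hY).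
by under eq_fun do rewrite scaleN1r.
Qed.

Lemma L2_cst x : L2 (fun _ => x).
Proof. by split; [move=> i; exact: measurable_cst|exact: intg_cst]. Qed.

Lemma L2_le X Y k1 k2 : mvec X -> L2 Y ->
  (forall w, sqnorm (X w) <= k1 + k2 * sqnorm (Y w)) -> L2 X.
Proof.
move=> mX [mY hY] XY; split=> //.
apply: (le_intg _ _ _ _ _ (intgD _ _ _ (intg_cst P k1) (intgZ P k2 _ hY))).
  exact: measurable_dotv.
by move=> w; rewrite ger0_norm ?sqnorm_ge0.
Qed.

End RandomVectors.

Section Borel.
Context {R : realType} {d : nat}.
Local Notation V := (borelRd R d).

Lemma open_measurable_Rd (A : set 'rV[R]_d) : open A -> measurable (A : set V).
Proof. by move=> oA; exact: sub_sigma_algebra. Qed.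

(** The rays ]a, +oo] generate the Borel sets, and their preimages are open. *)
Lemma lsc_measurable (f : 'rV[R]_d -> \bar R) : lower_semicontinuous f ->
  measurable_fun setT (f : V -> \bar R).
Proof.
move=> lf; apply: (measurability _ (ErealGenOInfty.measurableE R)).
move=> /= _ [_ [a ->]] <-; apply: measurableI => //; apply: open_measurable_Rd.
by rewrite preimage_itvoy; move/lower_semicontinuousP : lf; exact.
Qed.

Lemma continuous_measurable_Rd (f : 'rV[R]_d -> R) : continuous f ->
  measurable_fun setT (f : V -> R).
Proof.
move=> cf; apply/measurable_EFinP; apply: (lsc_measurable (EFin \o f)).
rewrite (_ : EFin \o f = fun x => 0%:E + (f x)%:E)%E.
  by apply: lscD_cont => //; exact: lsc_cst.
by apply/funext => x /=; rewrite add0e.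
Qed.

Lemma mvec_id : mvec (fun x : V => x : 'rV[R]_d).
Proof. by move=> i; apply: continuous_measurable_Rd; exact: coord_cont. Qed.

Lemma continuous_measurable_map (f : 'rV[R]_d -> 'rV[R]_d) : continuous f ->
  measurable_fun setT (f : V -> V).
Proof.
move=> cf; apply: (measurability (@open 'rV[R]_d : set (set V))) => //.
move=> _ [B oB <-]; apply: measurableI => //; apply: open_measurable_Rd.
by move/continuousP : cf; apply.
Qed.

Lemma measurable_mvec {disp} {T : measurableType disp} (X : T -> V) :
  measurable_fun setT X -> mvec (X : T -> 'rV[R]_d).
Proof. by move=> mX i; exact: (measurableT_comp (mvec_id i) mX). Qed.

End Borel.

(** * Couplings and the Wasserstein cost *)

Section Joint.
Context {R : realType} {d1 d2 d3 : measure_display}.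
Context {T : measurableType d1} {U : measurableType d2} {W : measurableType d3}.

Lemma exists_law (P : probability T R) (X : T -> U) : measurable_fun setT X ->
  exists mu : probability U R, has_law P X mu.
Proof.
move=> mX; pose m := isMeasurableFun.Build _ _ _ _ _ mX.
pose X' : {mfun T >-> U} := HB.pack X m.
by exists (distribution P X').
Qed.

Lemma has_law_comp (P : probability T R) (X : T -> U) mu (f : U -> W) nu :
  has_law P X mu -> has_law mu f nu -> has_law P (f \o X) nu.
Proof.
move=> [mX PX] [mf Pf]; split; first exact: measurableT_comp.
move=> A mA; rewrite -Pf // -PX //.
by rewrite -[X in measurable X]setTI; exact: mf.
Qed.

Lemma has_law_fst (P : probability T R) (Q : probability U R) :
  has_law (P \x Q)%E fst P.
Proof.
split; first exact: measurable_fst.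
move=> A mA; rewrite (_ : fst @^-1` A = A `*` setT).
  apply: etrans (product_measure1E P Q mA measurableT) _.
  exact: etrans (congr1 (fun e => P A * e)%E (probability_setT Q)) (mule1 _).
by apply/seteqP; split=> -[x y] //= [].
Qed.

Lemma has_law_snd (P : probability T R) (Q : probability U R) :
  has_law (P \x Q)%E snd Q.
Proof.
split; first exact: measurable_snd.
move=> A mA; rewrite (_ : snd @^-1` A = setT `*` A).
  apply: etrans (product_measure1E P Q measurableT mA) _.
  exact: etrans (congr1 (fun e => e * Q A)%E (probability_setT P)) (mul1e _).
by apply/seteqP; split=> -[x y] //= [].
Qed.

End Joint.

Section Wasserstein.
Context {R : realType} {d : nat}.
Local Notation V := (borelRd R d).
Implicit Types (mu nu : probability V R).

Lemma in_P2P mu : in_P2 mu <-> L2 mu (fun x : V => x : 'rV[R]_d).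
Proof.
have msq : measurable_fun setT (fun x : V => sqnorm (x : 'rV[R]_d)).
  exact: measurable_dotv mvec_id mvec_id.
rewrite /in_P2 /second_moment; split=> [h|[_ h]].
  split; first exact: mvec_id.
  apply/integrableP; split; first exact/measurable_EFinP.
  under eq_integral do rewrite /= ger0_norm ?sqnorm_ge0 //.
  exact: h.
by rewrite ExE // ltry.
Qed.

Section random.
Context {disp : measure_display} {T : measurableType disp}.
Variables (P : probability T R) (X Y : T -> V) (mu nu : probability V R).
Hypotheses (lX : has_law P X mu) (lY : has_law P Y nu).

Lemma law_L2 (f : V -> 'rV[R]_d) : L2 mu f -> L2 P (fun w => f (X w)).
Proof.
move=> [mf hf]; split; last exact: (law_intg _ _ _ lX _ hf).
by move=> i; apply: (measurableT_comp (mf i)); case: lX.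
Qed.

(** Any pair of random vectors with the right laws yields a coupling, so that
    couplings can be built on any convenient probability space. *)
Lemma W2sq_le : (W2sq mu nu <= \int[P]_w (sqnorm (X w - Y w : 'rV[R]_d))%:E)%E.
Proof.
have [[mX PX] [mY PY]] := (lX, lY).
have mXY : measurable_fun setT (fun w => (X w, Y w)) by exact: measurable_fun_pair.
have [g lg] := exists_law P _ mXY.
apply: ereal_inf_lbound; exists g => /=.
  split=> A mA.
    rewrite -PX //; have [_ <-] // := lg.
    by rewrite -[X in measurable X]setTI; exact: measurable_fst.
  rewrite -PY //; have [_ <-] // := lg.
  by rewrite -[X in measurable X]setTI; exact: measurable_snd.
rewrite (law_integral_ge0 _ _ _ lg (fun z => (sqnorm (z.1 - z.2 : 'rV[R]_d))%:E)) //.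
- apply/measurable_EFinP; apply: measurable_dotv.
    by apply: mvecD; [|under eq_fun do rewrite -scaleN1r; apply: mvecZ];
      apply: measurable_mvec; [exact: measurable_fst|exact: measurable_snd].
  by apply: mvecD; [|under eq_fun do rewrite -scaleN1r; apply: mvecZ];
      apply: measurable_mvec; [exact: measurable_fst|exact: measurable_snd].
- by move=> z; rewrite lee_fin sqnorm_ge0.
Qed.

Local Open Scope ereal_scope.

Lemma law_minorized (f : V -> \bar R) : minorized mu f -> minorized P (fun w => f (X w)).
Proof.
move=> [mf [q hq qf]]; split; first by apply: (measurableT_comp mf); case: lX.
by exists (fun w => q (X w)); [exact: (law_intg _ _ _ lX _ hq)|].
Qed.

End random.

(** Kantorovich's inequality, on an arbitrary probability space carrying the
    two marginals. *)
Lemma weak_duality {disp} {T : measurableType disp} (P : probability T R)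
   (X Y : T -> V) mu nu (f g : V -> \bar R) (h : T -> R) :
  has_law P X mu -> has_law P Y nu -> minorized mu f -> minorized nu g -> intg P h ->
  (forall w, ((h w)%:E <= f (X w) + g (Y w))%E) ->
  ((Ex P h)%:E <= \int[mu]_x f x + \int[nu]_y g y)%E.
Proof.
move=> lX lY hf hg hh hfg.
have [mf _] := hf; have [mg _] := hg.
have fX := law_minorized _ _ _ lX _ hf; have gY := law_minorized _ _ _ lY _ hg.
rewrite (law_integral _ _ _ lX _ mf) (law_integral _ _ _ lY _ mg).
rewrite -integral_minorizedD // -ExE //.
apply: integral_le => //; first exact: measurable_int hh.
by apply: emeasurable_funD; [case: fX|case: gY].
Qed.

Lemma coupling_law mu nu (g : probability (V * V)%type R) :
  coupling mu nu g <-> has_law g fst mu /\ has_law g snd nu.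
Proof.
split=> [[h1 h2]|[[_ h1] [_ h2]]]; last by split.
by split; split.
Qed.

Definition W2r mu nu : R := fine (W2sq mu nu).

Section P2.
Variables (mu nu : probability V R).
Hypotheses (hmu : in_P2 mu) (hnu : in_P2 nu).

(** The product coupling has finite cost. *)
Lemma W2sq_fin : W2sq mu nu = (W2r mu nu)%:E.
Proof.
rewrite /W2r fineK //.
have W0 : (0 <= W2sq mu nu)%E.
  apply: le_ereal_inf_tmp => _ [g _ <-]; apply: integral_ge0 => z _.
  by rewrite lee_fin sqnorm_ge0.
rewrite ge0_fin_numE //.
apply: le_lt_trans (W2sq_le _ _ _ _ _ (has_law_fst mu nu) (has_law_snd mu nu)) _.
have h : L2 (mu \x nu)%E (fun z => z.1 - z.2 : 'rV[R]_d).
  apply: L2B.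
    exact: (law_L2 _ _ _ (has_law_fst mu nu) _ (proj1 (in_P2P _) hmu)).
  exact: (law_L2 _ _ _ (has_law_snd mu nu) _ (proj1 (in_P2P _) hnu)).
by rewrite ExE ?ltry //; exact: L2_sqnorm h.
Qed.

Lemma W2r_le {disp} {T : measurableType disp} (P : probability T R) (X Y : T -> V) :
  has_law P X mu -> has_law P Y nu ->
  W2r mu nu <= Ex P (fun w => sqnorm (X w - Y w : 'rV[R]_d)).
Proof.
move=> lX lY; have := W2sq_le _ _ _ _ _ lX lY; rewrite W2sq_fin ExE ?lee_fin //.
apply: L2_sqnorm; apply: L2B.
  exact: (law_L2 _ _ _ lX _ (proj1 (in_P2P _) hmu)).
exact: (law_L2 _ _ _ lY _ (proj1 (in_P2P _) hnu)).
Qed.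

Lemma W2r_approx (e : R) : 0 < e -> exists g : probability (V * V)%type R,
  [/\ has_law g fst mu, has_law g snd nu &
    Ex g (fun z => sqnorm (z.1 - z.2 : 'rV[R]_d)) <= W2r mu nu + e].
Proof.
move=> e0; have : (W2sq mu nu < (W2r mu nu + e)%:E)%E.
  by rewrite W2sq_fin lte_fin ltrDl.
move=> /ereal_inf_lt[_ [g /coupling_law[l1 l2] <-]] h; exists g; split=> //.
rewrite -lee_fin -ExE; first exact: ltW.
apply: L2_sqnorm; apply: L2B.
  exact: (law_L2 _ _ _ l1 _ (proj1 (in_P2P _) hmu)).
exact: (law_L2 _ _ _ l2 _ (proj1 (in_P2P _) hnu)).
Qed.

End P2.

End Wasserstein.

(** * Comparison of the dual cost with the Kantorovich functional *)

Section Combination.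
Context {R : realType} {d : nat} {disp : measure_display} {T : measurableType disp}.
Variable P : probability T R.
Implicit Types (X Y : T -> 'rV[R]_d).

Lemma Ex_sqnorm_comb (a b : R) X Y : L2 P X -> L2 P Y ->
  Ex P (fun w => sqnorm (a *: X w + b *: Y w)) =
  a ^+ 2 * Ex P (fun w => sqnorm (X w)) +
  2 * a * b * Ex P (fun w => dotv (X w) (Y w)) +
  b ^+ 2 * Ex P (fun w => sqnorm (Y w)).
Proof.
move=> hX hY.
have h1 := L2_sqnorm _ _ hX; have h2 := L2_sqnorm _ _ hY.
have h3 := L2_dotv _ _ _ hX hY.
have e : (fun w => sqnorm (a *: X w + b *: Y w)) = (fun w =>
    a ^+ 2 * sqnorm (X w) + 2 * a * b * dotv (X w) (Y w) + b ^+ 2 * sqnorm (Y w)).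
  by apply/funext => w; rewrite sqnormD !sqnormZ !dotvE; ring.
rewrite e ExD ?ExD ?ExZ //; by repeat (apply: intgD || apply: intgZ).
Qed.

Lemma Ex_sqnormB X Y : L2 P X -> L2 P Y ->
  Ex P (fun w => sqnorm (X w - Y w)) =
  Ex P (fun w => sqnorm (X w)) - 2 * Ex P (fun w => dotv (X w) (Y w)) +
  Ex P (fun w => sqnorm (Y w)).
Proof.
move=> hX hY; have := Ex_sqnorm_comb 1 (-1) _ _ hX hY.
have -> : (fun w => sqnorm (1 *: X w + -1 *: Y w)) = fun w => sqnorm (X w - Y w).
  by apply/funext => w; rewrite scale1r scaleN1r.
by move=> ->; ring.
Qed.

End Combination.

Section Costs.
Context {R : realType} {d : nat}.
Local Notation V := (borelRd R d).
Local Notation Id := (fun x : V => x : 'rV[R]_d).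
Implicit Types (mu nu : probability V R).
Implicit Types (u v : 'rV[R]_d -> \bar R).

(** A smooth convex function has at most quadratic growth. *)
Lemma smooth_intg nu k (w : V -> R) (p : V -> 'rV[R]_d) : 0 < k ->
  smooth_convex k w p -> measurable_fun setT w -> L2 nu Id -> intg nu w.
Proof.
move=> k0 sm mw h.
have h1 : intg nu (fun y : V => dotv (p 0) (y : 'rV[R]_d)) by exact: L2_dotv (L2_cst _ _) h.
have h2 : intg nu (fun y : V => k / 2 * sqnorm (y : 'rV[R]_d)).
  by apply: intgZ; exact: L2_sqnorm h.
have h0 := intg_cst nu `|w 0|.
apply: (le_intg _ _ _ mw _ (intgD _ _ _ (intgD _ _ _ h0 (integrable_norm h1)) h2)).
move=> y; have := sm 0 y; rewrite add0r => /andP[l1 l2].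
have := sqnorm_ge0 y => l3.
have := ler_norm (w 0); have := ler_norm (- w 0); rewrite normrN.
have := ler_norm (dotv (p 0) y); have := ler_norm (- dotv (p 0) y); rewrite normrN.
have l4 : 0 <= k / 2 * sqnorm y by rewrite mulr_ge0 //; lra.
by rewrite ler_norml /=; lra.
Qed.

Lemma legendre_minorized nu v : proper_fun v -> L2 nu Id -> minorized nu (legendre v).
Proof.
move=> [vN [x0 vx0]] h; split; first by apply: lsc_measurable; exact: legendre_lsc.
have [r vr] : exists r, v x0 = r%:E.
  by move: vx0 (vN x0); case: (v x0) => [r||] // _ _; exists r.
exists (fun y : V => dotv x0 (y : 'rV[R]_d) - r).
  by apply: intgB; [exact: L2_dotv (L2_cst _ _) h|exact: intg_cst].
by move=> y; exact: legendre_ge.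
Qed.

Section admissible.
Variables (t : R) (t1 : 1 < t) (u : 'rV[R]_d -> \bar R) (au : admissible t u).
Local Notation w := (fun y => fine (legendre u y)).
Local Notation p := (gradient (legendre u)).
Local Notation Tu := (extrapolation_map t u).

Lemma k_gt0 : 0 < ((t - 1) / t)^-1.
Proof. by rewrite invr_gt0; exact: c_gt0. Qed.

Lemma gradient_continuous : continuous p.
Proof.
by have [_ sm _ _] := admissible_legendre _ t1 _ au; exact: smooth_continuous k_gt0 sm.
Qed.

Lemma gradient_L2 nu : L2 nu Id -> L2 nu p.
Proof.
move=> h; have [_ sm _ _] := admissible_legendre _ t1 _ au.
apply: (L2_le _ _ _ _ _ _ h (fun y => smooth_growth _ _ _ y k_gt0 sm)).
by apply: measurable_mvec; apply: continuous_measurable_map; exact: gradient_continuous.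
Qed.

Lemma extrapolation_mapE y : Tu y = t *: (y : 'rV[R]_d) - (t - 1) *: p y :> 'rV[R]_d.
Proof. by apply/rowP => i; rewrite !mxE; ring. Qed.

Lemma extrapolation_map_measurable : measurable_fun setT (Tu : V -> V).
Proof.
apply: continuous_measurable_map => y.
have cp := gradient_continuous y.
have F := nbhs_filter (y : 'rV[R]_d).
have cB := @cvgB _ 'rV[R]_d _ (nbhs y) F id p y (p y) cvg_id cp.
have cZ := @cvgZ _ 'rV[R]_d _ (nbhs y) F (cst t) (id - p) t _ (@cvg_cst _ t _ (nbhs y) F) cB.
exact: (@cvgD _ 'rV[R]_d _ (nbhs y) F _ _ _ _ cp cZ).
Qed.

Lemma extrapolation_map_L2 nu : L2 nu Id -> L2 nu (Tu : V -> 'rV[R]_d).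
Proof.
move=> h; have := L2B _ _ _ (L2Z _ t _ h) (L2Z _ (t - 1) _ (gradient_L2 _ h)).
by congr L2; apply/funext => y; rewrite extrapolation_mapE.
Qed.

Lemma legendre_intg nu : L2 nu Id -> intg nu w.
Proof.
move=> h; have [lE sm _ _] := admissible_legendre _ t1 _ au.
apply: (smooth_intg _ _ _ _ k_gt0 sm) => //.
apply/measurable_EFinP; rewrite (_ : EFin \o w = legendre u).
  by apply: lsc_measurable; exact: legendre_lsc.
by apply/funext => y /=; rewrite -lE.
Qed.

Lemma admissible_minorized nu : minorized nu u.
Proof.
have [lE sm QG _] := admissible_legendre _ t1 _ au.
split; first by apply: lsc_measurable; exact: strongly_admissible_lsc au.
exists (fun => - w 0); first exact: intg_cst.
move=> z; apply: le_trans (QG 0 z); rewrite lee_fin dotv0.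
have := mulr_ge0 (ltW (c_gt0 _ t1)) (sqnorm_ge0 (z - p 0)); lra.
Qed.

Lemma dual_costE nu0 nu1 : L2 nu1 Id ->
  dual_cost nu0 nu1 u = ((Ex nu1 w)%:E + \int[nu0]_x u x)%E.
Proof.
move=> h; have [lE _ _ _] := admissible_legendre _ t1 _ au.
rewrite /dual_cost; congr (_ + _)%E; rewrite -(ExE _ _ (legendre_intg _ h)).
by apply: eq_integral => y _; rewrite -lE.
Qed.

End admissible.

Lemma potential_minorized nu t u : 1 < t -> L2 nu Id -> minorized nu u ->
  minorized nu (potential t u).
Proof.
move=> t1 h hu; rewrite /potential.
under [X in minorized _ X]eq_fun do rewrite -EFinN.
apply: minorized_addq; first by apply: minorizedZ => //; lra.
apply: intgN; apply: intgZ; under [X in intg _ X]eq_fun do rewrite mulrC.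
by apply: intgZ; exact: L2_sqnorm h.
Qed.

Lemma half_sqnormE nu a : L2 nu Id ->
  Ex nu (fun x : V => a * (sqnorm (x : 'rV[R]_d) / 2)) = a / 2 * Ex nu (fun x : V => sqnorm (x : 'rV[R]_d)).
Proof.
move=> h; rewrite -ExZ; last exact: L2_sqnorm h.
by congr Ex; apply/funext => x; rewrite mulrA mulrAC.
Qed.

Lemma half_sqnorm_intg nu a : L2 nu Id ->
  intg nu (fun x : V => a * (sqnorm (x : 'rV[R]_d) / 2)).
Proof.
move=> h; under [X in intg _ X]eq_fun do rewrite mulrA mulrAC.
by apply: intgZ; exact: L2_sqnorm h.
Qed.

Lemma integral_potential nu t u : 1 < t -> L2 nu Id -> minorized nu u ->
  (\int[nu]_x potential t u x = t%:E * \int[nu]_x u x -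
    ((t - 1) / 2 * Ex nu (fun x : V => sqnorm (x : 'rV[R]_d)))%:E)%E.
Proof.
move=> t1 h hu; have t0 : 0 <= t by lra.
rewrite -(half_sqnormE _ _ h) -EFinN -ExN; last exact: half_sqnorm_intg.
rewrite -integral_minorizedZ // -integral_addq //; first exact: minorizedZ.
by apply: intgN; exact: half_sqnorm_intg.
Qed.

(** A closed convex function is the potential, for t = 2, of an admissible
    function, which is bounded below by a constant. *)
Lemma closed_convex_minorized nu v : closed_convex v -> L2 nu Id -> minorized nu v.
Proof.
move=> cv h; have t1 : 1 < 2 :> R by lra.
have au : admissible 2 (depotential 2 v).
  by apply/admissible_potential => //; rewrite depotentialK.
rewrite -(depotentialK 2 v t1); apply: potential_minorized => //.
exact: admissible_minorized t1 _ au _.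
Qed.

Section transported.
Variables (t : R) (t1 : 1 < t) (u : 'rV[R]_d -> \bar R) (au : admissible t u).
Local Notation w := (fun y => fine (legendre u y)).
Local Notation p := (gradient (legendre u)).
Local Notation Tu := (extrapolation_map t u).
Variables (nu0 nu1 mu : probability V R).
Hypotheses (h0 : L2 nu0 Id) (h1 : L2 nu1 Id) (lmu : has_law nu1 Tu mu).
Local Notation S0 := (Ex nu0 (fun x : V => sqnorm (x : 'rV[R]_d))).
Local Notation S1 := (Ex nu1 (fun x : V => sqnorm (x : 'rV[R]_d))).
Local Notation Sp := (Ex nu1 (fun x : V => sqnorm (p x))).

(** The constant relating t times the dual cost to the Kantorovich functional
    from nu0 to the transported measure. *)
Definition gap_cst : R := - ((t - 1) / 2 * Sp) - (t - 1) / 2 * S0.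

Lemma transported_L2 : L2 mu Id.
Proof.
have [mT _] := lmu; split; first exact: mvec_id.
apply: (law_intg_inv _ _ _ lmu); first exact: measurable_dotv mvec_id mvec_id.
exact: L2_sqnorm (extrapolation_map_L2 _ t1 _ au _ h1).
Qed.

Local Open Scope ereal_scope.

(** Pointwise, this is the bound on the transform of the potential at T y. *)
Lemma kantorovich_le_dual :
  kantorovich_cost nu0 mu (potential t u) <=
  t%:E * dual_cost nu0 nu1 u + gap_cst%:E.
Proof.
have t1' := t1.
have hu := admissible_minorized _ t1 _ au nu0.
rewrite /kantorovich_cost (integral_potential _ _ _ t1 h0 hu).
have mL : measurable_fun setT (legendre (potential t u) : V -> \bar R).
  by apply: lsc_measurable; exact: legendre_lsc.
rewrite (law_integral _ _ _ lmu _ mL).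
have hw := legendre_intg _ t1 _ au _ h1.
have hp := L2_sqnorm _ _ (gradient_L2 _ t1 _ au _ h1).
have hq : intg nu1 (fun y => t * w y + - ((t - 1) / 2) * sqnorm (p y))%R.
  by apply: intgD; apply: intgZ.
apply: (@le_trans _ _ (t%:E * (\int[nu0]_x u x) - ((t - 1) / 2 * S0)%:E +
    (Ex nu1 (fun y => t * w y + - ((t - 1) / 2) * sqnorm (p y))%R)%:E)).
  apply: leeD => //; rewrite -(ExE _ _ hq); apply: integral_le.
  - by apply: (measurableT_comp mL); case: lmu.
  - exact: measurable_int hq.
  - move=> y; apply: le_trans (legendre_potential _ t1 _ au y) _.
    by rewrite lee_fin mulNr.
rewrite ExD ?ExZ //; try exact: intgZ.
rewrite (dual_costE _ t1 _ au _ _ h1) /gap_cst.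
have := minorized_gtNy _ _ hu; case: (\int[nu0]_x u x) => [r||] // _.
  suff : (t * r - (t - 1) / 2 * S0 + (t * Ex nu1 w + - ((t - 1) / 2) * Sp) <=
   t * (Ex nu1 w + r) + (- ((t - 1) / 2 * Sp) - (t - 1) / 2 * S0))%R.
    by rewrite -lee_fin.
  by lra.
by rewrite addey // gt0_muley ?lte_fin ?addye ?leey //; lra.
Qed.

(** For an arbitrary competitor [v] the transform of the admissible function
    attached to it is estimated at y by the choice x = T y, for which
    t y - x = (t - 1) p y; the constant is therefore the same as in
    [kantorovich_le_dual]. *)
Lemma dual_le_kantorovich v : closed_convex v ->
  t%:E * dual_cost nu0 nu1 (depotential t v) + gap_cst%:E <= kantorovich_cost nu0 mu v.
Proof.
move=> cv; have t1' := t1.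
have av : admissible t (depotential t v).
  by apply/admissible_potential => //; rewrite depotentialK.
have hu := admissible_minorized _ t1 _ av nu0.
have hv := closed_convex_minorized nu0 v cv h0.
have pv : proper_fun v by case: cv.
have hlv := legendre_minorized _ _ pv transported_L2.
have hp := L2_sqnorm _ _ (gradient_L2 _ t1 _ au _ h1).
have eK := integral_potential _ _ _ t1 h0 hu; rewrite depotentialK // in eK.
rewrite /kantorovich_cost eK.
have mL : measurable_fun setT (legendre v : V -> \bar R).
  by apply: lsc_measurable; exact: legendre_lsc.
rewrite (law_integral _ _ _ lmu _ mL).
have hlT := law_minorized _ _ _ lmu _ hlv.
have ti0 : (0 <= t^-1)%R by rewrite invr_ge0; lra.
pose c2 := ((t - 1) / (2 * t))%R.
have le1 : \int[nu1]_y legendre (depotential t v) y <=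
   t^-1%:E * (\int[nu1]_y legendre v (Tu y)) + (c2 * Sp)%:E.
  rewrite -ExZ // -integral_minorizedZ // -integral_addq; last 2 first.
  - exact: minorizedZ.
  - exact: intgZ.
  apply: integral_le.
  - by apply: lsc_measurable; exact: legendre_lsc.
  - by case: (minorized_addq _ _ _ (minorizedZ _ _ _ ti0 hlT) (intgZ _ c2 _ hp)).
  - move=> y; apply: le_trans (legendre_depotential _ _ (Tu y) _ t1 pv) _.
    apply: leeD2l; rewrite lee_fin extrapolation_mapE.
    rewrite opprB addrC subrK sqnormZ /c2.
    by rewrite le_eqVlt; apply/orP; left; apply/eqP; field; lra.
have key (l : R) (a b : \bar R) : -oo < a -> -oo < b ->
    l%:E <= t^-1%:E * b + (c2 * Sp)%:E ->
    t%:E * (l%:E + a) + gap_cst%:E <= (t%:E * a - ((t - 1) / 2 * S0)%:E) + b.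
  case: a => [a||] //; case: b => [b||] // _ _; last 3 first.
  - by move=> _; rewrite addey // leey.
  - by move=> _; rewrite gt0_muley ?lte_fin ?addye ?leey //; lra.
  - by move=> _; rewrite gt0_muley ?lte_fin ?addye ?leey //; lra.
  rewrite lee_fin => h; rewrite lee_fin.
  suff : (t * l <= b + (t - 1) / 2 * Sp)%R by rewrite /gap_cst; lra.
  have e : (b + (t - 1) / 2 * Sp = t * (t^-1 * b + c2 * Sp))%R.
    by rewrite /c2; field; lra.
  by rewrite e ler_wpM2l //; lra.
have hl := legendre_intg _ t1 _ av _ h1.
have [lE _ _ _] := admissible_legendre _ t1 _ av.
rewrite (dual_costE _ t1 _ av _ _ h1); apply: key.
- exact: minorized_gtNy hu.
- exact: minorized_gtNy hlT.
- apply: le_trans le1; rewrite -(ExE _ _ hl).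
  by under eq_integral do rewrite -lE.
Qed.

End transported.
End Costs.

(** * From dual solutions to primal competitors *)

Section Primal.
Context {R : realType} {d : nat}.
Local Notation V := (borelRd R d).
Local Notation Id := (fun x : V => x : 'rV[R]_d).
Implicit Types (mu nu : probability V R).
Implicit Types (u v : 'rV[R]_d -> \bar R).

Definition moment mu : R := Ex mu (fun x : V => sqnorm (x : 'rV[R]_d)).

Lemma primal_costE nu0 nu1 t mu : in_P2 nu0 -> in_P2 nu1 -> in_P2 mu ->
  primal_cost nu0 nu1 t mu =
  ((2 * (t - 1))^-1 * W2r mu nu1 - (2 * t)^-1 * W2r mu nu0)%:E.
Proof. by move=> h0 h1 hmu; rewrite /primal_cost !W2sq_fin // -!EFinM -EFinB. Qed.

Lemma has_law_id mu : has_law mu id mu.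
Proof. by split; [exact: measurable_id|]. Qed.

Section transported.
Variables (t : R) (t1 : 1 < t) (u : 'rV[R]_d -> \bar R) (au : admissible t u).
Local Notation w := (fun y => fine (legendre u y)).
Local Notation p := (gradient (legendre u)).
Local Notation Tu := (extrapolation_map t u).
Variables (nu0 nu1 mu : probability V R).
Hypotheses (h0 : in_P2 nu0) (h1 : in_P2 nu1) (lmu : has_law nu1 Tu mu).

Lemma transported_P2 : in_P2 mu.
Proof. by apply/in_P2P; exact: transported_L2 t1 _ au _ _ (proj1 (in_P2P _) h1) lmu. Qed.

(** The first term of the primal cost is bounded by the coupling (T, Id), and
    the second one by Kantorovich duality with the potential of [u]. *)
Lemma primal_le_dual D : dual_cost nu0 nu1 u = D%:E ->
  (primal_cost nu0 nu1 t mu <= (D - moment nu0 / 2 - moment nu1 / 2)%:E)%E.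
Proof.
move=> uD; have t1' := t1.
have hmu := transported_P2.
have L0 := proj1 (in_P2P _) h0; have L1 := proj1 (in_P2P _) h1.
have Lmu := proj1 (in_P2P _) hmu.
have Lp := gradient_L2 _ t1 _ au _ L1.
have LT := extrapolation_map_L2 _ t1 _ au _ L1.
rewrite primal_costE // lee_fin.
have eT a b : Ex nu1 (fun y : V => sqnorm (a *: (y : 'rV[R]_d) + b *: p y)) = 
    a ^+ 2 * moment nu1 + 2 * a * b * Ex nu1 (fun y : V => dotv (y : 'rV[R]_d) (p y)) +
    b ^+ 2 * Ex nu1 (fun y : V => sqnorm (p y)).
  by rewrite (Ex_sqnorm_comb _ _ _ _ _ L1 Lp).
set A := Ex nu1 (fun y : V => dotv (y : 'rV[R]_d) (p y)) in eT.
set Sp := Ex nu1 (fun y : V => sqnorm (p y)) in eT.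
(* upper bound by the coupling (T, id) of mu and nu1 *)
have w1 : W2r mu nu1 <= (t - 1) ^+ 2 * (moment nu1 - 2 * A + Sp).
  apply: le_trans (W2r_le _ _ hmu h1 _ _ _ lmu (has_law_id nu1)) _.
  have -> : (fun y : V => sqnorm (Tu y - y : 'rV[R]_d)) =
      fun y : V => sqnorm ((t - 1) *: (y : 'rV[R]_d) + - (t - 1) *: p y).
    apply/funext => y; congr sqnorm; rewrite extrapolation_mapE //.
    by apply/rowP => i; rewrite !mxE; ring.
  by rewrite eT le_eqVlt; apply/orP; left; apply/eqP; ring.
have momT : moment mu = t ^+ 2 * moment nu1 - 2 * t * (t - 1) * A + (t - 1) ^+ 2 * Sp.
  rewrite {1}/moment -(law_Ex _ _ _ lmu); last exact: measurable_dotv mvec_id mvec_id.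
  have -> : (fun y : V => sqnorm (Tu y : 'rV[R]_d)) =
      fun y : V => sqnorm (t *: (y : 'rV[R]_d) + - (t - 1) *: p y).
    apply/funext => y; congr sqnorm; rewrite extrapolation_mapE //.
    by apply/rowP => i; rewrite !mxE; ring.
  by rewrite eT; ring.
(* lower bound by Kantorovich duality with the potential t u - (t-1)|.|^2/2 *)
have w0 : moment mu + moment nu0 - 2 * (t * D + gap_cst t u nu0 nu1) <= W2r mu nu0.
  apply/ler_addgt0Pr => e e0.
  have [g [l1 l2 ge]] := W2r_approx _ _ hmu h0 e e0.
  apply: le_trans ge.
  have G1 := law_L2 _ _ _ l1 _ Lmu; have G2 := law_L2 _ _ _ l2 _ L0.
  rewrite (Ex_sqnormB _ _ _ G1 G2).
  rewrite (law_Ex _ _ _ l1 (fun x : V => sqnorm (x : 'rV[R]_d))); last first.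
    exact: measurable_dotv mvec_id mvec_id.
  rewrite (law_Ex _ _ _ l2 (fun x : V => sqnorm (x : 'rV[R]_d))); last first.
    exact: measurable_dotv mvec_id mvec_id.
  rewrite -/(moment mu) -/(moment nu0).
  have cv : closed_convex (potential t u) by apply/admissible_potential.
  have pv : proper_fun (potential t u) by case: cv.
  have := weak_duality g _ _ _ _ _ _ _ l1 l2 (legendre_minorized _ _ pv Lmu)
    (closed_convex_minorized _ _ cv L0) (L2_dotv _ _ _ G1 G2).
  move=> /(_ (fun z => fenchel_young _ z.1 z.2 pv)) wd.
  have : ((Ex g (fun z => dotv (z.1 : 'rV[R]_d) (z.2 : 'rV[R]_d)))%:E
     <= (t * D + gap_cst t u nu0 nu1)%:E)%E.
    apply: (le_trans wd); rewrite addeC.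
    apply: le_trans (kantorovich_le_dual _ t1 _ au _ _ _ L0 L1 lmu) _.
    by rewrite uD -EFinM -EFinD.
  rewrite lee_fin; lra.
rewrite momT /gap_cst -/Sp -/(moment nu0) in w0; clear uD.
have t0 : 0 < t by lra.
have t10 : 0 < t - 1 by lra.
have w1' : (2 * (t - 1))^-1 * W2r mu nu1 <= (t - 1) / 2 * (moment nu1 - 2 * A + Sp).
  rewrite mulrC ler_pdivrMr ?mulr_gt0 //; apply: le_trans w1 _.
  by rewrite le_eqVlt; apply/orP; left; apply/eqP; field.
have w0' : (2 * t)^-1 * (t ^+ 2 * moment nu1 - 2 * t * (t - 1) * A + (t - 1) ^+ 2 * Sp
  + moment nu0 - 2 * (t * D + (- ((t - 1) / 2 * Sp) - (t - 1) / 2 * moment nu0)))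
  <= (2 * t)^-1 * W2r mu nu0.
  by rewrite ler_wpM2l // invr_ge0 mulr_ge0 // ltW.
have e : (2 * t)^-1 * (t ^+ 2 * moment nu1 - 2 * t * (t - 1) * A + (t - 1) ^+ 2 * Sp
  + moment nu0 - 2 * (t * D + (- ((t - 1) / 2 * Sp) - (t - 1) / 2 * moment nu0))) =
  t / 2 * moment nu1 - (t - 1) * A + (t - 1) / 2 * Sp + moment nu0 / 2 - D.
  by field; lra.
rewrite e in w0'; lra.
Qed.

(** T is the gradient of this convex function, hence (Id, T) saturates the
    Fenchel inequality, and weak duality makes the function optimal. *)
Lemma forward_brenier : brenier_potential nu1 mu (fun y =>
  (- ((t - 1)%:E * legendre u y) + (t * (sqnorm y / 2))%:E)%E).
Proof.
have [lE _ _ _] := admissible_legendre _ t1 _ au.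
have L1 := proj1 (in_P2P _) h1.
have LT := extrapolation_map_L2 _ t1 _ au _ L1.
have Lmu := proj1 (in_P2P _) transported_P2.
set f := (X in brenier_potential _ _ X).
have -> : f = EFin \o forward_potential t u.
  by apply/funext => y; rewrite /f lE -EFinM -EFinN -EFinD.
have sg := forward_potential_subgradient _ t1 _ au.
have cf := subgradient_closed_convex _ _ sg.
split=> // v cv; have pv : proper_fun v by case: cv.
have hd : intg nu1 (fun y : V => dotv (y : 'rV[R]_d) (Tu y)) by exact: L2_dotv L1 LT.
have wd := weak_duality nu1 _ _ _ _ _ _ _ (has_law_id nu1) lmu
  (closed_convex_minorized _ _ cv L1) (legendre_minorized _ _ pv Lmu) hd.
apply: le_trans (wd _); last first.
  by move=> y; rewrite dotvC addeC; exact: fenchel_young.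
rewrite /kantorovich_cost.
have mL : measurable_fun setT (legendre (EFin \o forward_potential t u) : V -> \bar R).
  by apply: lsc_measurable; exact: legendre_lsc.
rewrite (law_integral _ _ _ lmu _ mL).
have hf : intg nu1 (forward_potential t u).
  apply: intgD; last exact: half_sqnorm_intg.
  by apply: intgN; apply: intgZ; exact: legendre_intg _ t1 _ au _ L1.
rewrite /= ExE //.
have -> : (\int[nu1]_y legendre (EFin \o forward_potential t u) (Tu y) =
  (Ex nu1 (fun y => dotv (y : 'rV[R]_d) (Tu y) - forward_potential t u y))%:E)%E.
  rewrite -ExE; last exact: intgB.
  apply: eq_integral => y _; rewrite (legendre_subgradient _ _ y sg).
  by rewrite dotvC.
by rewrite ExB // -EFinD lee_fin; lra.
Qed.

(** Both comparisons of the Kantorovich functional with the dual cost hold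
    with the same constant. *)
Lemma backward_brenier : solves_dual nu0 nu1 t u ->
  brenier_potential nu0 mu (potential t u).
Proof.
move=> [_ min]; have t1' := t1.
have L0 := proj1 (in_P2P _) h0; have L1 := proj1 (in_P2P _) h1.
split=> [|v cv]; first by apply/admissible_potential.
apply: le_trans (kantorovich_le_dual _ t1 _ au _ _ _ L0 L1 lmu) _.
apply: le_trans (dual_le_kantorovich _ t1 _ au _ _ _ L0 L1 lmu _ cv).
apply: leeD2r; apply: lee_wpmul2l; first by rewrite lee_fin; lra.
by apply: min; apply/admissible_potential => //; rewrite depotentialK.
Qed.

(** The known solution [u] serves twice: it defines the map T with respect to
    which the comparisons are made, and its cost is the minimum that u' attains. *)
Lemma brenier_solves_dual u' : solves_dual nu0 nu1 t u ->
  brenier_potential nu0 mu (potential t u') -> solves_dual nu0 nu1 t u'.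
Proof.
move=> [_ min] [cv' brn]; have t1' := t1.
have L0 := proj1 (in_P2P _) h0; have L1 := proj1 (in_P2P _) h1.
split=> [|u'' au'']; first by apply/admissible_potential.
apply: le_trans (min _ au'').
have h := dual_le_kantorovich _ t1 _ au _ _ _ L0 L1 lmu _ cv'.
rewrite potentialK // in h.
have {}h := le_trans h (brn _ (proj1 (admissible_potential _ _ t1) au)).
have {h} := le_trans h (kantorovich_le_dual _ t1 _ au _ _ _ L0 L1 lmu).
rewrite leeD2rE // lee_pmul2l // ?lte_fin ?fin_numE //; lra.
Qed.

End transported.
End Primal.

(** * Reweighted products *)

Section Reweighting.
Context {R : realType} {disp : measure_display} {T : measurableType disp}.
Local Open Scope ereal_scope.

Lemma finite_sum_measure (I : Type) (s : seq I) (m : I -> {measure set T -> \bar R}) :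
  exists M : {measure set T -> \bar R}, forall h : T -> \bar R,
    (forall x, 0 <= h x) -> measurable_fun setT h ->
    \int[M]_x h x = \sum_(i <- s) \int[m i]_x h x.
Proof.
elim: s => [|i s [M hM]].
  by exists mzero => h h0 mh; rewrite big_nil integral_measure_zero.
exists (measure_add (m i) M) => h h0 mh.
by rewrite big_cons ge0_integral_measure_add // hM.
Qed.

Variable Q : probability T R.

Lemma integral_mrestr (C : set T) (mC : measurable C) (h : T -> \bar R) :
  (forall x, 0 <= h x) -> measurable_fun setT h ->
  \int[mrestr Q mC]_x h x = \int[Q]_x (h x * (\1_C x)%:E).
Proof.
move=> h0 mh; rewrite -[in LHS](setUv C) ge0_integral_setU //; last 3 first.
- exact: measurableC.
- by rewrite setUv.
- by rewrite disj_set2E setICr.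
rewrite [X in _ + X = _](_ : _ = 0) ?adde0; last first.
  rewrite (eq_measure_integral mzero) ?integral_measure_zero // => A mA AC.
  rewrite /= /mrestr (_ : A `&` C = set0) ?measure0 //.
  by apply/seteqP; split => // x [/AC].
rewrite (eq_measure_integral Q) => [|A mA AC]; last first.
  by rewrite /= /mrestr setIidl.
rewrite [LHS]integral_mkcond; congr (integral _ _ _); apply/funext => x.
by rewrite patchE indicE; case: (x \in C); rewrite ?mule1 ?mule0.
Qed.

(** The probability of density rho, for a step function rho of mean 1: a finite
    sum of scaled restrictions of Q. *)
Lemma reweight (K : finType) (C : K -> set T) (r : K -> R) :
  (forall k, measurable (C k)) -> (forall k, 0 <= r k)%R ->
  let rho x := (\sum_k r k * \1_(C k) x)%R in
  Ex Q rho = 1%R ->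
  exists Pi : probability T R, forall f : T -> R, intg Q f ->
    intg Pi f /\ Ex Pi f = Ex Q (fun x => f x * rho x)%R.
Proof.
move=> mC r0 rho rho1.
have mrho : measurable_fun setT rho.
  by apply: measurable_sum => k; apply: measurable_funM => //; exact: measurable_indic.
have rho0 x : (0 <= rho x)%R.
  by apply: sumr_ge0 => k _; rewrite mulr_ge0 // indicE.
have [M hM] := finite_sum_measure _ (enum K)
  (fun k => mscale (NngNum (r0 k)) (mrestr Q (mC k))).
have key (h : T -> R) : (forall x, 0 <= h x)%R -> measurable_fun setT h ->
    \int[M]_x (h x)%:E = \int[Q]_x (h x * rho x)%:E.
  move=> h0 mh; have mh' : measurable_fun setT (EFin \o h) by exact/measurable_EFinP.
  have mk k : measurable_fun setT (fun x => (h x)%:E * (\1_(C k) x)%:E).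
    by apply: emeasurable_funM => //; apply/measurable_EFinP; exact: measurable_indic.
  rewrite hM //.
  transitivity (\sum_(k <- enum K)
     \int[Q]_x ((r k)%:E * ((h x)%:E * (\1_(C k) x)%:E))).
    apply: eq_bigr => k _.
    rewrite ge0_integral_mscale //=; last by move=> x _; rewrite lee_fin.
    rewrite (integral_mrestr _ _ (EFin \o h)) //.
    rewrite ge0_integralZl_EFin // => x _.
    by rewrite mule_ge0 ?lee_fin // indicE.
  apply: etrans (esym (ge0_integral_sum Q measurableT
    (f := fun k x => (r k)%:E * ((h x)%:E * (\1_(C k) x)%:E)) _ _ (enum K))) _.
  - by move=> k; exact: measurable_funeM.
  - by move=> k x _; rewrite !mule_ge0 ?lee_fin // indicE.
  apply: eq_integral => x _; rewrite /rho big_enum /= mulr_sumr -sumEFin.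
  by apply: eq_bigr => k _; rewrite -!EFinM mulrCA.
have bnd x : (rho x <= \sum_k r k)%R.
  apply: ler_sum => k _; rewrite ler_piMr // indicE; by case: (_ \in _).
have irho : intg Q rho.
  apply: (le_intg _ _ (fun=> \sum_k r k)%R) => //; last exact: intg_cst.
  by move=> x; rewrite ger0_norm.
have M1 : M setT = 1.
  have := key (fun=> 1%R) (fun=> ler01) (measurable_cst _).
  rewrite integral_cst // mul1e => ->.
  under eq_integral do rewrite mul1r.
  by rewrite ExE // rho1.
pose Pi : probability T R := mnormalize M Q.
have PiM U : Pi U = M U.
  by rewrite /Pi /= /mnormalize M1 onee_eq0 /= invr1 mule1.
have {}key (h : T -> R) : (forall x, 0 <= h x)%R -> measurable_fun setT h ->
    \int[Pi]_x (h x)%:E = \int[Q]_x (h x * rho x)%:E.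
  move=> h0 mh; rewrite -key //.
  by apply: eq_measure_integral => A mA _; exact: PiM.
exists Pi => f hf.
have PiE (h : T -> R) : (forall x, 0 <= h x)%R -> intg Q h ->
    intg Q (fun x => h x * rho x)%R /\ intg Pi h /\
    Ex Pi h = Ex Q (fun x => h x * rho x)%R.
  move=> h0 hh; have mh := intg_measurable _ _ hh.
  have hr : intg Q (fun x => h x * rho x)%R.
    apply: (le_intg _ _ (fun x => (\sum_k r k) * h x)%R).
    - exact: measurable_funM.
    - by move=> x; rewrite ger0_norm ?mulr_ge0 // mulrC ler_wpM2r.
    - exact: intgZ.
  split=> //; have := key h h0 mh; rewrite (ExE _ _ hr) => kh.
  split; last by rewrite /Ex /Rintegral kh.
  apply/integrableP; split; first exact/measurable_EFinP.
  under eq_integral do rewrite /= ger0_norm //.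
  by rewrite kh ltry.
have mf := intg_measurable _ _ hf.
have ha : intg Q (fun x => `|f x|)%R by exact: integrable_norm hf.
have [i1 [i2 i3]] := PiE _ (fun x => normr_ge0 (f x)) ha.
(* f is a difference of two nonnegative integrable functions *)
have hb : intg Q (fun x => f x + `|f x|)%R by exact: intgD.
have [|j1 [j2 j3]] := PiE (fun x => f x + `|f x|)%R _ hb.
  by move=> x; have := ler_norm (- f x)%R; rewrite normrN; lra.
have fE : f = (fun x => (f x + `|f x|) - `|f x|)%R by apply/funext => x; rewrite addrK.
split; first by rewrite fE; exact: intgB.
rewrite {1}fE ExB // i3 j3 -ExB //; congr Ex.
by apply/funext => x; rewrite mulrDl addrK.
Qed.

End Reweighting.

Section ProductExpectation.
Context {R : realType} {d1 d2 : measure_display}.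
Context {T : measurableType d1} {U : measurableType d2}.
Variables (P : probability T R) (Q : probability U R).

(** Fubini's theorem for a product of two functions of one variable each. *)
Lemma Ex_prod (f : T -> R) (g : U -> R) : intg P f -> intg Q g ->
  intg (P \x Q)%E (fun z => f z.1 * g z.2) /\
  Ex (P \x Q)%E (fun z => f z.1 * g z.2) = Ex P f * Ex Q g.
Proof.
move=> hf hg.
have mf := intg_measurable _ _ hf; have mg := intg_measurable _ _ hg.
have mfg : measurable_fun setT (fun z : T * U => f z.1 * g z.2).
  by apply: measurable_funM; apply: measurableT_comp.
have ifg : intg (P \x Q)%E (fun z => f z.1 * g z.2).
  apply/integrable12ltyP; first exact/measurable_EFinP.
  under eq_integral => x _.
    rewrite /=; under eq_integral do rewrite normrM.
    rewrite (ExE _ (fun y => `|f x| * `|g y|)); last first.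
      by apply: intgZ; exact: integrable_norm hg.
    rewrite ExZ; last exact: integrable_norm hg.
    rewrite mulrC.
    over.
  rewrite /= (ExE _ (fun x => _ * `|f x|)) ?ltry //.
  by apply: intgZ; exact: integrable_norm hf.
split=> //; apply: EFin_inj; rewrite -ExE // -integral12_prod_meas1 //.
rewrite /fubini_F /=.
under eq_integral => x _.
  rewrite (ExE _ (fun y => f x * g y)); last exact: intgZ.
  rewrite ExZ // mulrC.
  over.
by rewrite /= (ExE _ (fun x => Ex Q g * f x)) ?ExZ 1?mulrC //; exact: intgZ.
Qed.

End ProductExpectation.

(** * Couplings built from finite partitions *)

Section Partition.
Context {R : realType} {disp : measure_display} {T : measurableType disp}.
Variable P : probability T R.
Context {I : finType}.
Variable q : T -> I.

Definition measurable_partition := forall i, measurable (q @^-1` [set i]).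
Definition cell i (w : T) : R := (q w == i)%:R.
Definition mass i := Ex P (cell i).

Hypothesis mq : measurable_partition.

Lemma cellE i : cell i = \1_(q @^-1` [set i]) :> (T -> R).
Proof.
apply/funext => w; rewrite /cell indicE; congr ((nat_of_bool _)%:R).
by apply/eqP/idP; rewrite inE.
Qed.

Lemma measurable_cell i : measurable_fun setT (cell i).
Proof. by rewrite cellE; exact: measurable_indic. Qed.

Lemma cell_ge0 i w : 0 <= cell i w. Proof. by rewrite /cell. Qed.

Lemma intg_cell f i : intg P f -> intg P (fun w => f w * cell i w).
Proof.
move=> hf; apply: (le_intg _ _ _ _ _ (integrable_norm hf)).
  by apply: measurable_funM; [exact: intg_measurable hf|exact: measurable_cell].
move=> w /=; rewrite /cell; case: (_ == _); by rewrite ?mulr1 ?mulr0 ?normr0.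
Qed.

Lemma sum_cell (F : I -> R) w : \sum_i F i * cell i w = F (q w).
Proof.
rewrite (bigD1 (q w)) //= /cell eqxx mulr1 big1 ?addr0 // => i.
by rewrite eq_sym => /negPf ->; rewrite mulr0.
Qed.

Lemma measurable_step (F : I -> R) : measurable_fun setT (fun w => F (q w)).
Proof.
under eq_fun do rewrite -sum_cell.
by apply: measurable_sum => i; apply: measurable_funM => //; exact: measurable_cell.
Qed.

Lemma intg_step (F : I -> R) : intg P (fun w => F (q w)).
Proof.
apply: (le_intg _ _ (fun=> \sum_i `|F i|)) (measurable_step F) _ (intg_cst _ _).
by move=> w; rewrite (bigD1 (q w)) //= lerDl sumr_ge0.
Qed.

Lemma L2_step {d : nat} (F : I -> 'rV[R]_d) : L2 P (fun w => F (q w)).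
Proof.
split; first by move=> k; exact: measurable_step (fun i => F i ord0 k).
exact: intg_step (fun i => sqnorm (F i)).
Qed.

Lemma Ex_step (F : I -> R) : Ex P (fun w => F (q w)) = \sum_i mass i * F i.
Proof.
under [X in Ex P X]eq_fun do rewrite -sum_cell.
have h i : intg P (cell i).
  by have := intg_cell _ i (intg_cst P 1); under eq_fun do rewrite mul1r.
by rewrite Ex_sum => [|i]; [apply: eq_bigr => i _; rewrite ExZ // mulrC|exact: intgZ].
Qed.

Lemma Ex_partition f : intg P f -> Ex P f = \sum_i Ex P (fun w => f w * cell i w).
Proof.
move=> hf; rewrite -Ex_sum => [|i]; last exact: intg_cell.
by congr Ex; apply/funext => w; rewrite (sum_cell (fun=> f w)).
Qed.

Lemma sum_mass : \sum_i mass i = 1.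
Proof.
have := Ex_step (fun=> 1); rewrite Ex_cst => ->.
by apply: eq_bigr => i _; rewrite mulr1.
Qed.

End Partition.

Lemma prob_Ex {R : realType} {disp} {T : measurableType disp} (P : probability T R)
  (A : set T) : measurable A -> P A = (Ex P (\1_A))%:E.
Proof.
move=> mA; rewrite -ExE; last first.
  apply: (le_intg _ _ (fun=> 1)); [exact: measurable_indic| |exact: intg_cst].
  by move=> w; rewrite indicE; case: (_ \in _); rewrite ?normr0 ?normr1.
by rewrite integral_indic // setIT.
Qed.

Lemma intg_indic {R : realType} {disp} {T : measurableType disp} (P : probability T R)
  (A : set T) : measurable A -> intg P (\1_A).
Proof.
move=> mA; apply: (le_intg _ _ (fun=> 1)); [exact: measurable_indic| |exact: intg_cst].
by move=> w; rewrite indicE; case: (_ \in _); rewrite ?normr0 ?normr1.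
Qed.

Section Barycenter.
Context {R : realType} {d : nat}.
Local Notation V := (borelRd R d).
Variables (nu : probability V R) (I : finType) (q : V -> I).
Hypotheses (mq : measurable_partition q) (L : L2 nu (fun y : V => y : 'rV[R]_d)).

Definition barycenter i : 'rV[R]_d :=
  \row_k ((mass nu q i)^-1 * Ex nu (fun y : V => (y : 'rV[R]_d) ord0 k * cell q i y)).

Lemma coord_intg k : intg nu (fun y : V => (y : 'rV[R]_d) ord0 k).
Proof.
have := L2_dotv _ _ _ (L2_cst nu (delta_mx ord0 k : 'rV[R]_d)) L.
congr (intg nu); apply/funext => y.
rewrite /dotv (bigD1 k) //= big1 ?addr0 => [|j /negPf jk]; rewrite mxE eqxx /= ?eqxx ?mul1r //.
by rewrite jk mul0r.
Qed.

Hypothesis mass_gt0 : forall i, 0 < mass nu q i.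

Lemma Ex_coord_cell k i : Ex nu (fun y : V => (y : 'rV[R]_d) ord0 k * cell q i y) =
  mass nu q i * barycenter i ord0 k.
Proof. by rewrite mxE mulVKf // gt_eqF. Qed.

Lemma Ex_dotv_step (G : I -> 'rV[R]_d) :
  Ex nu (fun y : V => dotv (G (q y)) (y : 'rV[R]_d)) =
  \sum_i mass nu q i * dotv (G i) (barycenter i).
Proof.
have hi i : intg nu (fun y : V => dotv (G i) (y : 'rV[R]_d)).
  exact: L2_dotv (L2_cst _ _) L.
transitivity (Ex nu (fun y : V => \sum_i dotv (G i) (y : 'rV[R]_d) * cell q i y)).
  by congr Ex; apply/funext => y; rewrite (sum_cell q (fun i => dotv (G i) y)).
rewrite Ex_sum => [|i]; last exact: intg_cell.
apply: eq_bigr => i _.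
transitivity (Ex nu (fun y : V => \sum_k G i ord0 k * ((y : 'rV[R]_d) ord0 k * cell q i y))).
  congr Ex; apply/funext => y; rewrite /dotv mulr_suml.
  by apply: eq_bigr => k _; rewrite mulrA.
have hk k : intg nu (fun y : V => (y : 'rV[R]_d) ord0 k * cell q i y).
  by apply: intg_cell => //; exact: coord_intg.
rewrite Ex_sum => [|k]; last exact: intgZ.
rewrite /dotv mulr_sumr; apply: eq_bigr => k _.
by rewrite ExZ // Ex_coord_cell mulrCA.
Qed.

End Barycenter.

Section StepCoupling.
Context {R : realType} {d : nat} {disp : measure_display} {T : measurableType disp}.
Local Notation V := (borelRd R d).
Variables (P : probability T R) (nu0 : probability V R) (I J : finType).
Variables (q1 : T -> I) (q0 : V -> J) (g : I -> J -> R).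
Hypotheses (mq1 : measurable_partition q1) (mq0 : measurable_partition q0).
Hypotheses (a_gt0 : forall i, 0 < mass P q1 i) (b_gt0 : forall j, 0 < mass nu0 q0 j).
Hypotheses (g_ge0 : forall i j, 0 <= g i j).
Hypotheses (g_row : forall i, \sum_j g i j = mass P q1 i).
Hypotheses (g_col : forall j, \sum_i g i j = mass nu0 q0 j).
Local Notation a := (mass P q1).
Local Notation b := (mass nu0 q0).
Hypothesis L0 : L2 nu0 (fun y : V => y : 'rV[R]_d).

(** Mean of the second variable under the glued coupling, given that the first
    one lies in the cell [i]. *)
Definition cond_bary i : 'rV[R]_d := (a i)^-1 *: \sum_j g i j *: barycenter nu0 _ q0 j.

(** The product measure is reweighted by g i j / (a i * b j) on the product of
    the cells i and j. The marginals are preserved because the rows and columns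
    of g sum up to the masses, and quantities linear in the second variable only
    see its conditional means. *)
Lemma step_coupling : exists Pi : probability (T * V)%type R,
  [/\ has_law Pi fst P, has_law Pi snd nu0 &
   forall G : T -> 'rV[R]_d, L2 P G ->
     Ex Pi (fun z => dotv (G z.1) (z.2 : 'rV[R]_d)) =
     Ex P (fun w => dotv (G w) (cond_bary (q1 w)))].
Proof.
pose Q := (P \x nu0)%E.
pose C (k : I * J) : set (T * V) := (q1 @^-1` [set k.1]) `*` (q0 @^-1` [set k.2]).
pose r (k : I * J) : R := g k.1 k.2 / (a k.1 * b k.2).
pose rho z := \sum_k r k * (cell q1 k.1 z.1 * cell q0 k.2 z.2) : R.
have mC k : measurable (C k) by apply: measurableX; [exact: mq1|exact: mq0].
have r0 k : 0 <= r k by rewrite divr_ge0 // mulr_ge0 // ltW.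
have rhoE : (fun z => \sum_k r k * \1_(C k) z) = rho.
  apply/funext => z; apply: eq_bigr => k _; congr (_ * _).
  rewrite !cellE !indicE -natrM mulnb; congr ((nat_of_bool _)%:R).
  by apply/idP/andP; rewrite !inE.
have star (f : T -> R) (h : V -> R) : intg P f -> intg nu0 h ->
    intg Q (fun z => f z.1 * h z.2) /\
    Ex Q (fun z => (f z.1 * h z.2) * rho z) =
    \sum_i \sum_j r (i, j) *
      (Ex P (fun w => f w * cell q1 i w) * Ex nu0 (fun y => h y * cell q0 j y)).
  move=> hf hh; split; first by have [] := Ex_prod _ _ _ _ hf hh.
  have hk k := Ex_prod P nu0 _ _ (intg_cell _ _ mq1 _ k.1 hf) (intg_cell _ _ mq0 _ k.2 hh).
  transitivity (Ex Q (fun z => \sum_k r k *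
      ((f z.1 * cell q1 k.1 z.1) * (h z.2 * cell q0 k.2 z.2)))).
    congr Ex; apply/funext => z; rewrite /rho mulr_sumr; apply: eq_bigr => k _.
    by ring.
  rewrite Ex_sum => [|k]; last by apply: intgZ; case: (hk k).
  rewrite pair_bigA /=; apply: eq_bigr => -[i j] _.
  by have [hi hE] := hk (i, j); rewrite ExZ // hE.
have cell1 (S : measurableType _) (PS : probability S R) (K : finType) (q : S -> K) k :
    Ex PS (fun w => 1 * cell q k w) = mass PS q k.
  by congr Ex; apply/funext => w; rewrite mul1r.
have rowE i : \sum_j r (i, j) * b j = 1.
  transitivity ((a i)^-1 * \sum_j g i j); last by rewrite g_row mulVf // gt_eqF.
  rewrite mulr_sumr; apply: eq_bigr => j _; rewrite /r /=.
  by field; rewrite !gt_eqF.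
have colE j : \sum_i r (i, j) * a i = 1.
  transitivity ((b j)^-1 * \sum_i g i j); last by rewrite g_col mulVf // gt_eqF.
  rewrite mulr_sumr; apply: eq_bigr => i _; rewrite /r /=.
  by field; rewrite !gt_eqF.
have first_marg (f : T -> R) : intg P f ->
    \sum_i \sum_j r (i, j) * (Ex P (fun w => f w * cell q1 i w) *
      Ex nu0 (fun y => 1 * cell q0 j y)) = Ex P f.
  move=> hf; rewrite (Ex_partition _ _ mq1 _ hf); apply: eq_bigr => i _.
  under eq_bigr do rewrite cell1 mulrCA mulrC.
  by rewrite -mulr_suml rowE mul1r.
have second_marg (h : V -> R) : intg nu0 h ->
    \sum_i \sum_j r (i, j) * (Ex P (fun w => 1 * cell q1 i w) *
      Ex nu0 (fun y => h y * cell q0 j y)) = Ex nu0 h.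
  move=> hh; rewrite (Ex_partition _ _ mq0 _ hh) exchange_big /=.
  apply: eq_bigr => j _.
  under eq_bigr do rewrite cell1 mulrA.
  by rewrite -mulr_suml colE mul1r.
have i1 := intg_cst P 1; have i0 := intg_cst nu0 1.
have [] := reweight Q _ C r mC r0.
  rewrite rhoE; have [_ e] := star _ _ i1 i0.
  transitivity (Ex Q (fun z => 1 * 1 * rho z)).
    by congr Ex; apply/funext => z; rewrite !mul1r.
  by rewrite e first_marg // Ex_cst.
move=> Pi HPi'; exists Pi.
have HPi f : intg Q f -> intg Pi f /\ Ex Pi f = Ex Q (fun z => f z * rho z).
  by rewrite -rhoE; exact: HPi'.
have HP (f : T -> R) (h : V -> R) : intg P f -> intg nu0 h ->
    intg Pi (fun z => f z.1 * h z.2) /\ Ex Pi (fun z => f z.1 * h z.2) =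
    \sum_i \sum_j r (i, j) *
      (Ex P (fun w => f w * cell q1 i w) * Ex nu0 (fun y => h y * cell q0 j y)).
  move=> hf hh; have [h1 h2] := star f h hf hh; have [h3 h4] := HPi _ h1.
  by rewrite h4.
split.
- split; first exact: measurable_fst.
  move=> A mA; have mF : measurable (fst @^-1` A : set (T * V)).
    by rewrite -[X in measurable X]setTI; exact: measurable_fst.
  apply: etrans (prob_Ex _ _ mF) (etrans _ (esym (prob_Ex _ _ mA))).
  have [_] := HP _ _ (intg_indic P _ mA) i0.
  rewrite first_marg => [e|]; last exact: intg_indic.
  by rewrite -e; congr (_%:E); congr Ex; apply/funext => z; rewrite mulr1.
- split; first exact: measurable_snd.
  move=> A mA; have mF : measurable (snd @^-1` A : set (T * V)).
    by rewrite -[X in measurable X]setTI; exact: measurable_snd.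
  apply: etrans (prob_Ex _ _ mF) (etrans _ (esym (prob_Ex _ _ mA))).
  have [_] := HP _ _ i1 (intg_indic nu0 _ mA).
  rewrite second_marg => [e|]; last exact: intg_indic.
  by rewrite -e; congr (_%:E); congr Ex; apply/funext => z; rewrite mul1r.
move=> G LG.
have hG k : intg P (fun w => G w ord0 k).
  apply: (le_intg _ _ _ _ _ (intgD _ _ _ (intg_cst P 1) (L2_sqnorm _ _ LG))).
    by case: LG.
  move=> w; have := sqnorm_coord (G w) k.
  have := sqr_ge0 (G w ord0 k - 1); have := sqr_ge0 (G w ord0 k + 1).
  by rewrite ler_norml; nra.
have h0 k := coord_intg nu0 L0 k.
rewrite {1}/dotv Ex_sum => [|k]; last by have [] := HP _ _ (hG k) (h0 k).
have cB i k : cond_bary i ord0 k = \sum_j r (i, j) * (b j * barycenter nu0 _ q0 j ord0 k).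
  rewrite /cond_bary mxE summxE mulr_sumr; apply: eq_bigr => j _.
  by rewrite mxE /r /=; field; rewrite !gt_eqF.
have hB k i : intg P (fun w => G w ord0 k * cell q1 i w) by exact: intg_cell.
transitivity (\sum_k \sum_i Ex P (fun w => G w ord0 k * cell q1 i w) * cond_bary i ord0 k).
  apply: eq_bigr => k _; have [_ ->] := HP _ _ (hG k) (h0 k).
  apply: eq_bigr => i _; rewrite cB mulr_sumr; apply: eq_bigr => j _.
  by rewrite Ex_coord_cell // mulrCA.
transitivity (Ex P (fun w => \sum_k \sum_i cond_bary i ord0 k * (G w ord0 k * cell q1 i w))).
  rewrite Ex_sum => [|k]; last by apply: intg_sum => i; exact: intgZ.
  apply: eq_bigr => k _; rewrite Ex_sum => [|i]; last exact: intgZ.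
  by apply: eq_bigr => i _; rewrite ExZ // mulrC.
congr Ex; apply/funext => w; rewrite /dotv; apply: eq_bigr => k _.
under eq_bigr do rewrite mulrCA mulrA.
rewrite (sum_cell q1 (fun i => G w ord0 k * cond_bary i ord0 k)) //.
Qed.

End StepCoupling.

(** * The score of a discrete coupling *)

Section Score.
Context {R : realType} {d : nat}.
Local Notation V := (borelRd R d).
Local Notation Id := (fun x : V => x : 'rV[R]_d).
Variables (nu0 nu1 : probability V R) (I J : finType).
Variables (q1 : V -> I) (q0 : V -> J) (g : I -> J -> R).
Hypotheses (h0 : in_P2 nu0) (h1 : in_P2 nu1).
Hypotheses (mq1 : measurable_partition q1) (mq0 : measurable_partition q0).
Hypotheses (a_gt0 : forall i, 0 < mass nu1 q1 i) (b_gt0 : forall j, 0 < mass nu0 q0 j).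
Hypotheses (g_ge0 : forall i j, 0 <= g i j).
Hypotheses (g_row : forall i, \sum_j g i j = mass nu1 q1 i).
Hypotheses (g_col : forall j, \sum_i g i j = mass nu0 q0 j).
Variables (t : R) (t1 : 1 < t).
Local Notation c := ((t - 1) / t).

Definition step_map (y : V) : 'rV[R]_d := cond_bary nu1 nu0 _ _ q1 q0 g (q1 y).

(** The common lower bound for the primal and the dual cost, up to second
    moments. *)
Definition score : R :=
  Ex nu1 (fun y : V => dotv (y : 'rV[R]_d) (step_map y) - c / 2 * sqnorm (step_map y)).

Lemma step_map_L2 : L2 nu1 step_map.
Proof. exact: L2_step. Qed.

Lemma scoreE : score = Ex nu1 (fun y : V => dotv (y : 'rV[R]_d) (step_map y)) -
  c / 2 * Ex nu1 (fun y => sqnorm (step_map y)).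
Proof.
have L1 := proj1 (in_P2P _) h1; have LB := step_map_L2.
rewrite /score ExB ?ExZ //; first exact: L2_sqnorm LB.
  exact: L2_dotv L1 LB.
by apply: intgZ; exact: L2_sqnorm LB.
Qed.

(** Weak duality for the glued coupling of nu1 and nu0, applied to the Fenchel
    inequality with its quadratic remainder. *)
Lemma dual_ge_score u D : admissible t u -> dual_cost nu0 nu1 u = D%:E ->
  score + c / 2 * moment nu0 +
    c / 2 * Ex nu1 (fun y => sqnorm (step_map y - gradient (legendre u) y)) <= D.
Proof.
move=> au uD; have t1' := t1.
have L0 := proj1 (in_P2P _) h0; have L1 := proj1 (in_P2P _) h1.
have [Pi [l1 l0 PiE]] := step_coupling nu1 nu0 _ _ _ _ g mq1 mq0 a_gt0 b_gt0 g_ge0 g_row g_col L0.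
set p := gradient (legendre u).
have Lp : L2 nu1 p := gradient_L2 _ t1 _ au _ L1.
have LB := step_map_L2.
have [lE _ QG _] := admissible_legendre _ t1 _ au.
(* the coupling only sees z linearly, so |z - p y|^2 is expanded *)
have LG : L2 nu1 (fun y : V => (y : 'rV[R]_d) - c *: p y) by apply: L2B => //; exact: L2Z.
have P1 := law_L2 _ _ _ l1 _ L1; have P0 := law_L2 _ _ _ l0 _ L0.
have Pp := law_L2 _ _ _ l1 _ Lp; have PG := law_L2 _ _ _ l1 _ LG.
pose h (z : V * V) := dotv ((z.1 : 'rV[R]_d) - c *: p z.1) (z.2 : 'rV[R]_d) +
  (c / 2 * sqnorm (z.2 : 'rV[R]_d) + c / 2 * sqnorm (p z.1)).
have i1 := L2_dotv _ _ _ PG P0.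
have i2 := intgZ _ (c / 2) _ (L2_sqnorm _ _ P0).
have i3 := intgZ _ (c / 2) _ (L2_sqnorm _ _ Pp).
have hh : intg Pi h by apply: intgD => //; exact: intgD.
have wd : ((Ex Pi h)%:E <= dual_cost nu0 nu1 u)%E.
  apply: weak_duality l1 l0 _ _ hh _.
  - by apply: legendre_minorized => //; case: au.
  - exact: admissible_minorized t1 _ au _.
  move=> z; rewrite lE; have := QG z.1 z.2; have [[uN _] _ _] := au.
  have := uN z.2; case: (u z.2) => [r||] // _; last by rewrite addey ?leey.
  rewrite -EFinD !lee_fin /h sqnormB !dotvE -/p (dotvC (z.2 : 'rV[R]_d) z.1) (dotvC (z.2 : 'rV[R]_d) (p _)).
  lra.
rewrite uD lee_fin in wd; apply: le_trans wd; clear uD.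
have -> : Ex Pi h = Ex nu1 (fun y : V => dotv ((y : 'rV[R]_d) - c *: p y) (step_map y)) +
   (c / 2 * moment nu0 + c / 2 * Ex nu1 (fun y => sqnorm (p y))).
  rewrite /h ExD ?ExD ?ExZ //; last 3 first.
  - exact: L2_sqnorm Pp.
  - exact: L2_sqnorm P0.
  - exact: intgD.
  rewrite (PiE _ LG) -/step_map; congr (_ + (_ * _ + _ * _)).
    exact: (law_Ex _ _ _ l0 (fun x : V => sqnorm (x : 'rV[R]_d)) (measurable_dotv _ _ mvec_id mvec_id)).
  by apply: (law_Ex _ _ _ l1 (fun y => sqnorm (p y))); apply: measurable_dotv; case: Lp.
rewrite scoreE (Ex_sqnormB _ _ _ LB Lp).
have -> : Ex nu1 (fun y : V => dotv ((y : 'rV[R]_d) - c *: p y) (step_map y)) =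
   Ex nu1 (fun y : V => dotv (y : 'rV[R]_d) (step_map y)) -
   c * Ex nu1 (fun y : V => dotv (step_map y) (p y)).
  rewrite -ExZ; last exact: L2_dotv LB Lp.
  rewrite -ExB; last 2 first.
  - exact: L2_dotv L1 LB.
  - by apply: intgZ; exact: L2_dotv LB Lp.
  by congr Ex; apply/funext => y; rewrite !dotvE (dotvC (p y)).
lra.
Qed.

(** A coupling of mu and nu1 is glued to nu0, which couples mu and nu0 and
    bounds their distance from above; completing the square leaves the remainder. *)
Lemma primal_ge_score (mu : probability V R) (gam : probability (V * V)%type R) :
  in_P2 mu -> has_law gam fst mu -> has_law gam snd nu1 ->
  score - moment nu1 / 2 - moment nu0 / (2 * t) + (2 * t * (t - 1))^-1 *
     Ex gam (fun z => sqnorm ((z.1 : 'rV[R]_d) -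
       (t *: (z.2 : 'rV[R]_d) - (t - 1) *: step_map z.2)))
  <= (2 * (t - 1))^-1 * Ex gam (fun z => sqnorm (z.1 - z.2 : 'rV[R]_d)) -
     (2 * t)^-1 * W2r mu nu0.
Proof.
move=> hmu l1 l2; have t1' := t1; have t0 : 0 < t by lra.
have L0 := proj1 (in_P2P _) h0; have L1 := proj1 (in_P2P _) h1.
have Lmu := proj1 (in_P2P _) hmu; have LB := step_map_L2.
(* gam itself is glued to nu0, along the cells of its second variable *)
pose q1' (z : V * V) := q1 z.2.
have mq1' : measurable_partition q1'.
  move=> i; rewrite -[X in measurable X]setTI.
  exact: (measurable_snd measurableT (q1 @^-1` [set i]) (mq1 i)).
have aE i : mass gam q1' i = mass nu1 q1 i.
  by apply: (law_Ex _ _ _ l2 (cell q1 i)); exact: measurable_cell.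
have bE i : cond_bary gam nu0 _ _ q1' q0 g i = cond_bary nu1 nu0 _ _ q1 q0 g i.
  by rewrite /cond_bary aE.
have [||Pi [lP l0 PiE]] := step_coupling gam nu0 _ _ q1' q0 g mq1' mq0 _ b_gt0 g_ge0 _ g_col L0.
- by move=> i; rewrite aE.
- by move=> i; rewrite aE.
have G1 := law_L2 _ _ _ l1 _ Lmu; have G2 := law_L2 _ _ _ l2 _ L1.
have GB := law_L2 _ _ _ l2 _ LB.
have lX := has_law_comp _ _ _ _ _ lP l1.
have X1 := law_L2 _ _ _ lX _ Lmu; have X0 := law_L2 _ _ _ l0 _ L0.
have sqm := measurable_dotv _ _ (@mvec_id R d) mvec_id.
have w : W2r mu nu0 <= moment mu + moment nu0 -
    2 * Ex gam (fun z => dotv (z.1 : 'rV[R]_d) (step_map z.2)).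
  apply: le_trans (W2r_le _ _ hmu h0 _ _ _ lX l0) _.
  rewrite (Ex_sqnormB _ _ _ X1 X0).
  rewrite (law_Ex _ _ _ lX (fun x : V => sqnorm (x : 'rV[R]_d)) sqm).
  rewrite (law_Ex _ _ _ l0 (fun x : V => sqnorm (x : 'rV[R]_d)) sqm).
  rewrite (PiE (fun z => z.1 : 'rV[R]_d) G1) -/(moment mu) -/(moment nu0).
  rewrite (_ : (fun z : V * V => dotv (z.1 : 'rV[R]_d) (cond_bary gam nu0 I J q1' q0 g (q1' z)))
     = fun z => dotv (z.1 : 'rV[R]_d) (step_map z.2)); first by lra.
  by apply/funext => z; rewrite bE.
have eS : score = Ex gam (fun z => dotv (z.2 : 'rV[R]_d) (step_map z.2)) -
   c / 2 * Ex gam (fun z => sqnorm (step_map z.2)).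
  rewrite scoreE; congr (_ - _ * _); apply/esym.
    apply: (law_Ex _ _ _ l2 (fun y : V => dotv (y : 'rV[R]_d) (step_map y))).
    by apply: measurable_dotv; [exact: mvec_id|case: LB].
  apply: (law_Ex _ _ _ l2 (fun y : V => sqnorm (step_map y))).
  by apply: measurable_dotv; case: LB.
have eX : Ex gam (fun z => sqnorm (z.1 : 'rV[R]_d)) = moment mu.
  exact: (law_Ex _ _ _ l1 (fun x : V => sqnorm (x : 'rV[R]_d)) sqm).
have eY : Ex gam (fun z => sqnorm (z.2 : 'rV[R]_d)) = moment nu1.
  exact: (law_Ex _ _ _ l2 (fun x : V => sqnorm (x : 'rV[R]_d)) sqm).
have GT : L2 gam (fun z => t *: (z.2 : 'rV[R]_d) - (t - 1) *: step_map z.2).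
  by apply: L2B; apply: L2Z.
rewrite (Ex_sqnormB _ _ _ G1 GT) (Ex_sqnormB _ _ _ G1 G2) eX eY eS.
have eT : Ex gam (fun z => sqnorm (t *: (z.2 : 'rV[R]_d) - (t - 1) *: step_map z.2)) =
    t ^+ 2 * moment nu1 - 2 * t * (t - 1) * Ex gam (fun z => dotv (z.2 : 'rV[R]_d) (step_map z.2)) +
    (t - 1) ^+ 2 * Ex gam (fun z => sqnorm (step_map z.2)).
  have := Ex_sqnorm_comb gam t (- (t - 1)) _ _ G2 GB; rewrite eY.
  have -> : (fun w : V * V => sqnorm (t *: (w.2 : 'rV[R]_d) + - (t - 1) *: step_map w.2)) =
     fun z => sqnorm (t *: (z.2 : 'rV[R]_d) - (t - 1) *: step_map z.2).
    by apply/funext => z; rewrite scaleNr.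
  by move=> ->; ring.
have eXT : Ex gam (fun z => dotv (z.1 : 'rV[R]_d) (t *: (z.2 : 'rV[R]_d) - (t - 1) *: step_map z.2)) =
   t * Ex gam (fun z => dotv (z.1 : 'rV[R]_d) (z.2 : 'rV[R]_d)) -
   (t - 1) * Ex gam (fun z => dotv (z.1 : 'rV[R]_d) (step_map z.2)).
  have j1 := L2_dotv _ _ _ G1 G2; have j2 := L2_dotv _ _ _ G1 GB.
  rewrite -!ExZ // -ExB; [|exact: intgZ..].
  by congr Ex; apply/funext => z; rewrite !dotvE.
rewrite eT eXT.
set XY := Ex gam (fun z => dotv (z.1 : 'rV[R]_d) (z.2 : 'rV[R]_d)).
set XB := Ex gam (fun z => dotv (z.1 : 'rV[R]_d) (step_map z.2)) in w *.
set YB := Ex gam (fun z => dotv (z.2 : 'rV[R]_d) (step_map z.2)).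
set BB := Ex gam _.
have w' : (2 * t)^-1 * W2r mu nu0 <= (2 * t)^-1 * (moment mu + moment nu0 - 2 * XB).
  by rewrite ler_wpM2l // invr_ge0 mulr_ge0 // ltW.
rewrite lerBrDr; apply: le_trans (lerD (lexx _) w') _.
rewrite le_eqVlt; apply/orP; left; apply/eqP.
by field; rewrite !gt_eqF //; lra.
Qed.

End Score.

(** * Duality for discrete marginals *)

Section FiniteDuality.
Context {R : realType} {d : nat} (I J : finType).
Variables (a : I -> R) (b : J -> R) (y : I -> 'rV[R]_d) (z : J -> 'rV[R]_d).
Hypotheses (a_gt0 : forall i, 0 < a i) (b_gt0 : forall j, 0 < b j).
Hypotheses (a_sum : \sum_i a i = 1) (b_sum : \sum_j b j = 1).
Variables (t e : R) (t1 : 1 < t) (e0 : 0 < e).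

Definition slack (phi : I -> R) (v : J -> R) (x : I -> 'rV[R]_d) i j : R :=
  dotv (x i) (z j) - v j - phi i.

(** Penalization of the problem of minimizing sum a phi + sum b v plus the
    quadratic term under the constraints dotv (x i) (z j) <= phi i + v j. *)
Definition penalized phi v x : R :=
  \sum_i a i * phi i + \sum_j b j * v j +
  (2 * e)^-1 * \sum_i \sum_j (Num.max (slack phi v x i j) 0) ^+ 2 +
  (2 * (t - 1))^-1 * \sum_i a i * sqnorm (t *: y i - x i).

(** The linear terms are absorbed in the penalty, which makes each summand
    bounded below. *)
Lemma penalizedE phi v x : penalized phi v x =
  \sum_i \sum_j ((2 * e)^-1 * (Num.max (slack phi v x i j) 0) ^+ 2
     - a i * b j * slack phi v x i j) +
  \sum_i a i * (dotv (x i) (\sum_j b j *: z j) +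
     (2 * (t - 1))^-1 * sqnorm (t *: y i - x i)).
Proof.
have dsum i : dotv (x i) (\sum_j b j *: z j) = \sum_j b j * dotv (x i) (z j).
  rewrite dotvC; elim/big_rec2 : _ => [|j s1 s2 _ <-]; first by rewrite dot0v.
  by rewrite !dotvE (dotvC (z j)).
have h : \sum_i \sum_j a i * b j * slack phi v x i j =
    \sum_i a i * dotv (x i) (\sum_j b j *: z j) -
    (\sum_i a i * phi i + \sum_j b j * v j).
  have e1 i : \sum_j a i * b j * slack phi v x i j = a i * dotv (x i) (\sum_j b j *: z j)
      - a i * (\sum_j b j * v j) - a i * phi i.
    rewrite dsum !mulr_sumr -sumrB -[a i * phi i]mulr1 -b_sum mulr_sumr -sumrB.
    by apply: eq_bigr => j _; rewrite /slack; ring.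
  rewrite (eq_bigr _ (fun i _ => e1 i)) !sumrB -mulr_suml a_sum; ring.
rewrite /penalized.
under [X in _ = X + _]eq_bigr do rewrite sumrB.
rewrite sumrB h; under [X in _ = _ + X]eq_bigr do rewrite mulrDr mulrCA.
rewrite big_split /= -mulr_sumr.
under [X in _ = X - _ + _]eq_bigr do rewrite -mulr_sumr.
by rewrite -mulr_sumr; ring.
Qed.

(** The translation invariance which has to be factored out before compactness
    can be used. *)
Lemma penalized_shift phi v x s :
  penalized (fun i => phi i + s) (fun j => v j - s) x = penalized phi v x.
Proof.
rewrite /penalized /slack; congr (_ + _ * _ + _).
  under eq_bigr do rewrite mulrDr; rewrite big_split /= -mulr_suml a_sum.
  under [X in _ + X = _]eq_bigr do rewrite mulrBr; rewrite sumrB -mulr_suml b_sum.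
  ring.
apply: eq_bigr => i _; apply: eq_bigr => j _; congr (Num.max _ _ ^+ 2); ring.
Qed.

Lemma penalized_bound_below (k : R) s : 0 <= k ->
  k * `|s| - 2 * e * k ^+ 2 <= (2 * e)^-1 * (Num.max s 0) ^+ 2 - k * s.
Proof.
have e0' := e0; move=> k0; have [s0|s0] := leP s 0.
  rewrite expr0n /= mulr0 ler0_norm //.
  by have := mulr_ge0 (ltW e0) (sqr_ge0 k); lra.
rewrite gtr0_norm //.
have : 0 <= (2 * e)^-1 * (s - 2 * e * k) ^+ 2.
  by rewrite mulr_ge0 ?sqr_ge0 // invr_ge0; lra.
have -> : (2 * e)^-1 * (s - 2 * e * k) ^+ 2 =
   (2 * e)^-1 * s ^+ 2 - 2 * k * s + 2 * e * k ^+ 2 by field; lra.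
lra.
Qed.

Lemma penalized_quad_below (k : R) (x y1 Z : 'rV[R]_d) : 0 < k ->
  k / 4 * sqnorm x - (k * t ^+ 2 * sqnorm y1 + k^-1 * sqnorm Z) <=
  dotv x Z + k * sqnorm (t *: y1 - x).
Proof.
move=> k0.
have := sqnormD_le (t *: y1) (x - t *: y1); rewrite addrC subrK -(opprB (t *: y1)) sqnormN sqnormZ => h1.
have k2 : 0 < k / 2 by lra.
have := dotv_young (k / 2) x (- Z) k2; rewrite dotvNr sqnormN invf_div => h2.
have := ler_wpM2l (ltW k0) h1 => h3.
have e1 : (2 / k = 2 * k^-1) by [].
rewrite e1 in h2; lra.
Qed.

(* The unknowns (phi, v, x) are packed in one row vector, for which closed
   bounded boxes are known to be compact. *)
Local Notation K := ((I + J) + (I * 'I_d))%type.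
Local Notation n := #|{: K}|.
Definition param (th : 'rV[R]_n) (k : K) : R := th ord0 (enum_rank k).
Definition param_phi th i := param th (inl (inl i)).
Definition param_v th j := param th (inl (inr j)).
Definition param_x th i : 'rV[R]_d := \row_k param th (inr (i, k)).
Definition penalized_param th := penalized (param_phi th) (param_v th) (param_x th).
Definition pack (phi : I -> R) (v : J -> R) (x : I -> 'rV[R]_d) : 'rV[R]_n :=
  \row_l match enum_val l with
         | inl (inl i) => phi i | inl (inr j) => v j | inr (i, k) => x i ord0 k
         end.

Lemma pack_penalized phi v x : penalized_param (pack phi v x) = penalized phi v x.
Proof.
rewrite /penalized_param; congr penalized; apply/funext => i.
- by rewrite /param_phi /param mxE enum_rankK.
- by rewrite /param_v /param mxE enum_rankK.
- by apply/rowP => k; rewrite mxE /param mxE enum_rankK.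
Qed.

Lemma cont_sum (S : topologicalType) (A : Type) (s : seq A) (f : A -> S -> R) :
  (forall i, continuous (f i)) -> continuous (fun w => \sum_(i <- s) f i w).
Proof.
move=> cf w; apply: cvg_big => [|i _]; first exact: add_continuous.
exact: cf.
Qed.

Lemma penalized_param_cont : continuous penalized_param.
Proof.
have cp k : continuous (fun th => param th k) by move=> th; exact: coord_continuous.
have cD (f g : 'rV[R]_n -> R) : continuous f -> continuous g -> continuous (fun w => f w + g w).
  by move=> cf cg w; exact: (cvgD (cf w) (cg w)).
have cB (f g : 'rV[R]_n -> R) : continuous f -> continuous g -> continuous (fun w => f w - g w).
  by move=> cf cg w; exact: (cvgB (cf w) (cg w)).
have cM (f g : 'rV[R]_n -> R) : continuous f -> continuous g -> continuous (fun w => f w * g w).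
  by move=> cf cg w; exact: (cvgM (cf w) (cg w)).
have cmax (f : 'rV[R]_n -> R) : continuous f -> continuous (fun w => Num.max (f w) 0).
  move=> cf w; exact: (@continuous_max _ _ f (fun=> 0) w (cf w) (@cst_continuous _ _ (0 : R) w)).
have cd (f : 'rV[R]_n -> 'rV[R]_d) (Z : 'rV[R]_d) :
    (forall k, continuous (fun w => f w ord0 k)) -> continuous (fun w => dotv (f w) Z).
  move=> cf; apply: cont_sum => k; apply: (cM _ _) => //; exact: cst_continuous.
have cx i k : continuous (fun th => param_x th i ord0 k).
  by under eq_fun do rewrite mxE; exact: cp.
have cs i j : continuous (fun w => slack (param_phi w) (param_v w) (param_x w) i j).
  apply: (cB (fun w => dotv (param_x w i) (z j) - param_v w j) (fun w => param_phi w i)).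
    apply: (cB (fun w => dotv (param_x w i) (z j)) (fun w => param_v w j)).
      exact: (cd (fun w => param_x w i) (z j) (cx i)).
    exact: (cp (inl (inr j))).
  exact: (cp (inl (inl i))).
rewrite /penalized_param /penalized.
apply: (cD _ _); [apply: (cD _ _); [apply: (cD _ _)|]|].
- apply: cont_sum => i; apply: contZ; exact: cp.
- apply: cont_sum => j; apply: contZ; exact: cp.
- apply: contZ; apply: cont_sum => i; apply: cont_sum => j.
  by apply: (cM _ _); apply: (cmax _); exact: cs.
- apply: contZ; apply: cont_sum => i; apply: contZ; rewrite /sqnorm /dotv.
  apply: cont_sum => k; under eq_fun do rewrite !mxE.
  by apply: (cM _ _); apply: (cB _ _); ((exact: cp) || (exact: cst_continuous)).
Qed.

(** A finite family of positive numbers is bounded below by the inverse of one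
    plus the sum of their inverses. *)
Lemma finite_lower_bound (L : finType) (f : L -> R) : (forall l, 0 < f l) ->
  exists2 r : R, 0 < r & forall l, r <= f l.
Proof.
move=> f0; have S0 : 0 <= \sum_l (f l)^-1 by apply: sumr_ge0 => l _; rewrite invr_ge0 ltW.
exists (1 + \sum_l (f l)^-1)^-1; first by rewrite invr_gt0; lra.
move=> l; rewrite -[f l]invrK lef_pV2 ?posrE ?invr_gt0 //; last by lra.
rewrite (bigD1 l) //= addrCA lerDl addr_ge0 //.
by apply: sumr_ge0 => k _; rewrite invr_ge0 ltW.
Qed.

(** The functional controls the slacks and the points x i; together with the
    normalisation of one v j this controls all the unknowns. *)
Lemma penalized_coercive : exists C1 : R, forall phi v x,
  (forall i j, a i * b j * `|slack phi v x i j| <= penalized phi v x + C1) /\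
  (forall i, a i * ((2 * (t - 1))^-1 / 4 * sqnorm (x i)) <= penalized phi v x + C1).
Proof.
have t1' := t1; set k := (2 * (t - 1))^-1.
have k0 : 0 < k by rewrite /k invr_gt0; lra.
pose Z := \sum_j b j *: z j.
pose c1 i j := 2 * e * (a i * b j) ^+ 2.
pose c2 i := k * t ^+ 2 * sqnorm (y i) + k^-1 * sqnorm Z.
exists (\sum_i \sum_j c1 i j + \sum_i a i * c2 i) => phi v x.
have low : \sum_i \sum_j (a i * b j * `|slack phi v x i j|) +
   \sum_i a i * (k / 4 * sqnorm (x i)) <=
   penalized phi v x + (\sum_i \sum_j c1 i j + \sum_i a i * c2 i).
  rewrite penalizedE addrACA; apply: lerD.
    rewrite -big_split; apply: ler_sum => i _; rewrite -big_split; apply: ler_sum => j _ /=.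
    have ab0 : 0 <= a i * b j by rewrite mulr_ge0 // ltW.
    by have := penalized_bound_below (a i * b j) (slack phi v x i j) ab0; rewrite /c1; lra.
  rewrite -big_split; apply: ler_sum => i _ /=; rewrite -mulrDr.
  apply: ler_wpM2l; first exact: ltW.
  by have := penalized_quad_below k (x i) (y i) Z k0; rewrite /c2 -/k; lra.
have p1 i j : 0 <= a i * b j * `|slack phi v x i j|.
  by rewrite !mulr_ge0 // ltW.
have p2 i : 0 <= a i * (k / 4 * sqnorm (x i)).
  by rewrite !mulr_ge0 ?sqnorm_ge0 ?ltW //; lra.
have s1 : 0 <= \sum_i \sum_j (a i * b j * `|slack phi v x i j|).
  by apply: sumr_ge0 => i _; apply: sumr_ge0.
have s2 : 0 <= \sum_i a i * (k / 4 * sqnorm (x i)) by apply: sumr_ge0.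
split=> [i j|i].
  apply: le_trans low; apply: le_trans (_ : _ <= \sum_i \sum_j (a i * b j * `|slack phi v x i j|)) _; last by lra.
  rewrite (bigD1 i) //= (bigD1 j) //= -addrA lerDl addr_ge0 //.
    by apply: sumr_ge0.
  by apply: sumr_ge0 => i' _; apply: sumr_ge0.
apply: le_trans low; apply: le_trans (_ : _ <= \sum_i a i * (k / 4 * sqnorm (x i))) _; last by lra.
by rewrite (bigD1 i) //= lerDl sumr_ge0.
Qed.

Lemma sum1_inhabited (L : finType) (f : L -> R) : \sum_l f l = 1 -> exists l : L, True.
Proof.
move=> f1; case: (pickP (fun l : L => true)) => [l _|h]; first by exists l.
by move: f1; rewrite big1 => [/esym/eqP|l]; [rewrite oner_eq0|have := h l].
Qed.

Lemma penalized_min : exists phi v x, forall phi' v' x',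
  penalized phi v x <= penalized phi' v' x'.
Proof.
have t1' := t1.
have [i0 _] := sum1_inhabited _ _ a_sum; have [j0 _] := sum1_inhabited _ _ b_sum.
have [C1 coer] := penalized_coercive.
have [r r0 rab] := finite_lower_bound _ (fun k : I * J => a k.1 * b k.2)
  (fun k => mulr_gt0 (a_gt0 k.1) (b_gt0 k.2)).
have [ra ra0 raa] := finite_lower_bound _ a a_gt0.
set k := (2 * (t - 1))^-1 / 4 in coer.
have k0 : 0 < k by rewrite /k divr_gt0 // invr_gt0; lra.
pose C0 := penalized (fun=> 0) (fun=> 0) (fun=> 0).
pose B := C0 + C1.
pose Ms := B / r; pose Mx := B / (ra * k); pose Zs := \sum_j sqnorm (z j).
pose M1 := Mx + Zs + Ms; pose M := 2 * M1 + Mx + 1.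
have bnd phi v x : penalized phi v x <= C0 ->
    (forall i j, `|phi i + v j| <= M1) /\ (forall i, sqnorm (x i) <= Mx).
  move=> le0; have [h1 h2] := coer phi v x.
  have hx i : sqnorm (x i) <= Mx.
    rewrite /Mx ler_pdivlMr; last exact: mulr_gt0.
    have -> : sqnorm (x i) * (ra * k) = ra * (k * sqnorm (x i)) by ring.
    apply: le_trans (_ : _ <= a i * (k * sqnorm (x i))) _.
      by apply: ler_wpM2r => //; rewrite mulr_ge0 ?sqnorm_ge0 // ltW.
    by apply: le_trans (h2 i) _; rewrite lerD2r.
  split=> // i j; have hs : `|slack phi v x i j| <= Ms.
    rewrite /Ms ler_pdivlMr // mulrC.
    apply: le_trans (_ : _ <= a i * b j * `|slack phi v x i j|) _.
      by apply: ler_wpM2r => //; exact: (rab (i, j)).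
    by apply: le_trans (h1 i j) _; rewrite lerD2r.
  have zj : sqnorm (z j) <= Zs.
    by rewrite /Zs (bigD1 j) //= lerDl sumr_ge0 // => j' _; exact: sqnorm_ge0.
  have := sqnorm_ge0 (x i + z j); have := sqnorm_ge0 (x i - z j).
  rewrite sqnormB sqnormD => h3 h4; have h5 := hx i.
  have := sqnorm_ge0 (x i); have := sqnorm_ge0 (z j) => h6 h7.
  move: hs; rewrite ler_norml /slack => /andP[h8 h9].
  by rewrite ler_norml /M1; lra.
have [b0 x0] := bnd (fun=> 0) (fun=> 0) (fun=> 0) (lexx _).
have M10 : 0 <= M1 by apply: le_trans (b0 i0 j0).
have Mx0 : 0 <= Mx by apply: le_trans (x0 i0); exact: sqnorm_ge0.
clear b0 x0.
(* By translation invariance v j0 = 0 may be assumed, and then the sublevel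
   set of the value at 0 is contained in a box. *)
pose Kc := [set th : 'rV[R]_n | forall l, th ord0 l \in `[(- M), M]].
have cK : compact Kc.
  by apply: (@rV_compact _ _ (fun=> `[(- M), M]%classic)) => _; exact: segment_compact.
have inK phi v x : v j0 = 0 -> penalized phi v x <= C0 -> Kc (pack phi v x).
  move=> v0 /bnd[h1 h2] l; rewrite mxE in_itv /= -ler_norml.
  have hphi i : `|phi i| <= M1 by have := h1 i j0; rewrite v0 addr0.
  case: (enum_val l) => [[i|j]|[i m]].
  - by apply: le_trans (hphi i) _; rewrite /M; lra.
  - have := h1 i0 j; have := hphi i0; rewrite !ler_norml /M => /andP[] ? ? /andP[] ? ?.
    by lra.
  - have := h2 i; have := sqnorm_coord (x i) m => h3 h4.
    have := sqr_ge0 (x i ord0 m - 1); have := sqr_ge0 (x i ord0 m + 1) => h5 h6.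
    by rewrite ler_norml /M; nra.
have lF : lower_semicontinuous (fun th => (penalized_param th)%:E).
  rewrite (_ : (fun _ => _) = fun th => 0%:E + (penalized_param th)%:E)%E.
    by apply: lscD_cont; [exact: lsc_cst|exact: penalized_param_cont].
  by apply/funext => th; rewrite add0e.
have K0 : Kc (pack (fun=> 0) (fun=> 0) (fun=> 0)) by apply: inK.
have [|th thK thmin] := lsc_compact_min _ _ _ cK _ lF; first by eexists; exact: K0.
have minC0 : penalized_param th <= C0.
  by have := thmin _ K0; rewrite lee_fin pack_penalized.
exists (param_phi th), (param_v th), (param_x th) => phi' v' x'.
rewrite -/(penalized_param th) -(penalized_shift phi' v' x' (v' j0)).
set p := penalized _ _ _.
have [h|h] := leP p C0; last by apply: le_trans minC0 (ltW h).
have /thmin : Kc (pack (fun i => phi' i + v' j0) (fun j => v' j - v' j0) x').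
  by apply: inK => //; rewrite subrr.
by rewrite lee_fin pack_penalized.
Qed.

Lemma sqr_max_le (s h : R) : (Num.max (s + h) 0) ^+ 2 <=
  (Num.max s 0) ^+ 2 + 2 * Num.max s 0 * h + h ^+ 2.
Proof.
have [h1|h1] := leP (s + h) 0; have [h2|h2] := leP s 0; try nra.
Qed.

(** The principle by which a minimum gives a first-order condition when only a
    quadratic upper bound on the increment is known. *)
Lemma linear_quadratic_eq0 (A C : R) : (forall s, 0 <= s * A + s ^+ 2 * C) -> A = 0.
Proof.
move=> h; pose D := `|C| + 1; have D0 : 0 < D by rewrite /D; have := normr_ge0 C; lra.
have := h (- A / D); have -> : - A / D * A + (- A / D) ^+ 2 * C = A ^+ 2 / D ^+ 2 * (C - D).
  by field; rewrite gt_eqF.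
rewrite mulrC => h1; apply/eqP; rewrite -sqrf_eq0 eq_le sqr_ge0 andbT.
have CD : C - D <= -1 by rewrite /D; have := ler_norm C; lra.
have : A ^+ 2 / D ^+ 2 <= 0.
  have : 0 <= A ^+ 2 / D ^+ 2 by rewrite divr_ge0 ?sqr_ge0.
  nra.
by rewrite ler_pdivrMr ?exprn_gt0 // mul0r.
Qed.

Section critical.
Variables (phi : I -> R) (v : J -> R) (x : I -> 'rV[R]_d).
Hypothesis pmin : forall phi' v' x', penalized phi v x <= penalized phi' v' x'.
Let g i j := e^-1 * Num.max (slack phi v x i j) 0.

(** The Euler equation in an arbitrary direction (p, q, h): the positive part
    squared is differentiable, with derivative proportional to [g]. *)
Lemma penalized_first_order (p : I -> R) (q : J -> R) (h : I -> 'rV[R]_d) :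
  \sum_i a i * p i + \sum_j b j * q j +
  \sum_i \sum_j g i j * (dotv (h i) (z j) - q j - p i) -
  (t - 1)^-1 * \sum_i a i * dotv (t *: y i - x i) (h i) = 0.
Proof.
have t1' := t1; have e0' := e0.
pose ds i j := dotv (h i) (z j) - q j - p i.
apply: (linear_quadratic_eq0 _ ((2 * e)^-1 * (\sum_i \sum_j ds i j ^+ 2) +
  (2 * (t - 1))^-1 * \sum_i a i * sqnorm (h i))) => s.
have := pmin (fun i => phi i + s * p i) (fun j => v j + s * q j) (fun i => x i + s *: h i).
have e1 : \sum_i a i * (phi i + s * p i) = \sum_i a i * phi i + s * \sum_i a i * p i.
  by rewrite mulr_sumr -big_split; apply: eq_bigr => i _ /=; ring.
have e2 : \sum_j b j * (v j + s * q j) = \sum_j b j * v j + s * \sum_j b j * q j.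
  by rewrite mulr_sumr -big_split; apply: eq_bigr => i _ /=; ring.
have e3 : \sum_i a i * sqnorm (t *: y i - (x i + s *: h i)) =
   \sum_i a i * sqnorm (t *: y i - x i) - 2 * s * (\sum_i a i * dotv (t *: y i - x i) (h i))
   + s ^+ 2 * \sum_i a i * sqnorm (h i).
  rewrite !mulr_sumr -sumrB -big_split; apply: eq_bigr => i _ /=.
  by rewrite opprD addrA sqnormB sqnormZ dotvZr; ring.
have e4 : (2 * e)^-1 * \sum_i \sum_j Num.max (slack (fun i => phi i + s * p i)
     (fun j => v j + s * q j) (fun i => x i + s *: h i) i j) 0 ^+ 2 <=
   (2 * e)^-1 * \sum_i \sum_j Num.max (slack phi v x i j) 0 ^+ 2 +
   s * (\sum_i \sum_j g i j * ds i j) + s ^+ 2 * ((2 * e)^-1 * (\sum_i \sum_j ds i j ^+ 2)).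
  rewrite !mulr_sumr -!big_split; apply: ler_sum => i _ /=.
  rewrite !mulr_sumr -!big_split; apply: ler_sum => j _ /=.
  have -> : slack (fun i => phi i + s * p i) (fun j => v j + s * q j)
      (fun i => x i + s *: h i) i j = slack phi v x i j + s * ds i j.
    by rewrite /slack /ds !dotvE; ring.
  have := sqr_max_le (slack phi v x i j) (s * ds i j); rewrite /g.
  set m := Num.max (slack phi v x i j) 0 => le1.
  have ei : 0 <= (2 * e)^-1 by rewrite invr_ge0; lra.
  apply: le_trans (ler_wpM2l ei le1) _.
  by rewrite le_eqVlt; apply/orP; left; apply/eqP; field; lra.
rewrite /penalized e1 e2 e3.
set S1 := \sum_i a i * phi i; set S2 := \sum_j b j * v j.
set S3 := \sum_i a i * p i; set S4 := \sum_j b j * q j.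
set S5 := \sum_i a i * sqnorm (t *: y i - x i).
set S6 := \sum_i a i * dotv (t *: y i - x i) (h i).
set S7 := \sum_i a i * sqnorm (h i).
rewrite -/(ds _ _).
have e5 : (2 * (t - 1))^-1 * (S5 - 2 * s * S6 + s ^+ 2 * S7) =
  (2 * (t - 1))^-1 * S5 - s * ((t - 1)^-1 * S6) + s ^+ 2 * ((2 * (t - 1))^-1 * S7).
  by field; lra.
rewrite e5; move: e4.
under [X in _ -> _ -> 0 <= s * (_ + X - _) + _]eq_bigr do under eq_bigr do rewrite -/(ds _ _).
lra.
Qed.

Lemma critical_row i : \sum_j g i j = a i.
Proof.
have := penalized_first_order (fun i' => (i' == i)%:R) (fun=> 0) (fun=> 0).
rewrite (bigD1 i) //= eqxx mulr1 big1 ?addr0 => [|i' /negPf ->]; last by rewrite mulr0.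
rewrite [X in _ + X + _ - _](_ : _ = 0) ?addr0; last by rewrite big1 // => j _; rewrite mulr0.
rewrite [X in _ - _ * X](_ : _ = 0); last first.
  by rewrite big1 // => i' _; rewrite dotv0 mulr0.
rewrite mulr0 subr0 (bigD1 i) //= [X in _ + (_ + X)]big1 => [|i' /negPf i'i]; last first.
  by rewrite big1 // => j _; rewrite i'i dot0v !subr0 mulr0.
rewrite eqxx addr0 (_ : \sum_j _ = - \sum_j g i j); first by lra.
by rewrite -sumrN; apply: eq_bigr => j _; rewrite dot0v subr0 sub0r mulrN mulr1.
Qed.

Lemma critical_col j : \sum_i g i j = b j.
Proof.
have := penalized_first_order (fun=> 0) (fun j' => (j' == j)%:R) (fun=> 0).
rewrite [X in X + _ + _ - _](_ : _ = 0) ?add0r; last by rewrite big1 // => i _; rewrite mulr0.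
rewrite (bigD1 j) //= eqxx mulr1 big1 ?addr0 => [|j' /negPf ->]; last by rewrite mulr0.
rewrite [X in _ - _ * X](_ : _ = 0); last first.
  by rewrite big1 // => i' _; rewrite dotv0 mulr0.
rewrite mulr0 subr0 exchange_big (bigD1 j) //= [X in _ + (_ + X)]big1 => [|j' /negPf j'j]; last first.
  by rewrite big1 // => i _; rewrite j'j dot0v !subr0 mulr0.
rewrite eqxx addr0 (_ : \sum_(i in I) _ = - \sum_i g i j); first by lra.
by rewrite -sumrN; apply: eq_bigr => i _; rewrite dot0v subr0 sub0r mulrN mulr1.
Qed.

Lemma critical_bary i :
  t *: y i - x i = (t - 1) *: ((a i)^-1 *: \sum_j g i j *: z j).
Proof.
have t1' := t1.
have dsum (h : 'rV[R]_d) : dotv h (\sum_j g i j *: z j) = \sum_j g i j * dotv h (z j).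
  rewrite dotvC; elim/big_rec2 : _ => [|j s1 s2 _ <-]; first by rewrite dot0v.
  by rewrite !dotvE (dotvC (z j)).
have key (h : 'rV[R]_d) :
    dotv h (\sum_j g i j *: z j - ((t - 1)^-1 * a i) *: (t *: y i - x i)) = 0.
  have := penalized_first_order (fun=> 0) (fun=> 0) (fun i' => if i' == i then h else 0).
  rewrite [X in X + _ + _ - _](_ : _ = 0) ?add0r; last by rewrite big1 // => i' _; rewrite mulr0.
  rewrite [X in X + _ - _](_ : _ = 0) ?add0r; last by rewrite big1 // => j _; rewrite mulr0.
  rewrite (bigD1 i) //= [X in _ + X - _]big1 => [|i' /negPf i'i]; last first.
    by rewrite big1 // => j _; rewrite i'i dot0v !subr0 mulr0.
  rewrite (bigD1 i) //= [X in _ * (_ + X)]big1 => [|i' /negPf ->]; last by rewrite dotv0 mulr0.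
  rewrite eqxx !addr0 dotvDr dotvNr dotvZr dsum (dotvC h (t *: y i - x i)).
  under eq_bigr do rewrite !subr0.
  by rewrite mulrA.
have := key (\sum_j g i j *: z j - ((t - 1)^-1 * a i) *: (t *: y i - x i)).
move=> /eqP; rewrite -/(sqnorm _) sqnorm_eq0 subr_eq0 => /eqP ->.
rewrite !scalerA.
have -> : (t - 1) * (a i)^-1 * ((t - 1)^-1 * a i) = 1.
  by field; rewrite !gt_eqF ?a_gt0 //; lra.
by rewrite scale1r.
Qed.

(** The entries of [g] are at most 1 since they are nonnegative and sum up to
    1, and g i j bounds the violation of the constraint divided by [e]. *)
Lemma critical_slack i j : dotv (x i) (z j) - v j <= phi i + e.
Proof.
have e0' := e0.
have g0 i' j' : 0 <= g i' j'.
  by rewrite mulr_ge0 ?invr_ge0 ?le_max ?lexx ?orbT // ltW.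
have gle : g i j <= 1.
  rewrite -a_sum (bigD1 i) //= -critical_row (bigD1 j) //= -addrA lerDl addr_ge0 //.
    by apply: sumr_ge0.
  by apply: sumr_ge0 => i' _; exact: ltW.
have : slack phi v x i j <= e.
  apply: le_trans (_ : Num.max (slack phi v x i j) 0 <= _); first by rewrite le_max lexx.
  by move: gle; rewrite /g mulrC ler_pdivrMr // mul1r.
rewrite /slack; lra.
Qed.

(** Complementary slackness: [g] charges only the violated constraints. *)
Lemma critical_value : \sum_i a i * phi i + \sum_j b j * v j <=
  \sum_i \sum_j g i j * dotv (x i) (z j).
Proof.
have : 0 <= \sum_i \sum_j g i j * slack phi v x i j.
  apply: sumr_ge0 => i _; apply: sumr_ge0 => j _; rewrite /g.
  have ei : 0 <= e^-1 by rewrite invr_ge0 ltW.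
  have [h|h] := leP (slack phi v x i j) 0; first by rewrite mulr0 mul0r.
  by rewrite !mulr_ge0 // ltW.
have -> : \sum_i \sum_j g i j * slack phi v x i j =
   \sum_i \sum_j g i j * dotv (x i) (z j) - \sum_i \sum_j g i j * v j -
   \sum_i \sum_j g i j * phi i.
  rewrite -!sumrB; apply: eq_bigr => i _; rewrite -!sumrB; apply: eq_bigr => j _.
  by rewrite /slack; ring.
have -> : \sum_i \sum_j g i j * v j = \sum_j b j * v j.
  by rewrite exchange_big; apply: eq_bigr => j _ /=; rewrite -mulr_suml critical_col.
have -> : \sum_i \sum_j g i j * phi i = \sum_i a i * phi i.
  by apply: eq_bigr => i _; rewrite -mulr_suml critical_row.
lra.
Qed.

End critical.

(** Duality for discrete marginals, up to the error [e]: the plan [g] is read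
    off the penalty at a minimizer, which is feasible up to [e]. *)
Lemma finite_duality : exists (g : I -> J -> R) (phi : I -> R) (v : J -> R) (x : I -> 'rV[R]_d),
  [/\ forall i j, 0 <= g i j, forall i, \sum_j g i j = a i &
     forall j, \sum_i g i j = b j] /\
  [/\ forall i, t *: y i - x i = (t - 1) *: ((a i)^-1 *: \sum_j g i j *: z j),
      forall i j, dotv (x i) (z j) - v j <= phi i + e &
     \sum_i a i * phi i + \sum_j b j * v j <= \sum_i \sum_j g i j * dotv (x i) (z j)].
Proof.
have [phi [v [x pmin]]] := penalized_min.
exists (fun i j => e^-1 * Num.max (slack phi v x i j) 0), phi, v, x; split; split.
- by move=> i j; rewrite mulr_ge0 ?invr_ge0 ?le_max ?lexx ?orbT // ltW.
- exact: critical_row pmin.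
- exact: critical_col pmin.
- exact: critical_bary pmin.
- exact: critical_slack pmin.
- exact: critical_value pmin.
Qed.

End FiniteDuality.

(** * Quantization *)

Section Quantization.
Context {R : realType} {d : nat}.
Local Notation V := (borelRd R d).
Local Notation Id := (fun x : V => x : 'rV[R]_d).

Definition rational_vector (k : nat) : 'rV[R]_d :=
  if unpickle k is Some r then map_mx ratr (r : 'rV[rat]_d) else 0.

Lemma rational_vector_dense (x : 'rV[R]_d) (e : R) : 0 < e ->
  exists k, sqnorm (x - rational_vector k) < e.
Proof.
move=> e0; pose D : R := d%:R + 1.
have D0 : 0 < D by rewrite /D ltr_wpDl.
pose del := Num.min 1 (e / D).
have del0 : 0 < del by rewrite /del lt_min ltr01 divr_gt0.
have del1 : del <= 1 by rewrite /del ge_min lexx.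
have dele : del * D <= e by rewrite -ler_pdivlMr // /del ge_min lexx orbT.
have rat_close (s : R) : exists r : rat, `|s - ratr r| < del.
  have [|r] := @rat_in_itvoo R (s - del) (s + del); first by lra.
  by rewrite in_itv /= => /andP[h1 h2]; exists r; rewrite ltr_norml; lra.
have [r rP] := choice rat_close.
exists (pickle (\row_i r (x ord0 i))); rewrite /rational_vector pickleK.
have le1 : sqnorm (x - map_mx ratr (\row_i r (x ord0 i))) <= d%:R * del.
  rewrite /sqnorm /dotv; apply: le_trans (_ : _ <= \sum_(i < d) del) _.
    apply: ler_sum => i _; rewrite !mxE -expr2 -real_normK ?num_real //.
    have := rP (x ord0 i); have := normr_ge0 (x ord0 i - ratr (r (x ord0 i))).
    by nra.
  by rewrite sumr_const card_ord mulr_natl.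
apply: le_lt_trans le1 _; apply: lt_le_trans dele.
by rewrite mulrC ltr_pM2l // /D; lra.
Qed.

Variable nu : probability V R.
Hypothesis L : L2 nu Id.

(** Orthogonality of the deviation from the barycenters to step functions. *)
Lemma barycenter_best (I : finType) (q : V -> I) (r : I -> 'rV[R]_d) :
  measurable_partition q -> (forall i, 0 < mass nu q i) ->
  Ex nu (fun y : V => sqnorm ((y : 'rV[R]_d) - r (q y))) =
  Ex nu (fun y : V => sqnorm ((y : 'rV[R]_d) - barycenter nu _ q (q y))) +
  \sum_i mass nu q i * sqnorm (barycenter nu _ q i - r i).
Proof.
move=> mq m0; set m := barycenter nu _ q.
have Lstep (F : I -> 'rV[R]_d) := L2_step nu q mq F.
have Lm : L2 nu (fun y : V => (y : 'rV[R]_d) - m (q y)) by exact: L2B.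
have hd : intg nu (fun y : V => dotv ((y : 'rV[R]_d) - m (q y)) (m (q y) - r (q y))).
  exact: L2_dotv Lm (Lstep (fun i => m i - r i)).
have d0 : Ex nu (fun y : V => dotv ((y : 'rV[R]_d) - m (q y)) (m (q y) - r (q y))) = 0.
  have -> : (fun y : V => dotv ((y : 'rV[R]_d) - m (q y)) (m (q y) - r (q y))) =
     fun y : V => dotv (m (q y) - r (q y)) (y : 'rV[R]_d) -
                  dotv (m (q y) - r (q y)) (m (q y)).
    by apply/funext => y; rewrite !dotvE !(dotvC y) (dotvC (r _) (m _)); ring.
  rewrite ExB; last 2 first.
  - exact: L2_dotv (Lstep (fun i => m i - r i)) L.
  - exact: L2_dotv (Lstep (fun i => m i - r i)) (Lstep m).
  rewrite (Ex_dotv_step _ _ _ mq L m0 (fun i => m i - r i)).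
  by rewrite (Ex_step _ _ mq (fun i => dotv (m i - r i) (m i))) subrr.
have -> : (fun y : V => sqnorm ((y : 'rV[R]_d) - r (q y))) = fun y : V =>
   sqnorm ((y : 'rV[R]_d) - m (q y)) + (2 * dotv ((y : 'rV[R]_d) - m (q y)) (m (q y) - r (q y))
   + sqnorm (m (q y) - r (q y))).
  apply/funext => y; rewrite addrA -sqnormD; congr sqnorm.
  by rewrite addrA subrK.
have hs : intg nu (fun y => sqnorm (m (q y) - r (q y))).
  exact: intg_step _ _ mq (fun i => sqnorm (m i - r i)).
rewrite ExD; [|exact: L2_sqnorm Lm|by apply: intgD => //; exact: intgZ].
rewrite ExD //; last exact: intgZ.
rewrite ExZ // d0 mulr0 add0r; congr (_ + _).
exact: Ex_step _ _ mq (fun i => sqnorm (m i - r i)).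
Qed.

Lemma Ex_null_cell (I : finType) (q : V -> I) i f : measurable_partition q ->
  mass nu q i = 0 -> intg nu f -> Ex nu (fun y => f y * cell q i y) = 0.
Proof.
move=> mq m0 hf; have mC := mq i.
have n0 : nu (q @^-1` [set i]) = 0%E.
  by apply: etrans (prob_Ex _ _ mC) _; rewrite -cellE; congr (_%:E).
have : (\int[nu]_(y in q @^-1` [set i]) (f y)%:E = 0)%E.
  apply: null_set_integral => //.
  by apply: measurable_funTS; exact: measurable_int hf.
rewrite integral_mkcond => h.
rewrite /Ex /Rintegral (_ : (fun y => _) = ((EFin \o f) \_ (q @^-1` [set i]))) ?h //.
apply/funext => y; rewrite patchE cellE indicE /=.
by case: (_ \in _); rewrite ?mulr1 ?mulr0.
Qed.

(** Null cells are merged with one of positive mass, which changes no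
    expectation. *)
Lemma positive_partition (I : finType) (q : V -> I) (r : I -> 'rV[R]_d) :
  measurable_partition q ->
  exists (K : finType) (q' : V -> K) (r' : K -> 'rV[R]_d),
  [/\ measurable_partition q', forall k, 0 < mass nu q' k &
   Ex nu (fun y : V => sqnorm ((y : 'rV[R]_d) - r' (q' y))) =
   Ex nu (fun y : V => sqnorm ((y : 'rV[R]_d) - r (q y)))].
Proof.
move=> mq; pose K := {i : I | 0 < mass nu q i}.
have mass0 i : 0 <= mass nu q i by apply: Ex_ge0 => y; exact: cell_ge0.
have [i0 i0P] : exists i, 0 < mass nu q i.
  apply/existsP; rewrite -[X in is_true X]negbK negb_exists; apply/negP => /forallP h.
  have := sum_mass nu q mq; rewrite big1 => [/esym/eqP|i _]; first by rewrite oner_eq0.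
  by apply/eqP; rewrite eq_le mass0 andbT leNgt.
pose k0 : K := exist _ i0 i0P.
pose f (i : I) : K := insubd k0 i.
exists K, (f \o q), (fun k => r (val k)).
have mq' : measurable_partition (f \o q).
  move=> k; rewrite (_ : _ @^-1` _ = \bigcup_(i in [set i | f i = k]) q @^-1` [set i]).
    by apply: fin_bigcup_measurable => [|i _]; [exact: finite_finset|exact: mq].
  by apply/seteqP; split=> [y /= h|y [i /= h hq]]; [exists (q y)|rewrite /preimage /= hq].
split=> //.
  move=> k; apply: lt_le_trans (valP k) _.
  have hc (I' : finType) (q' : V -> I') i : measurable_partition q' -> intg nu (cell q' i).
    by move=> m; have := intg_cell _ _ m _ i (intg_cst nu 1); under eq_fun do rewrite mul1r.
  apply: Ex_le; [exact: hc|exact: hc|].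
  move=> y; rewrite /cell /=; case: eqP => [->|_] //.
  by rewrite /f valKd eqxx.
have i1 := L2_sqnorm _ _ (L2B _ _ _ L (L2_step nu _ mq' (fun k : K => r (val k)))).
have i2 := L2_sqnorm _ _ (L2B _ _ _ L (L2_step nu q mq r)).
rewrite (Ex_partition _ _ mq _ i1) (Ex_partition _ _ mq _ i2).
apply: eq_bigr => i _; have [m0|m0] := eqVneq (mass nu q i) 0.
  by rewrite !Ex_null_cell.
have mi : 0 < mass nu q i by rewrite lt0r m0 mass0.
congr Ex; apply/funext => y; rewrite /cell /=; case: eqP => [->|_]; last by rewrite !mulr0.
by rewrite /f insubdK.
Qed.

(** The second moment outside the first [N] members of a cover tends to 0, by
    dominated convergence. *)
Lemma remainder_small (e : R) (D : nat -> set V) : 0 < e ->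
  (forall k, measurable (D k)) -> (forall y, exists k, D k y) ->
  exists N, Ex nu (fun y : V => sqnorm (y : 'rV[R]_d) * \1_(\bigcap_(k < N) ~` D k) y) <= e.
Proof.
move=> e0 mD cov.
have mR N : measurable (\bigcap_(k < N) ~` D k).
  by rewrite -setC_bigcup; apply: measurableC; apply: bigcup_measurable => k _; exact: mD.
pose F N (y : V) : R := sqnorm (y : 'rV[R]_d) * \1_(\bigcap_(k < N) ~` D k) y.
have mF N : measurable_fun setT (F N).
  by apply: measurable_funM; [exact: intg_measurable (L2_sqnorm _ _ L)|exact: measurable_indic].
have F0 N y : 0 <= F N y by rewrite mulr_ge0 ?sqnorm_ge0 // indicE.
have Fle N y : F N y <= sqnorm (y : 'rV[R]_d).
  by rewrite ler_piMr ?sqnorm_ge0 // indicE; case: (_ \in _).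
have iF N : intg nu (F N).
  apply: (le_intg _ _ _ (mF N) _ (L2_sqnorm _ _ L)) => y.
  by rewrite ger0_norm.
(* every y lies in some D k, so that the integrand vanishes for large N *)
have hcv : {ae nu, forall y, setT y -> (F N y)%:E @[N --> \oo] --> 0%E}.
  apply: aeW => y _; have [k Dk] := cov y.
  apply: cvg_near_cst; exists k.+1 => // N /= kN.
  by rewrite /F indicE memNset ?mulr0 // => /(_ k kN).
have hbd : {ae nu, forall y N, setT y -> (`|(F N y)%:E| <= (sqnorm (y : 'rV[R]_d))%:E)%E}.
  by apply: aeW => y N _; rewrite gee0_abs lee_fin.
have [_ _ cv0] := @dominated_convergence _ _ _ nu setT measurableT
  (fun N y => (F N y)%:E) (fun=> 0%E) (fun y => (sqnorm (y : 'rV[R]_d))%:E)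
  (fun N => proj2 (measurable_EFinP _ _) (mF N)) (measurable_cst _) hcv (L2_sqnorm _ _ L) hbd.
have cv : (fun N => (Ex nu (F N))%:E) @ \oo --> 0%E.
  rewrite integral0 in cv0; apply: cvg_trans cv0.
  by apply: near_eq_cvg; near=> N; rewrite /= ExE.
have /fine_cvgP[_ /cvgrPdist_le /(_ e e0)] := cv.
move=> [N _ /(_ N (leqnn N))] /=; rewrite sub0r normrN => h.
by exists N; apply: le_trans (ler_norm _) h.
Unshelve. all: by end_near. Qed.

(** The cells are the points close to the k-th rational vector and to none
    before it, for k < N, and a remainder; barycenters only lower the error. *)
Lemma quantization (e : R) : 0 < e -> exists (I : finType) (q : V -> I),
  [/\ measurable_partition q, forall i, 0 < mass nu q i &
   Ex nu (fun y : V => sqnorm ((y : 'rV[R]_d) - barycenter nu _ q (q y))) <= e].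
Proof.
move=> e0; have e20 : 0 < e / 2 by lra.
pose near_vec (y : V) k := sqnorm ((y : 'rV[R]_d) - rational_vector k) < e / 2.
pose D k : set V := [set y | near_vec y k].
have mD k : measurable (D k).
  apply: open_measurable_Rd.
  rewrite (_ : D k = (fun y => sqnorm (y - rational_vector k)) @^-1` [set s | s < e / 2]) //.
  have cf := sqnormB_cont (rational_vector k).
  by move/continuousP : cf; apply; exact: open_lt.
have [N hN] := remainder_small (e / 2) D e20 mD (fun y => rational_vector_dense y _ e20).
pose ix (y : V) := find (near_vec y) (iota 0 N).
have mix s k : measurable [set y : V | find (near_vec y) s = k].
  elim: s k => [|l s IH] [|k] /=.
  - by rewrite (_ : mkset _ = setT) //; apply/seteqP; split.
  - by rewrite (_ : mkset _ = set0) //; apply/seteqP; split.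
  - rewrite (_ : mkset _ = D l) //; apply/seteqP; split=> y /=; rewrite /D /=;
    by case: (near_vec y l).
  - rewrite (_ : mkset _ = ~` D l `&` [set y | find (near_vec y) s = k]).
      by apply: measurableI; [exact: measurableC|exact: IH].
    apply/seteqP; split=> y /=; rewrite /D /=; case: (near_vec y l) => //.
    + by move=> [].
    + by move=> [].
    + by move=> [_ ->].
have ixN y : (ix y < N.+1)%N.
  by rewrite ltnS /ix; have := find_size (near_vec y) (iota 0 N); rewrite size_iota.
pose q (y : V) : 'I_N.+1 := Ordinal (ixN y).
have mq : measurable_partition q.
  move=> i; rewrite (_ : q @^-1` _ = [set y | ix y = i]); first exact: mix.
  apply/seteqP; split=> y /=; first by move=> <-.
  by move=> h; exact: val_inj.
(* the last index collects the points far from the first N rational vectors,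
   all sent to the origin *)
pose r (i : 'I_N.+1) := if (i < N)%N then rational_vector i else 0.
have [K [q' [r' [mq' m0 eq']]]] := positive_partition _ q r mq.
exists K, q'; split=> //.
have := barycenter_best _ q' r' mq' m0; rewrite eq' => eb.
apply: le_trans (_ : Ex nu (fun y : V => sqnorm ((y : 'rV[R]_d) - r (q y))) <= _).
  by rewrite eb lerDl sumr_ge0 // => k _; rewrite mulr_ge0 ?sqnorm_ge0 // ltW.
have Lr := L2_step nu q mq r.
have mR : measurable (\bigcap_(k < N) ~` D k).
  by rewrite -setC_bigcup; apply: measurableC; apply: bigcup_measurable => k _; exact: mD.
have hR : intg nu (fun y : V => sqnorm (y : 'rV[R]_d) * \1_(\bigcap_(k < N) ~` D k) y).
  apply: (le_intg _ _ _ _ _ (L2_sqnorm _ _ L)).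
    by apply: measurable_funM; [exact: intg_measurable (L2_sqnorm _ _ L)|exact: measurable_indic].
  move=> y; rewrite ger0_norm ?mulr_ge0 ?sqnorm_ge0 //.
  by rewrite ler_piMr ?sqnorm_ge0 // indicE; case: (_ \in _).
apply: le_trans (_ : _ <= Ex nu (fun y : V => e / 2 +
    sqnorm (y : 'rV[R]_d) * \1_(\bigcap_(k < N) ~` D k) y)) _; last first.
  by rewrite ExD // ?Ex_cst; [lra|exact: intg_cst].
apply: Ex_le; [exact: L2_sqnorm (L2B _ _ _ L Lr)|by apply: intgD => //; exact: intg_cst|].
move=> y; rewrite /r /q /=.
have [lt|ge] := ltnP (ix y) N.
  have : has (near_vec y) (iota 0 N) by rewrite has_find size_iota.
  move=> /(nth_find 0%N); rewrite -/(ix y) nth_iota // add0n /near_vec => h.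
  by apply: le_trans (ltW h) _; rewrite lerDl mulr_ge0 ?sqnorm_ge0.
rewrite subr0 indicE mem_set ?mulr1; first by lra.
move=> k kN /=; rewrite /D /= => nk.
have : has (near_vec y) (iota 0 N) by apply/hasP; exists k => //; rewrite mem_iota.
by rewrite has_find size_iota ltnNge ge.
Qed.

End Quantization.

(** * Absence of a duality gap *)

Section Smoothing.
Context {R : realType} {d : nat} (J : finType).
Variables (z : J -> 'rV[R]_d) (v : J -> R) (del : R) (del0 : 0 < del).

Definition feasible (p : 'rV[R]_d * R) := forall j, dotv p.1 (z j) - v j <= p.2.

(** The supremum of <x, z> - r - del/2 |x|^2 over the pairs (x, r) for which r
    dominates all the <x, z j> - v j, that is, the transform of
    max_j (<x, z j> - v j) + del/2 |x|^2: the quadratic term makes it finite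
    everywhere, at most v j + |y - z j|^2 / (2 del) at y. *)
Definition smoothed_potential : 'rV[R]_d -> \bar R :=
  sup_affine {p | feasible p}
    (fun p => - ((sval p).2 + del / 2 * sqnorm (sval p).1)) (fun p => (sval p).1).

Lemma smoothed_potential_le j y :
  (smoothed_potential y <= (v j + (2 * del)^-1 * sqnorm (y - z j))%:E)%E.
Proof.
have del0' := del0.
apply: ge_ereal_sup => _ [[[x r] h] _ <-] /=; rewrite lee_fin.
have := h j; have := dotv_young del x (y - z j) del0; rewrite /= !dotvE => h1 h2.
have : (2 * del)^-1 * sqnorm (y - z j) = del^-1 * sqnorm (y - z j) / 2 by field; lra.
lra.
Qed.

Lemma legendre_smoothed_potential x r : feasible (x, r) ->
  (legendre smoothed_potential x <= (r + del / 2 * sqnorm x)%:E)%E.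
Proof.
move=> h; apply: ge_ereal_sup => _ [y _ <-].
have := sup_affine_ge _ (fun p : {p | feasible p} => - ((sval p).2 + del / 2 * sqnorm (sval p).1))
  (fun p => (sval p).1) (exist _ (x, r) h) y.
rewrite -/smoothed_potential /=; case: (smoothed_potential y) => [s||] //; last by rewrite leNye.
by rewrite -EFinB !lee_fin dotvC; lra.
Qed.

Lemma smoothed_potential_closed (j : J) x r : feasible (x, r) -> closed_convex smoothed_potential.
Proof.
move=> h; apply: (closed_convex_sup_affine _ _ _ (exist _ (x, r) h) 0).
by apply: le_lt_trans (smoothed_potential_le j 0) _; rewrite ltry.
Qed.

End Smoothing.

(** Each of the four sources of error costs at most [e] once del is chosen;
    the terms in B2, the energy of the discrete map, combine exactly. *)
Lemma error_budget {R : realType} (t e X A B2 m S1 S2 SX Q1 Q0 : R) :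
  let del := 2 * e / (X + 1) in
  1 < t -> 0 < e -> 0 <= X -> SX <= X -> Q0 <= 2 * del * e ->
  Q1 <= 2 * (t - 1) / t * e -> S1 + S2 <= t * A - (t - 1) * B2 ->
  t^-1 * (S1 + e + del / 2 * SX) +
    (2 * t * (t - 1))^-1 * (t ^+ 2 * Q1 + (t - 1) ^+ 2 * B2) +
    (t^-1 * (S2 + (2 * del)^-1 * Q0) + (t - 1) / t / 2 * m) <=
  A - (t - 1) / t / 2 * B2 + (t - 1) / t / 2 * m + 4 * e.
Proof.
move=> del t1 e0 X0 SXle Q0le Q1le val.
have t0 : 0 < t by lra.
have del0 : 0 < del by rewrite /del divr_gt0; lra.
have b1 : del / 2 * SX <= e.
  apply: le_trans (_ : _ <= del / 2 * X) _; first by apply: ler_wpM2l => //; lra.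
  have -> : del / 2 * X = e * (X / (X + 1)) by rewrite /del; field; lra.
  by rewrite ler_piMr ?ler_pdivrMr ?mul1r; lra.
have b2 : (2 * del)^-1 * Q0 <= e by rewrite ler_pdivrMl //; apply: mulr_gt0.
have b3 : t / (2 * (t - 1)) * Q1 <= e.
  have h : t / (2 * (t - 1)) * (2 * (t - 1) / t * e) = e by field; rewrite !gt_eqF //; lra.
  by rewrite -[leRHS]h; apply: ler_wpM2l => //; rewrite divr_ge0 //; lra.
have b4 : t^-1 * (e + del / 2 * SX + (2 * del)^-1 * Q0) <= 3 * e.
  apply: le_trans (_ : _ <= t^-1 * (3 * e)) _.
    by apply: ler_wpM2l; [rewrite invr_ge0 ltW|lra].
  by rewrite ler_piMl ?invf_le1 //; lra.
have hv : t^-1 * (S1 + S2) <= A - (t - 1) / t * B2.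
  have -> : A - (t - 1) / t * B2 = t^-1 * (t * A - (t - 1) * B2) by field; lra.
  by rewrite ler_pM2l ?invr_gt0.
have -> : (2 * t * (t - 1))^-1 * (t ^+ 2 * Q1 + (t - 1) ^+ 2 * B2) =
    t / (2 * (t - 1)) * Q1 + (t - 1) / t / 2 * B2.
  by field; rewrite !gt_eqF //; lra.
lra.
Qed.

Section Approximation.
Context {R : realType} {d : nat}.
Local Notation V := (borelRd R d).
Local Notation Id := (fun x : V => x : 'rV[R]_d).

Definition step_data (nu0 nu1 : probability V R) {I J : finType}
    (q1 : V -> I) (q0 : V -> J) (g : I -> J -> R) :=
  [/\ measurable_partition q1, measurable_partition q0,
      forall i, 0 < mass nu1 q1 i & forall j, 0 < mass nu0 q0 j] /\
  [/\ forall i j, 0 <= g i j, forall i, \sum_j g i j = mass nu1 q1 i &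
      forall j, \sum_i g i j = mass nu0 q0 j].

Variables (nu0 nu1 : probability V R) (h0 : in_P2 nu0) (h1 : in_P2 nu1).

(** Conditional expectations do not increase second moments. *)
Lemma step_map_energy (I J : finType) (q1 : V -> I) (q0 : V -> J) g :
  step_data nu0 nu1 q1 q0 g ->
  Ex nu1 (fun y => sqnorm (step_map nu0 nu1 _ _ q1 q0 g y)) <= moment nu0.
Proof.
move=> [[mq1 mq0 a0 b0] [g0 grow gcol]].
have L0 := proj1 (in_P2P _) h0.
have [Pi [l1 l0 PiE]] := step_coupling nu1 nu0 _ _ _ _ g mq1 mq0 a0 b0 g0 grow gcol L0.
set B := step_map _ _ _ _ _ _ _; have LB : L2 nu1 B by exact: step_map_L2.
have X1 := law_L2 _ _ _ l1 _ LB; have X0 := law_L2 _ _ _ l0 _ L0.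
have e1 : Ex nu1 (fun y => sqnorm (B y)) = Ex Pi (fun z => dotv (B z.1) (z.2 : 'rV[R]_d)).
  by rewrite PiE.
have e2 : Ex Pi (fun z => sqnorm (B z.1)) = Ex nu1 (fun y => sqnorm (B y)).
  by apply: (law_Ex _ _ _ l1 (fun y => sqnorm (B y))); apply: measurable_dotv; case: LB.
have e3 : Ex Pi (fun z => sqnorm (z.2 : 'rV[R]_d)) = moment nu0.
  by apply: (law_Ex _ _ _ l0 (fun y : V => sqnorm (y : 'rV[R]_d))); exact: measurable_dotv mvec_id mvec_id.
have : 0 <= Ex Pi (fun z => sqnorm (B z.1 - (z.2 : 'rV[R]_d))).
  by apply: Ex_ge0 => z; exact: sqnorm_ge0.
rewrite (Ex_sqnormB _ _ _ X1 X0) e2 e3 -e1; lra.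
Qed.

Variables (t : R) (t1 : 1 < t).
Local Notation c := ((t - 1) / t).

(** The potentials of the discrete problem are turned into an admissible
    function by [smoothed_potential] and [depotential]. The error has four
    sources: the penalty, the smoothing (bounded by del times the second moment
    of the points x i), the quantization of nu1, and that of nu0, which is
    divided by del; hence del is fixed before the partition of nu0. *)
Lemma approximate_duality (eps : R) : 0 < eps ->
  exists (I J : finType) (q1 : V -> I) (q0 : V -> J) (g : I -> J -> R) u D,
  [/\ step_data nu0 nu1 q1 q0 g, admissible t u, dual_cost nu0 nu1 u = D%:E &
      D <= score nu0 nu1 _ _ q1 q0 g t + c / 2 * moment nu0 + eps].
Proof.
move=> eps0; have t1' := t1; have t0 : 0 < t by lra.
have L0 := proj1 (in_P2P _) h0; have L1 := proj1 (in_P2P _) h1.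
have m00 : 0 <= moment nu0 by apply: Ex_ge0 => x; exact: sqnorm_ge0.
have m10 : 0 <= moment nu1 by apply: Ex_ge0 => x; exact: sqnorm_ge0.
pose e := eps / 4.
have e0 : 0 < e by rewrite /e; lra.
(* X bounds the second moment of the points x i uniformly in the partitions,
   so that del can be chosen before them, and then the finer partition of nu0 *)
pose X := 2 * t ^+ 2 * (2 * moment nu1 + 2) + 2 * (t - 1) ^+ 2 * moment nu0.
have X0 : 0 <= X.
  by rewrite /X addr_ge0 // !mulr_ge0 ?sqr_ge0 //; lra.
pose del := 2 * e / (X + 1).
have del0 : 0 < del by rewrite /del divr_gt0; lra.
pose err0 := 2 * del * e; have err00 : 0 < err0 by rewrite /err0; apply: mulr_gt0 => //; apply: mulr_gt0.
pose err1 := Num.min 1 (2 * (t - 1) / t * e).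
have err10 : 0 < err1.
  rewrite /err1 lt_min ltr01 /=; apply: mulr_gt0 => //; apply: divr_gt0 => //.
  by apply: mulr_gt0 => //; lra.
have err1_le1 : err1 <= 1 by rewrite /err1 ge_min lexx.
have err1_le2 : err1 <= 2 * (t - 1) / t * e by rewrite /err1 ge_min lexx orbT.
have [I [q1 [mq1 a0 Q1]]] := quantization nu1 L1 err1 err10.
have [J [q0 [mq0 b0 Q0]]] := quantization nu0 L0 err0 err00.
set y := barycenter nu1 I q1 in Q1; set z := barycenter nu0 J q0 in Q0.
have [g [phi [v [x [[g0 grow gcol] [xB feas val]]]]]] :=
  finite_duality I J _ _ y z a0 b0 (sum_mass nu1 q1 mq1) (sum_mass nu0 q0 mq0) t e t1 e0.
have SD : step_data nu0 nu1 q1 q0 g by split.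
exists I, J, q1, q0, g.
set B := fun i => cond_bary nu1 nu0 I J q1 q0 g i.
have {}xB i : t *: y i - x i = (t - 1) *: B i by exact: xB.
have xE i : x i = t *: y i - (t - 1) *: B i by rewrite -xB opprB addrC subrK.
pose w := smoothed_potential J z v del.
have feas' i : feasible J z v (x i, phi i + e) by move=> j; exact: feas.
have [j0 _] := sum1_inhabited _ _ (sum_mass nu0 q0 mq0).
have [i0 _] := sum1_inhabited _ _ (sum_mass nu1 q1 mq1).
have cw : closed_convex w := smoothed_potential_closed J z v del del0 j0 _ _ (feas' i0).
pose u := depotential t w.
have au : admissible t u by apply/admissible_potential => //; rewrite /u depotentialK.
have pw : proper_fun w by case: cw.
have Lstep1 (F : I -> 'rV[R]_d) := L2_step nu1 q1 mq1 F.
have Lstep0 (F : J -> 'rV[R]_d) := L2_step nu0 q0 mq0 F.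
(* F1 and F0 bound the transform of u at y by the choice x (q1 y) of the dual
   variable, and u at z by the choice of the constraint v (q0 z). *)
pose k1 := (2 * t * (t - 1))^-1.
pose F1 (s : V) := t^-1 * (phi (q1 s) + e + del / 2 * sqnorm (x (q1 s))) +
   k1 * sqnorm (t *: (s : 'rV[R]_d) - x (q1 s)).
pose F0 (s : V) := t^-1 * (v (q0 s) + (2 * del)^-1 * sqnorm ((s : 'rV[R]_d) - z (q0 s))) +
   c / 2 * sqnorm (s : 'rV[R]_d).
have LX : L2 nu1 (fun s : V => t *: (s : 'rV[R]_d) - x (q1 s)).
  by apply: L2B => //; exact: L2Z.
have LZ : L2 nu0 (fun s : V => (s : 'rV[R]_d) - z (q0 s)) by exact: L2B.
have iphi : intg nu1 (fun s => phi (q1 s) + e + del / 2 * sqnorm (x (q1 s))).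
  exact: intg_step _ _ mq1 (fun i => phi i + e + del / 2 * sqnorm (x i)).
have iF1 : intg nu1 F1.
  by apply: intgD; apply: intgZ => //; exact: L2_sqnorm LX.
have iv : intg nu0 (fun s => v (q0 s)) by exact: intg_step.
have iv2 : intg nu0 (fun s => v (q0 s) + (2 * del)^-1 * sqnorm ((s : 'rV[R]_d) - z (q0 s))).
  by apply: intgD => //; apply: intgZ; exact: L2_sqnorm LZ.
have iF0 : intg nu0 F0.
  by apply: intgD; apply: intgZ => //; exact: L2_sqnorm L0.
have ti0 : 0 < t^-1 by rewrite invr_gt0.
have le1 s : (legendre u s <= (F1 s)%:E)%E.
  apply: le_trans (legendre_depotential t w (x (q1 s)) s t1 pw) _.
  rewrite /F1 EFinD; apply: leeD; last by rewrite lee_fin mulrC.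
  rewrite EFinM; apply: lee_wpmul2l; first by rewrite lee_fin ltW.
  exact: legendre_smoothed_potential (feas' _).
have le0 s : (u s <= (F0 s)%:E)%E.
  rewrite /u /depotential /F0 EFinD; apply: leeD; last by rewrite lee_fin mulrA mulrAC.
  rewrite EFinM; apply: lee_wpmul2l; first by rewrite lee_fin ltW.
  exact: smoothed_potential_le.
have hu := admissible_minorized t t1 u au nu0.
have hw := legendre_intg t t1 u au nu1 L1.
have lE := proj1 (and4_rect (fun a b c d => conj a b) (admissible_legendre t t1 u au)).
have leu : (\int[nu0]_s u s <= (Ex nu0 F0)%:E)%E.
  rewrite -(ExE _ _ iF0); apply: integral_le => //; first by case: hu.
  exact: measurable_int iF0.
have lew : Ex nu1 (fun s => fine (legendre u s)) <= Ex nu1 F1.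
  by apply: Ex_le => // s; rewrite -lee_fin -lE.
have [U UE] : exists U, (\int[nu0]_s u s = U%:E)%E.
  have := minorized_gtNy _ _ hu; move: leu.
  by case: (\int[nu0]_s u s)%E => [U||] // _ _; exists U.
exists u, (Ex nu1 (fun s => fine (legendre u s)) + U).
have cost : dual_cost nu0 nu1 u = (Ex nu1 (fun s => fine (legendre u s)) + U)%:E.
  by rewrite (dual_costE t t1 u au nu0 nu1 L1) UE -EFinD.
split=> //.
rewrite UE lee_fin in leu.
clear UE cost le1 le0 lE hu.
set a := mass nu1 q1 in grow val; set b := mass nu0 q0 in gcol val.
have EF1 : Ex nu1 F1 = t^-1 * (\sum_i a i * phi i + e + del / 2 * \sum_i a i * sqnorm (x i)) +
   k1 * Ex nu1 (fun s : V => sqnorm (t *: (s : 'rV[R]_d) - x (q1 s))).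
  rewrite /F1 ExD; [|exact: intgZ|by apply: intgZ; exact: L2_sqnorm LX].
  rewrite ExZ // ExZ; last exact: L2_sqnorm LX.
  congr (_ * _ + _).
  rewrite (Ex_step _ _ mq1 (fun i => phi i + e + del / 2 * sqnorm (x i))) -/a.
  rewrite -[e in RHS]mulr1 -(sum_mass nu1 q1 mq1) -/a !mulr_sumr -!big_split /=.
  by apply: eq_bigr => i _; ring.
have EF0 : Ex nu0 F0 = t^-1 * (\sum_j b j * v j + (2 * del)^-1 *
     Ex nu0 (fun s : V => sqnorm ((s : 'rV[R]_d) - z (q0 s)))) + c / 2 * moment nu0.
  rewrite /F0 (ExD _ _ _ (intgZ _ t^-1 _ iv2) (intgZ _ (c / 2) _ (L2_sqnorm _ _ L0))).
  rewrite (ExZ _ _ _ iv2) (ExZ _ _ _ (L2_sqnorm _ _ L0)).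
  congr (_ * _ + _).
  have iZ := intgZ _ (2 * del)^-1 _ (L2_sqnorm _ _ LZ).
  by rewrite (ExD _ _ _ iv iZ) (ExZ _ _ _ (L2_sqnorm _ _ LZ)) (Ex_step _ _ mq0 v).
(* conditional mean: t y - x is split into its barycentric part (t-1) B and
   the deviation of y from the barycenter of its cell *)
have EX : Ex nu1 (fun s : V => sqnorm (t *: (s : 'rV[R]_d) - x (q1 s))) =
   t ^+ 2 * Ex nu1 (fun s : V => sqnorm ((s : 'rV[R]_d) - y (q1 s))) +
   (t - 1) ^+ 2 * \sum_i a i * sqnorm (B i).
  have := barycenter_best nu1 L1 I q1 (fun i => t^-1 *: x i) mq1 a0.
  have -> : (fun s : V => sqnorm (t *: (s : 'rV[R]_d) - x (q1 s))) =
     fun s : V => t ^+ 2 * sqnorm ((s : 'rV[R]_d) - t^-1 *: x (q1 s)).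
    apply/funext => s; rewrite -sqnormZ; congr sqnorm.
    by rewrite scalerBr scalerA divff ?scale1r // gt_eqF.
  rewrite ExZ; last first.
    exact: L2_sqnorm (L2B _ _ _ L1 (Lstep1 (fun i => t^-1 *: x i))).
  move=> ->; rewrite mulrDr; congr (_ + _); rewrite !mulr_sumr.
  apply: eq_bigr => i _; rewrite mulrCA [RHS]mulrCA; congr (_ * _).
  rewrite -sqnormZ -[RHS]sqnormZ -xB; congr sqnorm.
  by rewrite scalerBr scalerA divff ?scale1r // gt_eqF.
set A := \sum_i a i * dotv (y i) (B i).
set BB := \sum_i a i * sqnorm (B i) in EX.
have EB : Ex nu1 (fun s => sqnorm (step_map nu0 nu1 I J q1 q0 g s)) = BB.
  exact: Ex_step _ _ mq1 (fun i => sqnorm (B i)).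
have ES : score nu0 nu1 I J q1 q0 g t = A - c / 2 * BB.
  rewrite scoreE // EB; congr (_ - _).
  rewrite /step_map -/(B _).
  transitivity (Ex nu1 (fun s : V => dotv (B (q1 s)) (s : 'rV[R]_d))).
    by congr Ex; apply/funext => s; rewrite dotvC.
  rewrite (Ex_dotv_step _ _ _ mq1 L1 a0 B).
  by apply: eq_bigr => i _; rewrite dotvC.
have BBle : BB <= moment nu0 by rewrite -EB; exact: step_map_energy.
have BB0 : 0 <= BB by rewrite -EB; apply: Ex_ge0 => s; exact: sqnorm_ge0.
have {}val : \sum_i a i * phi i + \sum_j b j * v j <= t * A - (t - 1) * BB.
  apply: le_trans val _; rewrite le_eqVlt; apply/orP; left; apply/eqP.
  rewrite /A /BB !mulr_sumr -sumrB; apply: eq_bigr => i _.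
  have -> : \sum_j g i j * dotv (x i) (z j) = a i * dotv (x i) (B i).
    rewrite /B /cond_bary dotvZr mulrA divff ?mul1r; last by rewrite gt_eqF // a0.
    rewrite dotvC; elim/big_rec2 : _ => [|j s1 s2 _ ->]; first by rewrite dot0v.
    by rewrite !dotvE (dotvC (z j)).
  rewrite xE; move: (B i) => Bi; rewrite !dotvE /sqnorm; ring.
have yle : \sum_i a i * sqnorm (y i) <= 2 * moment nu1 + 2.
  rewrite -(Ex_step _ _ mq1 (fun i => sqnorm (y i))).
  have Ly := L2_sqnorm _ _ (L2B _ _ _ L1 (Lstep1 y)).
  apply: le_trans (_ : _ <= Ex nu1 (fun s : V => 2 * sqnorm (s : 'rV[R]_d) +
      2 * sqnorm ((s : 'rV[R]_d) - y (q1 s)))) _.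
    apply: Ex_le; first exact: L2_sqnorm (Lstep1 y).
      by apply: intgD; apply: intgZ => //; exact: L2_sqnorm L1.
    move=> s; have := sqnormB_le s ((s : 'rV[R]_d) - y (q1 s)).
    by rewrite opprB addrC subrK.
  rewrite ExD ?ExZ //; try (by exact: L2_sqnorm L1); try (by apply: intgZ => //; exact: L2_sqnorm L1).
  rewrite -/(moment nu1); move: Q1 err1_le1; clear; lra.
have xle : \sum_i a i * sqnorm (x i) <= X.
  have -> : X = 2 * t ^+ 2 * (2 * moment nu1 + 2) + 2 * (t - 1) ^+ 2 * moment nu0 by [].
  apply: le_trans (_ : _ <= 2 * t ^+ 2 * (\sum_i a i * sqnorm (y i)) + 2 * (t - 1) ^+ 2 * BB) _.
    rewrite /BB !mulr_sumr -big_split; apply: ler_sum => i _ /=.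
    have := sqnormB_le (t *: y i) ((t - 1) *: B i); rewrite -xE !sqnormZ => h.
    have := ler_wpM2l (ltW (a0 i)) h; rewrite -/(a i); clear; lra.
  apply: lerD; apply: ler_wpM2l => //; by rewrite mulr_ge0 ?sqr_ge0.
set S1 := \sum_i a i * phi i in EF1 val; set S2 := \sum_j b j * v j in EF0 val.
set SX := \sum_i a i * sqnorm (x i) in EF1 xle.
set Q1' := Ex nu1 (fun s : V => sqnorm ((s : 'rV[R]_d) - y (q1 s))) in EX Q1.
set Q0' := Ex nu0 (fun s : V => sqnorm ((s : 'rV[R]_d) - z (q0 s))) in EF0 Q0.
rewrite EX in EF1.
rewrite ES; apply: le_trans (lerD lew leu) _; rewrite EF1 EF0.
have e4 : eps = 4 * e by rewrite /e; lra.
rewrite e4.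
exact: (error_budget t e X) t1 e0 X0 xle Q0 (le_trans Q1 err1_le2) val.
Qed.

End Approximation.

(** * Compactness of smooth convex functions *)

Section Compactness.
Context {R : realType} {d : nat}.

Lemma ultra_bounded_cvg (U : set_system nat) (f : nat -> R) (M : R) : UltraFilter U ->
  (forall n, `|f n| <= M) -> exists l : R, f n @[n --> U] --> l.
Proof.
move=> UU fM; have PU : ProperFilter U := @ultra_proper _ _ UU.
have PF : ProperFilter (f n @[n --> U]) by exact: fmap_proper_filter.
have h : (f n @[n --> U]) [set` `[- M, M]].
  apply: (@filterS _ U _ setT) => [n _ /=|]; last exact: filterT.
  by rewrite /= in_itv /= -ler_norml.
have [l [_ cl]] := @segment_compact R (- M) M _ PF h; exists l => A nA.
have [//|UcA] := in_ultra_setVsetC (f @^-1` A) UU.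
by have [x []] := cl (~` A) A UcA nA.
Qed.

Lemma smooth_convex_cvg (U : set_system nat) (k : R) (W : nat -> 'rV[R]_d -> R)
    (P : nat -> 'rV[R]_d -> 'rV[R]_d) (w : 'rV[R]_d -> R) (p : 'rV[R]_d -> 'rV[R]_d) :
  ProperFilter U -> (forall n, smooth_convex k (W n) (P n)) ->
  (forall y, W n y @[n --> U] --> w y) ->
  (forall y i, P n y ord0 i @[n --> U] --> p y ord0 i) ->
  smooth_convex k w p.
Proof.
move=> PU sW cW cP y h.
have cD : dotv (P n y) h @[n --> U] --> dotv (p y) h.
  rewrite /dotv; apply: cvg_big => [|i _]; first exact: add_continuous.
  by apply: cvgM; [exact: cP|exact: cvg_cst].
apply/andP; split.
  apply: (ler_cvg_to (cvgD (cW y) cD) (cW (y + h))).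
  by apply: nearW => n; case/andP: (sW n y h).
apply: (ler_cvg_to (cW (y + h)) (cvgD (cvgD (cW y) cD) (cvg_cst _))).
by apply: nearW => n; case/andP: (sW n y h).
Qed.

Lemma smooth_dist (k a B : R) (w : 'rV[R]_d -> R) p y h : 0 <= k -> 0 < a ->
  smooth_convex k w p -> sqnorm (p y) <= B ->
  `|w (y + h) - w y| <= (a * B + (a^-1 + k) * sqnorm h) / 2.
Proof.
move=> k0 a0 sw pB; have /andP[h1 h2] := sw y h.
have h3 := dotv_young a (p y) h a0.
have := dotv_young a (p y) (- h) a0; rewrite dotvNr sqnormN => h4.
have h5 := ler_wpM2l (ltW a0) pB.
have := mulr_ge0 k0 (sqnorm_ge0 h) => h6.
by rewrite ler_norml; apply/andP; split; lra.
Qed.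

Lemma smooth_bounded (k C : R) (w : 'rV[R]_d -> R) p y : 0 <= k -> smooth_convex k w p ->
  w 0 = 0 -> sqnorm (p 0) <= C -> `|w y| <= (C + (1 + k) * sqnorm y) / 2.
Proof.
move=> k0 sw w0 pC; have := smooth_dist k 1 C w p 0 y k0 ltr01 sw pC.
by rewrite add0r w0 subr0 invr1 mul1r.
Qed.

(** Boundedness gives limits along an ultrafilter for every vector at once. A
    subsequence is then chosen to converge on the countable set of rational
    vectors, and equicontinuity extends the convergence to all of them. *)
Lemma smooth_convex_compact (k C : R) (W : nat -> 'rV[R]_d -> R)
    (P : nat -> 'rV[R]_d -> 'rV[R]_d) : 0 < k ->
  (forall n, smooth_convex k (W n) (P n)) -> (forall n, W n 0 = 0) ->
  (forall n, sqnorm (P n 0) <= C) ->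
  exists (w : 'rV[R]_d -> R) (p : 'rV[R]_d -> 'rV[R]_d) (phi : nat -> nat), [/\ smooth_convex k w p, forall j, (j <= phi j)%N &
    forall y, W (phi j) y @[j --> \oo] --> w y].
Proof.
move=> k0 sW W0 PC.
have [U [UU oU]] := ultraFilterLemma (@eventually_filter).
have PU : ProperFilter U := @ultra_proper _ _ UU.
have /choice[w cw] : forall y, exists l : R, W n y @[n --> U] --> l.
  move=> y; apply: ultra_bounded_cvg UU _ => n; exact: smooth_bounded (ltW k0) (sW n) (W0 n) (PC n).
have growth n y : sqnorm (P n y) <= 2 * C + 8 * k ^+ 2 * sqnorm y.
  apply: le_trans (smooth_growth _ _ _ y k0 (sW n)) _.
  by rewrite lerD2r ler_pM2l.
have /choice[p cp] : forall y, exists l : 'rV[R]_d, forall i, P n y ord0 i @[n --> U] --> l ord0 i.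
  move=> y; have /choice[l cl] : forall i, exists l : R, P n y ord0 i @[n --> U] --> l.
    move=> i; apply: (ultra_bounded_cvg _ _ (1 + (2 * C + 8 * k ^+ 2 * sqnorm y)) UU) => n.
    have := sqnorm_coord (P n y) i; have := growth n y.
    have [h|h] := lerP `|P n y ord0 i| 1; first by have := sqnorm_ge0 (P n y); lra.
    rewrite -(@real_normK _ (P n y ord0 i)) ?num_real // => h1 h2.
    have : 0 <= (`|P n y ord0 i| - 1) * `|P n y ord0 i|
      by apply: mulr_ge0 => //; rewrite subr_ge0 ltW.
    lra.
  by exists (\row_i l i) => i; rewrite mxE.
have sw : smooth_convex k w p := smooth_convex_cvg U k W P w p PU sW cw cp.
have /choice[phi phiP] : forall j, exists n, (j <= n)%N /\
    forall i, (i <= j)%N -> `|w (rational_vector i) - W n (rational_vector i)| <= j.+1%:R^-1.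
  move=> j; have Uj : U [set n | forall i : 'I_j.+1,
      `|w (rational_vector i) - W n (rational_vector i)| <= j.+1%:R^-1].
    apply: filter_forall => i; have /cvgrPdist_le := cw (rational_vector i); apply.
    by rewrite invr_gt0 ltr0n.
  have Uj' : U [set n | (j <= n)%N] by apply: oU; exists j.
  have [n [h1 h2]] := filter_ex (filterI Uj Uj'); exists n; split => // i ij.
  exact: (h1 (Ordinal (ij : (i < j.+1)%N))).
exists w, p, phi; split=> // [j|y]; first by case: (phiP j).
apply/cvgrPdist_le => e e0.
pose B := 2 * C + 8 * k ^+ 2 * sqnorm y + sqnorm (p y).
have B1 : sqnorm (p y) <= B.
  by rewrite /B; have := growth 0%N y; have := sqnorm_ge0 (P 0%N y); lra.
have B2 n : sqnorm (P n y) <= B.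
  by rewrite /B; have := growth n y; have := sqnorm_ge0 (p y); lra.
have B0 : 0 <= B by exact: le_trans (sqnorm_ge0 _) B1.
pose a := e / 3 / (B + 1).
have e30 : 0 < e / 3 by rewrite divr_gt0.
have a0 : 0 < a by rewrite /a divr_gt0 //; lra.
have aB : a * B <= e / 3.
  by rewrite /a mulrAC -mulrA ler_piMr ?ler_pdivrMr ?mul1r; lra.
have ak : 0 < a^-1 + k by rewrite addr_gt0 ?invr_gt0.
have [i hi] := rational_vector_dense y (e / 3 / (a^-1 + k)) (divr_gt0 e30 ak).
rewrite ltr_pdivlMr // mulrC in hi.
have near_i v q : smooth_convex k v q -> sqnorm (q y) <= B ->
    `|v (rational_vector i) - v y| <= e / 3.
  move=> sv qB; have := smooth_dist k a B v q y (rational_vector i - y) (ltW k0) a0 sv qB.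
  rewrite [y + _]addrC subrK -(sqnormN (_ - y)) opprB; lra.
near=> j.
have h1 := near_i _ _ sw B1; have h2 := near_i _ _ (sW (phi j)) (B2 (phi j)).
have h3 : `|w (rational_vector i) - W (phi j) (rational_vector i)| <= e / 3.
  have ij : (i <= j)%N by near: j; exists i.
  apply: le_trans ((proj2 (phiP j)) i ij) _; near: j.
  have [N _ hN] := near_infty_natSinv_lt (PosNum e30).
  by exists N => // n Nn; apply: ltW; exact: hN.
move: h1 h2 h3; rewrite !ler_norml => /andP[? ?] /andP[? ?] /andP[? ?].
by apply/andP; split; lra.
Unshelve. all: by end_near. Qed.

End Compactness.

(** * Existence of a dual solution *)

Section DualExistence.
Context {R : realType} {d : nat}.
Local Notation V := (borelRd R d).
Local Notation Id := (fun x : V => x : 'rV[R]_d).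

Lemma le_limn_einf (a : nat -> R) (l : R) (G : nat -> \bar R) :
  a @ \oo --> l -> (forall n, ((a n)%:E <= G n)%E) -> (l%:E <= limn_einf G)%E.
Proof.
move=> al aG.
have al' : (EFin \o a) @ \oo --> l%:E by apply/fine_cvgP; split; [exact: nearW|].
rewrite -(cvg_lim _ al') // -is_cvg_limn_einfE; last by apply/cvg_ex; exists l%:E.
rewrite !limn_einf_lim; apply: lee_lim; [exact: is_cvg_einfs|exact: is_cvg_einfs|].
apply: nearW => n; apply: le_ereal_inf_tmp => _ [k /= nk <-].
by apply: le_trans (aG k); apply: ereal_inf_lbound; exists k.
Qed.

Variables (nu0 nu1 : probability V R) (h0 : in_P2 nu0) (h1 : in_P2 nu1).
Variables (t : R) (t1 : 1 < t).
Local Notation c := ((t - 1) / t).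

(** The Fenchel inequality at y = 0 with its quadratic remainder: the dual cost
    controls the gradient of the transform at the origin. *)
Lemma dual_coercive u D : admissible t u -> dual_cost nu0 nu1 u = D%:E ->
  c / 8 * sqnorm (gradient (legendre u) 0) <=
  D + 2 / c * moment nu1 + c / 2 * moment nu0.
Proof.
move=> au uD; have c0 : 0 < c := c_gt0 t t1.
have L0 := proj1 (in_P2P _) h0; have L1 := proj1 (in_P2P _) h1.
have [_ sw QG _] := admissible_legendre t t1 u au.
have iw := legendre_intg t t1 u au nu1 L1.
have [mu0 _] := admissible_minorized t t1 u au nu0.
set w := fun y => fine (legendre u y) in sw QG iw; set p := gradient _ in sw QG *.
have i0 := L2_sqnorm _ _ L0; have i1 := L2_sqnorm _ _ L1.
have e1 : w 0 - c / 8 * sqnorm (p 0) - 2 / c * moment nu1 <= Ex nu1 w.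
  have -> : w 0 - c / 8 * sqnorm (p 0) - 2 / c * moment nu1 =
    Ex nu1 (fun y : V => (w 0 - c / 8 * sqnorm (p 0)) - 2 / c * sqnorm (y : 'rV[R]_d)).
    by rewrite (ExB _ _ _ (intg_cst _ _) (intgZ _ _ _ i1)) (ExZ _ _ _ i1) Ex_cst.
  apply: Ex_le => //; first exact: intgB (intg_cst _ _) (intgZ _ _ _ i1).
  move=> y; have /andP[h _] := sw 0 y; rewrite add0r in h.
  have c40 : 0 < c / 4 by rewrite divr_gt0.
  have := dotv_young (c / 4) (p 0) (- (y : 'rV[R]_d)) c40; rewrite dotvNr sqnormN.
  have -> : (c / 4)^-1 = 2 * (2 / c) by move: (c) => x; rewrite invf_div; ring.
  by lra.
have e0 : ((- w 0 + c / 4 * sqnorm (p 0) - c / 2 * moment nu0)%:E <= \int[nu0]_z u z)%E.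
  have ii := intgB _ _ _ (intg_cst nu0 (- w 0 + c / 4 * sqnorm (p 0))) (intgZ _ (c / 2) _ i0).
  have -> : - w 0 + c / 4 * sqnorm (p 0) - c / 2 * moment nu0 =
    Ex nu0 (fun y : V => (- w 0 + c / 4 * sqnorm (p 0)) - c / 2 * sqnorm (y : 'rV[R]_d)).
    by rewrite (ExB _ _ _ (intg_cst _ _) (intgZ _ _ _ i0)) (ExZ _ _ _ i0) Ex_cst.
  rewrite -(ExE _ _ ii); apply: integral_le => //; first exact: measurable_int ii.
  move=> z; apply: le_trans (QG 0 z); rewrite lee_fin dotv0.
  have := sqnormB_le z (z - p 0); rewrite opprB [z + _]addrC subrK => h.
  have := ler_wpM2l (ltW c0) h; rewrite -/(w 0); lra.
have : ((w 0 - c / 8 * sqnorm (p 0) - 2 / c * moment nu1 +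
    (- w 0 + c / 4 * sqnorm (p 0) - c / 2 * moment nu0))%:E <= D%:E)%E.
  rewrite -uD (dual_costE t t1 u au nu0 nu1 L1) EFinD; apply: leeD => //.
rewrite lee_fin; lra.
Qed.

(** A minimizing sequence is normalised so that its transforms vanish at 0;
    their gradients at 0 are bounded by [dual_coercive]. The limit w of the
    transforms along a subsequence defines u = w^*. Dominated convergence applies
    to the transforms, Fatou's lemma to the functions. *)
Lemma dual_attained : exists u D, solves_dual nu0 nu1 t u /\ dual_cost nu0 nu1 u = D%:E.
Proof.
have t1' := t1; have c0 : 0 < c := c_gt0 t t1.
have L0 := proj1 (in_P2P _) h0; have L1 := proj1 (in_P2P _) h1.
pose S := [set D : R | exists u, admissible t u /\ dual_cost nu0 nu1 u = D%:E].
have S0 : S !=set0.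
  have [I [J [q1 [q0 [g [u [D [_ au uD _]]]]]]]] := approximate_duality nu0 nu1 h0 h1 t t1 1 ltr01.
  by exists D, u.
have Slb : lbound S (- (2 / c * moment nu1 + c / 2 * moment nu0)).
  move=> D [u [au uD]]; have := dual_coercive u D au uD.
  have : 0 <= c / 8 * sqnorm (gradient (legendre u) 0) by rewrite mulr_ge0 ?sqnorm_ge0 //; lra.
  lra.
have Sinf : has_inf S by split => //; eexists; exact: Slb.
pose m := inf S.
have /choice[un unP] : forall n : nat, exists uD : ('rV[R]_d -> \bar R) * R,
    [/\ admissible t uD.1, dual_cost nu0 nu1 uD.1 = uD.2%:E & uD.2 < m + n.+1%:R^-1].
  move=> n; have n0 : 0 < n.+1%:R^-1 :> R by rewrite invr_gt0 ltr0n.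
  have [D [u [au uD]] lt] := inf_adherent n0 Sinf.
  by exists (u, D).
pose u_ n := (un n).1; pose D_ n := (un n).2.
have au n : admissible t (u_ n) by case: (unP n).
have uD n : dual_cost nu0 nu1 (u_ n) = (D_ n)%:E by case: (unP n).
have Dlt n : D_ n < m + n.+1%:R^-1 by case: (unP n).
have Dge n : m <= D_ n by apply: ge_inf; [exists (- (2 / c * moment nu1 + c / 2 * moment nu0))|exists (u_ n)].
pose w_ n y := fine (legendre (u_ n) y); pose p_ n := gradient (legendre (u_ n)).
pose W n y := w_ n y - w_ n 0.
have sw n : smooth_convex c^-1 (w_ n) (p_ n) by case: (admissible_legendre t t1 (u_ n) (au n)).
have QG n y z : ((dotv z y - w_ n y + c / 2 * sqnorm (z - p_ n y))%:E <= u_ n z)%E.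
  by case: (admissible_legendre t t1 (u_ n) (au n)) => _ _ /(_ y z).
have sW n : smooth_convex c^-1 (W n) (p_ n).
  by move=> y h; have /andP[? ?] := sw n y h; rewrite /W; apply/andP; split; lra.
have k0 : 0 < c^-1 by rewrite invr_gt0.
pose C := (c / 8)^-1 * (m + 1 + 2 / c * moment nu1 + c / 2 * moment nu0).
have pC n : sqnorm (p_ n 0) <= C.
  have c80 : 0 < c / 8 by apply: divr_gt0.
  rewrite /C ler_pdivlMl //; apply: le_trans (dual_coercive _ _ (au n) (uD n)) _.
  rewrite !lerD2r; apply: le_trans (ltW (Dlt n)) _; rewrite lerD2l invf_le1 ?ltr0n //.
  by rewrite ler1n.
have W0 n : W n 0 = 0 by rewrite /W subrr.
have [w [p [phi [sw' phi_ge cW]]]] := smooth_convex_compact c^-1 C W p_ k0 sW W0 pC.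
have [au' lE QG'] := smooth_legendre c w p c0 sw'.
set u := legendre (EFin \o w) in au' lE QG'.
have {}au' : admissible t u by exact: au'.
have iW n : intg nu1 (W n).
  apply: intgB; [exact: legendre_intg t t1 _ (au n) nu1 L1|exact: intg_cst].
have iw : intg nu1 w.
  have := legendre_intg t t1 _ au' nu1 L1.
  by congr intg; apply/funext => y; rewrite lE.
have cEx : Ex nu1 (W (phi j)) @[j --> \oo] --> Ex nu1 w.
  pose B (y : V) := (C + (1 + c^-1) * sqnorm (y : 'rV[R]_d)) / 2.
  have iB : intg nu1 B.
    rewrite /B; under eq_fun do rewrite mulrC.
    apply: intgZ; apply: intgD; [exact: intg_cst|apply: intgZ; exact: L2_sqnorm L1].
  have := @dominated_cvg _ _ _ nu1 setT measurableT (fun j y => (W (phi j) y)%:E)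
    (fun y => (w y)%:E) (fun y => (B y)%:E).
  rewrite (ExE _ _ iw) => H.
  suff : (EFin \o (fun j => Ex nu1 (W (phi j)))) @ \oo --> (Ex nu1 w)%:E.
    by move/fine_cvgP => [].
  have -> : EFin \o (fun j => Ex nu1 (W (phi j))) = fun j => (\int[nu1]_y (W (phi j) y)%:E)%E.
    by apply/funext => j; rewrite (ExE _ _ (iW _)).
  apply: H => //.
  - by move=> j; exact: measurable_int (iW (phi j)).
  - by move=> y _; apply/fine_cvgP; split; [exact: nearW|exact: cW].
  - move=> j y _; rewrite lee_fin.
    exact: smooth_bounded (ltW k0) (sW _) (W0 _) (pC _).
pose G j z := (u_ (phi j) z + (w_ (phi j) 0)%:E)%E.
have mG j : minorized nu0 (G j).
  apply: minorized_addq; [exact: admissible_minorized t t1 _ (au _) nu0|exact: intg_cst].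
(* normalised at 0, the functions u_ are nonnegative by the quadratic bound *)
have G0 j z : (0 <= G j z)%E.
  rewrite /G -leeBlDr // sub0e; apply: le_trans (QG _ 0 z); rewrite -EFinN lee_fin dotv0.
  have : 0 <= c / 2 * sqnorm (z - p_ (phi j) 0) by rewrite mulr_ge0 ?sqnorm_ge0 //; lra.
  lra.
have GE j : (\int[nu0]_z G j z = (D_ (phi j) - Ex nu1 (W (phi j)))%:E)%E.
  rewrite /G (integral_addq _ _ _ (admissible_minorized t t1 _ (au _) nu0) (intg_cst _ _)) Ex_cst.
  have := uD (phi j); rewrite (dual_costE t t1 _ (au _) nu0 nu1 L1).
  have -> : Ex nu1 (W (phi j)) = Ex nu1 (w_ (phi j)) - w_ (phi j) 0.
    by rewrite (ExB _ _ _ (legendre_intg t t1 _ (au _) nu1 L1) (intg_cst _ _)) Ex_cst.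
  rewrite -/(w_ (phi j)); case: (\int[nu0]_x _)%E => [r||] //; rewrite -!EFinD => -[<-].
  by congr EFin; ring.
(* u is a supremum of limits of affine minorants of the G j *)
have uG z : (u z <= limn_einf (G ^~ z))%E.
  apply: ge_ereal_sup => _ [y _ <-] /=; rewrite -EFinB dotvC.
  apply: (le_limn_einf (fun j => dotv z y - W (phi j) y)).
    exact: (cvgB (cvg_cst (dotv z y)) (cW y)).
  move=> j; rewrite /G /W -leeBlDr //; apply: le_trans (QG _ y z); rewrite -EFinB lee_fin.
  have : 0 <= c / 2 * sqnorm (z - p_ (phi j) y) by rewrite mulr_ge0 ?sqnorm_ge0 //; lra.
  lra.
have cD : D_ (phi j) @[j --> \oo] --> m.
  apply/cvgrPdist_le => e e0; near=> j.
  have : (phi j).+1%:R^-1 <= e.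
    apply: le_trans (_ : _ <= j.+1%:R^-1) _.
      by rewrite lef_pV2 ?posrE ?ltr0n // ler_nat ltnS.
    near: j; have [N _ hN] := near_infty_natSinv_lt (PosNum e0).
    by exists N => // n Nn; apply: ltW; exact: hN.
  have := Dlt (phi j); have := Dge (phi j) => h2 h3 h4.
  have h5 : D_ (phi j) < m + e by apply: lt_le_trans h3 _; rewrite lerD2l.
  by clear h3 h4; rewrite ler_norml; apply/andP; split; lra.
have iu : (\int[nu0]_z u z <= (m - Ex nu1 w)%:E)%E.
  have lG : (\int[nu0]_z G j z)%E @[j --> \oo] --> (m - Ex nu1 w)%:E.
    under eq_fun do rewrite GE.
    by apply/fine_cvgP; split; [exact: nearW|exact: cvgB].
  have <- : limn_einf (fun j => \int[nu0]_z G j z)%E = (m - Ex nu1 w)%:E.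
    by rewrite is_cvg_limn_einfE; [exact: cvg_lim lG|apply/cvg_ex; exists (m - Ex nu1 w)%:E].
  apply: le_trans _ (fatou nu0 measurableT (fun j => proj1 (mG j)) (fun j z _ => G0 j z)).
  apply: integral_le => //; first by case: (admissible_minorized t t1 _ au' nu0).
  rewrite /limn_einf; apply: measurableT_comp => //.
  apply: measurable_fun_limn_esup => // j; apply: measurableT_comp => //.
  by case: (mG j).
have [r rE] : exists r, (\int[nu0]_z u z = r%:E)%E.
  have := minorized_gtNy _ _ (admissible_minorized t t1 _ au' nu0); move: iu.
  by case: (\int[nu0]_z u z)%E => [r||] // _ _; exists r.
have cost : dual_cost nu0 nu1 u = (Ex nu1 w + r)%:E.
  rewrite (dual_costE t t1 _ au' nu0 nu1 L1) rE EFinD; congr (_%:E + _)%E.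
  by congr Ex; apply/funext => y; rewrite lE.
exists u, (Ex nu1 w + r); split => //; split => // u' au2.
have rm : Ex nu1 w + r <= m by move: iu; rewrite rE lee_fin; lra.
rewrite cost; case E : (dual_cost nu0 nu1 u') => [D'||]; last 2 first.
- by rewrite leey.
- have := minorized_gtNy _ _ (admissible_minorized t t1 _ au2 nu0).
  move: E; rewrite (dual_costE t t1 _ au2 nu0 nu1 L1).
  by case: (\int[nu0]_x _)%E.
rewrite lee_fin; apply: le_trans rm _; apply: ge_inf; last by exists u'.
by exists (- (2 / c * moment nu1 + c / 2 * moment nu0)).
Unshelve. all: by end_near. Qed.

End DualExistence.

(** * A vanishing Wasserstein cost *)

Section Separation.
Context {R : realType} {d : nat}.
Local Notation V := (borelRd R d).
Implicit Types (mu nu : probability V R).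

(** The points of [O] at distance at least (n + 1)^(-1/2) from the complement.
    Written as the complement of a union of open balls, it is measurable. *)
Definition inner_set (O : set 'rV[R]_d) (n : nat) : set V :=
  ~` \bigcup_(y in ~` O) [set x : 'rV[R]_d | sqnorm (x - y) < n.+1%:R^-1].

Lemma inner_set_measurable O n : measurable (inner_set O n).
Proof.
apply: measurableC; apply: open_measurable_Rd; apply: bigcup_open => y _.
rewrite (_ : [set x | _] = (fun z => sqnorm (z - y)) @^-1` [set s | s < n.+1%:R^-1]) //.
apply: open_comp => [x _|]; [exact: sqnormB_cont|exact: open_lt].
Qed.

Lemma inner_setP O n x y : inner_set O n x -> ~ O y -> n.+1%:R^-1 <= sqnorm (x - y).
Proof. by move=> h Oy; rewrite leNgt; apply/negP => lt; apply: h; exists y. Qed.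

Lemma bigcup_inner_set (O : set 'rV[R]_d) : open O -> \bigcup_n inner_set O n = O.
Proof.
move=> oO; apply/seteqP; split=> [x [n _ h]|x Ox].
  apply: contrapT => /(inner_setP _ _ _ _ h); rewrite subrr sqnorm0.
  by rewrite leNgt invr_gt0 ltr0n.
have /nbhs_ballP[e /= e0 he] : nbhs x O by apply: open_nbhs_nbhs; split.
have e20 : 0 < (e / 2) ^+ 2 by rewrite exprn_gt0 // divr_gt0.
have [N _ hN] := near_infty_natSinv_lt (PosNum e20).
exists N => // -[y Oy /= xy]; apply: Oy; apply: he; rewrite -ball_normE /=.
apply: (@le_lt_trans _ _ (e / 2)); last by lra.
apply: mx_norm_sqnorm_le; first by lra.
by apply: ltW; apply: lt_trans xy _; exact: (hN N (leqnn N)).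
Qed.

(** If x lies in the inner set and y outside of [O], then |x - y|^2 is at least
    1 / (n + 1): the mass of the inner set that is not sent into [O] is at most
    (n + 1) times the transport cost, which can be taken arbitrarily small. *)
Lemma open_le_of_W2r0 mu nu O : in_P2 mu -> in_P2 nu -> W2r mu nu <= 0 -> open O ->
  (mu (O : set V) <= nu (O : set V))%E.
Proof.
move=> hmu hnu W0 oO; have mO := open_measurable_Rd O oO.
have mn n : (mu (inner_set O n) <= nu (O : set V))%E.
  have mI := inner_set_measurable O n.
  rewrite (prob_Ex mu _ mI) (prob_Ex nu _ mO) lee_fin.
  apply/ler_addgt0Pr => e e0.
  have ne : 0 < n.+1%:R^-1 * e by rewrite mulr_gt0 ?invr_gt0 ?ltr0n.
  have [g [l1 l2 gle]] := W2r_approx _ _ hmu hnu _ ne.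
  have X1 := law_L2 _ _ _ l1 _ (proj1 (in_P2P _) hmu).
  have X2 := law_L2 _ _ _ l2 _ (proj1 (in_P2P _) hnu).
  have LD := L2_sqnorm _ _ (L2B _ _ _ X1 X2).
  have i1 := law_intg _ _ _ l1 _ (intg_indic mu _ mI).
  have i2 := law_intg _ _ _ l2 _ (intg_indic nu _ mO).
  rewrite -(law_Ex _ _ _ l1 _ (intg_measurable _ _ (intg_indic mu _ mI))).
  rewrite -(law_Ex _ _ _ l2 _ (intg_measurable _ _ (intg_indic nu _ mO))).
  apply: le_trans (_ : _ <= Ex g (fun z => \1_O z.2 + n.+1%:R * sqnorm (z.1 - z.2 : 'rV[R]_d))) _.
    apply: Ex_le => //; first by apply: intgD => //; exact: intgZ.
    move=> [x y] /=; rewrite !indicE.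
    have s0 := sqnorm_ge0 (x - y : 'rV[R]_d).
    have n0 : 0 <= n.+1%:R * sqnorm (x - y : 'rV[R]_d) :> R by rewrite mulr_ge0.
    case: (asboolP (O y)) => Oy; first by rewrite (mem_set Oy); case: (_ \in _) => /=; lra.
    rewrite (memNset Oy); case: (asboolP (inner_set O n x)) => Ix; last by rewrite (memNset Ix) add0r.
    rewrite (mem_set Ix) add0r; have := inner_setP _ _ _ _ Ix Oy.
    by rewrite -[n.+1%:R^-1]mul1r ler_pdivrMr ?ltr0n // mulrC.
  rewrite (ExD _ _ _ i2 (intgZ _ _ _ LD)) (ExZ _ _ _ LD) lerD2l.
  rewrite -ler_pdivlMl ?ltr0n //; apply: le_trans gle _; by rewrite gerDr.
have := @nondecreasing_cvg_mu _ _ _ mu (inner_set O) (inner_set_measurable O).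
rewrite (bigcup_inner_set O oO) => /(_ mO) H.
have {}H : mu (inner_set O n) @[n --> \oo] --> mu (O : set V).
  apply: H => m n mn'; apply/subsetPset => x h [y Oy /= xy]; apply: h; exists y => //=.
  by apply: lt_le_trans xy _; rewrite lef_pV2 ?posrE ?ltr0n // ler_nat ltnS.
have -> : mu (O : set V) = limn (fun n => mu (inner_set O n)) by apply/esym/cvg_lim.
by apply: lime_le; [apply/cvg_ex; exists (mu (O : set V))|exact: nearW].
Qed.

(** The two measures agree on open sets, which are stable under intersection
    and generate the sigma-algebra. *)
Lemma W2r_le0_eq mu nu : in_P2 mu -> in_P2 nu -> W2r mu nu <= 0 ->
  forall A : set V, measurable A -> mu A = nu A.
Proof.
move=> hmu hnu W0; have W0' : W2r nu mu <= 0.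
  apply/ler_addgt0Pr => e e0; have [g [l1 l2 gle]] := W2r_approx _ _ hmu hnu _ e0.
  apply: le_trans (W2r_le _ _ hnu hmu _ _ _ l2 l1) _.
  have -> : (fun z : V * V => sqnorm (z.2 - z.1 : 'rV[R]_d)) = fun z => sqnorm (z.1 - z.2 : 'rV[R]_d).
    by apply/funext => z; rewrite -sqnormN opprB.
  lra.
apply: (@measure_unique _ _ V (@open 'rV[R]_d) (fun=> setT)) => //.
- by move=> A B; exact: openI.
- by move=> _; exact: openT.
- by apply/seteqP; split => // x _; exists 0%N.
- by move=> O oO; apply/eqP; rewrite eq_le !open_le_of_W2r0.
- by move=> _; apply: le_lt_trans (probability_le1 mu _) _ => //; rewrite ltry.
Qed.

End Separation.

(** * Optimality *)

Section Optimality.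
Context {R : realType} {d : nat}.
Local Notation V := (borelRd R d).
Variables (nu0 nu1 : probability V R) (h0 : in_P2 nu0) (h1 : in_P2 nu1).
Variables (t : R) (t1 : 1 < t).

Definition solution u D := solves_dual nu0 nu1 t u /\ dual_cost nu0 nu1 u = D%:E.

Lemma solves_dual_solution u : solves_dual nu0 nu1 t u -> exists D, solution u D.
Proof.
move=> su; have [u0 [D [[a0 m0] uD]]] := dual_attained nu0 nu1 h0 h1 t t1.
exists D; split => //; apply/eqP; rewrite eq_le -{1}uD (proj2 su) //=.
by rewrite -uD m0 //; case: su.
Qed.

(** By [approximate_duality] the score is within eps of the dual minimum, so
    that the remainder in [dual_ge_score] brings the discrete map close to the
    gradient of the transform; [primal_ge_score] does the rest. *)
Lemma primal_stability u D mu (eps : R) : solution u D -> in_P2 mu -> 0 < eps ->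
  exists g : probability (V * V)%type R, [/\ has_law g fst mu, has_law g snd nu1 &
   D - moment nu0 / 2 - moment nu1 / 2 + (4 * t * (t - 1))^-1 *
     Ex g (fun z => sqnorm (z.1 - extrapolation_map t u z.2 : 'rV[R]_d)) <=
   (2 * (t - 1))^-1 * W2r mu nu1 - (2 * t)^-1 * W2r mu nu0 + 3 * eps].
Proof.
move=> [[au um] uD] hmu eps0; have t1' := t1.
have L1 := proj1 (in_P2P _) h1; have Lmu := proj1 (in_P2P _) hmu.
have [I [J [q1 [q0 [g [u' [D' [[[mq1 mq0 a0 b0] [g0 grow gcol]] au' uD' le']]]]]]]] :=
  approximate_duality nu0 nu1 h0 h1 t t1 eps eps0.
have dge := dual_ge_score nu0 nu1 I J q1 q0 g h0 h1 mq1 mq0 a0 b0 g0 grow gcol t t1 u D au uD.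
have DD' : D <= D' by rewrite -lee_fin -uD -uD' um.
have e20 : 0 < 2 * (t - 1) * eps by rewrite !mulr_gt0 //; lra.
have [gam [l1 l2 gle]] := W2r_approx _ _ hmu h1 _ e20.
have pge := primal_ge_score nu0 nu1 I J q1 q0 g h0 h1 mq1 mq0 a0 b0 g0 grow gcol t t1 mu gam hmu l1 l2.
exists gam; split => //.
set B := step_map _ _ _ _ _ _ _ in dge pge; set p := gradient _ in dge.
have LB : L2 nu1 B by exact: step_map_L2.
have Lp : L2 nu1 p := gradient_L2 _ t1 _ au _ L1.
have X := law_L2 _ _ _ l1 _ Lmu; have Y := law_L2 _ _ _ l2 _ L1.
have YB := law_L2 _ _ _ l2 _ LB; have Yp := law_L2 _ _ _ l2 _ Lp.
have LTn := L2B _ _ _ X (L2B _ _ _ (L2Z _ t _ Y) (L2Z _ (t - 1) _ YB)).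
have LBp := L2_sqnorm _ _ (L2B _ _ _ YB Yp).
have LT := law_L2 _ _ _ l2 _ (extrapolation_map_L2 t t1 u au nu1 L1).
set E := Ex gam (fun z => sqnorm (z.1 - extrapolation_map t u z.2 : 'rV[R]_d)).
set E1 := Ex gam _ in pge; set A := Ex nu1 _ in dge.
have key (x y b q : 'rV[R]_d) : sqnorm (x - (t *: y - (t - 1) *: q)) <=
    2 * sqnorm (x - (t *: y - (t - 1) *: b)) + 2 * (t - 1) ^+ 2 * sqnorm (b - q).
  have -> : x - (t *: y - (t - 1) *: q) = (x - (t *: y - (t - 1) *: b)) - (t - 1) *: (b - q).
    by apply/rowP => i; rewrite !mxE; ring.
  by apply: le_trans (sqnormB_le _ _) _; rewrite sqnormZ mulrA.
(* passing from the discrete map to the extrapolation map costs A *)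
have EE : E <= 2 * E1 + 2 * (t - 1) ^+ 2 * A.
  have -> : A = Ex gam (fun z => sqnorm (B z.2 - p z.2)).
    rewrite /A -(law_Ex _ _ _ l2 (fun y : V => sqnorm (B y - p y))) //.
    exact: intg_measurable _ _ (L2_sqnorm _ _ (L2B _ _ _ LB Lp)).
  rewrite -(ExZ _ _ _ (L2_sqnorm _ _ LTn)) -(ExZ _ _ _ LBp).
  rewrite -(ExD _ _ _ (intgZ _ _ _ (L2_sqnorm _ _ LTn)) (intgZ _ _ _ LBp)).
  apply: Ex_le; first exact: L2_sqnorm (L2B _ _ _ X LT).
    exact: intgD (intgZ _ _ _ (L2_sqnorm _ _ LTn)) (intgZ _ _ _ LBp).
  by move=> [x y] /=; rewrite (extrapolation_mapE t u) -/p; exact: key.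
clear um uD uD' au au' hmu a0 b0 g0 grow gcol LTn LBp LT YB Yp X Y LB Lp Lmu L1 l1 l2 key.
have E1le : (2 * t * (t - 1))^-1 * E1 <= (2 * (t - 1))^-1 * W2r mu nu1 - (2 * t)^-1 * W2r mu nu0 +
    2 * eps - (D - moment nu0 / 2 - moment nu1 / 2).
  have e1 : moment nu0 / 2 = (t - 1) / t / 2 * moment nu0 + moment nu0 / (2 * t) by field; lra.
  have e2 : (2 * (t - 1))^-1 * (W2r mu nu1 + 2 * (t - 1) * eps) = (2 * (t - 1))^-1 * W2r mu nu1 + eps.
    by field; lra.
  have i0 : 0 <= (2 * (t - 1))^-1 by rewrite invr_ge0; lra.
  have := ler_wpM2l i0 gle; rewrite e2; lra.
have Ale : A <= 2 * t / (t - 1) * eps.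
  have c20 : 0 < (t - 1) / t / 2 by rewrite !divr_gt0 //; lra.
  rewrite -(ler_pM2l c20); have -> : (t - 1) / t / 2 * (2 * t / (t - 1) * eps) = eps.
    by field; rewrite !gt_eqF //; lra.
  lra.
have k0 : 0 <= (4 * t * (t - 1))^-1 by rewrite invr_ge0 !mulr_ge0 //; lra.
have := ler_wpM2l k0 EE.
have -> : (4 * t * (t - 1))^-1 * (2 * E1 + 2 * (t - 1) ^+ 2 * A) =
   (2 * t * (t - 1))^-1 * E1 + (t - 1) / (2 * t) * A.
  by field; rewrite !gt_eqF //; lra.
have c30 : 0 <= (t - 1) / (2 * t) by rewrite divr_ge0 //; lra.
have := ler_wpM2l c30 Ale.
have -> : (t - 1) / (2 * t) * (2 * t / (t - 1) * eps) = eps.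
  by field; rewrite !gt_eqF //; lra.
lra.
Qed.

Lemma dual_le_primal u D mu : solution u D -> in_P2 mu ->
  ((D - moment nu0 / 2 - moment nu1 / 2)%:E <= primal_cost nu0 nu1 t mu)%E.
Proof.
move=> su hmu; have t1' := t1; rewrite primal_costE // lee_fin.
apply/ler_addgt0Pr => e e0.
have e30 : 0 < e / 3 by lra.
have [g [_ _]] := primal_stability u D mu (e / 3) su hmu e30.
set E := Ex g _; have : 0 <= (4 * t * (t - 1))^-1 * E.
  apply: mulr_ge0; last by apply: Ex_ge0 => z; exact: sqnorm_ge0.
  by rewrite invr_ge0 !mulr_ge0 //; lra.
lra.
Qed.

Lemma transported_cost u D mu : solution u D -> has_law nu1 (extrapolation_map t u) mu ->
  primal_cost nu0 nu1 t mu = (D - moment nu0 / 2 - moment nu1 / 2)%:E.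
Proof.
move=> su lmu; have [[au _] uD] := su.
apply/eqP; rewrite eq_le (primal_le_dual t t1 u au nu0 nu1 mu h0 h1 lmu D uD) /=.
exact: dual_le_primal u D mu su (transported_P2 t t1 u au nu1 mu h1 lmu).
Qed.

Lemma transported_solves_primal u mu : solves_dual nu0 nu1 t u ->
  has_law nu1 (extrapolation_map t u) mu -> solves_primal nu0 nu1 t mu.
Proof.
move=> su lmu; have [D sD] := solves_dual_solution u su; have [au _] := su.
split; first exact: transported_P2 t t1 u au nu1 mu h1 lmu.
by move=> mu' hmu'; rewrite (transported_cost u D mu sD lmu); exact: dual_le_primal u D mu' sD hmu'.
Qed.

Lemma dual_law u : solves_dual nu0 nu1 t u ->
  exists mu, has_law nu1 (extrapolation_map t u : V -> V) mu.
Proof. by case=> au _; apply: exists_law; exact: extrapolation_map_measurable. Qed.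

(** The measure transported by [u] is another primal solution; by
    [primal_stability] the Wasserstein cost between the two vanishes. *)
Lemma solves_primal_transported u mu : solves_dual nu0 nu1 t u ->
  solves_primal nu0 nu1 t mu -> has_law nu1 (extrapolation_map t u) mu.
Proof.
move=> su [hmu mmin]; have t1' := t1; have [D sD] := solves_dual_solution u su.
have [au _] := su; have [rho lrho] := dual_law u su.
have hrho := transported_P2 t t1 u au nu1 rho h1 lrho.
have := mmin rho hrho; rewrite (transported_cost u D rho sD lrho) primal_costE // lee_fin => cle.
have W0 : W2r mu rho <= 0.
  apply/ler_addgt0Pr => e e0; rewrite add0r.
  have k0 : 0 < 4 * t * (t - 1) by rewrite !mulr_gt0 //; lra.
  have e30 : 0 < (4 * t * (t - 1))^-1 * e / 3 by rewrite divr_gt0 // mulr_gt0 // invr_gt0.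
  have [g [l1 l2 gle]] := primal_stability u D mu _ sD hmu e30.
  have lY := has_law_comp _ _ _ _ _ l2 lrho.
  apply: le_trans (W2r_le _ _ hmu hrho _ _ _ l1 lY) _.
  have ki : 0 < (4 * t * (t - 1))^-1 by rewrite invr_gt0.
  rewrite -(ler_pM2l ki) /=; lra.
have muE := W2r_le0_eq mu rho hmu hrho W0.
by case: lrho => mT lT; split => // A mA; rewrite muE // lT.
Qed.

Lemma integral_half_sqnorm nu : in_P2 nu ->
  (\int[nu]_x (sqnorm (x : 'rV[R]_d) / 2)%:E = (moment nu / 2)%:E)%E.
Proof.
move=> /in_P2P L; have := half_sqnormE nu 1 L; have := half_sqnorm_intg nu 1 L.
have -> : (fun x : V => 1 * (sqnorm (x : 'rV[R]_d) / 2)) = fun x : V => sqnorm (x : 'rV[R]_d) / 2.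
  by apply/funext => x; rewrite mul1r.
by move=> i e; rewrite (ExE _ _ i) e /moment mul1r mulrC.
Qed.

Lemma pushforward_law u mu : admissible t u ->
  is_pushforward (extrapolation_map t u) nu1 mu <-> has_law nu1 (extrapolation_map t u) mu.
Proof.
move=> au; split=> [h|[_ h] A mA]; last by rewrite /pushforward h.
by split=> [|A mA]; [exact: extrapolation_map_measurable|rewrite (h A mA)].
Qed.

End Optimality.

Theorem theorem2p6 (R : realType) (d : nat)
    (nu0 nu1 : probability (borelRd R d) R) (t : R)
    (hnu0 : in_P2 nu0) (hnu1 : in_P2 nu1) (ht : 1 < t) :
  (* the infimum in (P) is a minimum *)
  (exists mu, solves_primal nu0 nu1 t mu) /\
  (primal_value nu0 nu1 t =
    dual_value nu0 nu1 t - \int[nu0]_x (sqnorm x / 2)%:E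
                         - \int[nu1]_x (sqnorm x / 2)%:E)%E /\
  (forall mu : probability (borelRd R d) R,
    solves_primal nu0 nu1 t mu <->
    exists u : 'rV[R]_d -> \bar R,
      solves_dual nu0 nu1 t u /\ is_pushforward (extrapolation_map t u) nu1 mu) /\
  (forall u : 'rV[R]_d -> \bar R,
    solves_dual nu0 nu1 t u <->
    exists mu : probability (borelRd R d) R,
      [/\ solves_primal nu0 nu1 t mu,
          brenier_potential nu1 mu (fun y =>
            (- ((t - 1)%:E * legendre u y) + (t * (sqnorm y / 2))%:E)%E) &
          brenier_potential nu0 mu (fun x =>
            (t%:E * u x - ((t - 1) * (sqnorm x / 2))%:E)%E)]).
Proof.
have [u0 [D s0]] := dual_attained nu0 nu1 hnu0 hnu1 t ht.
have [su0 uD0] := s0; have [au0 um0] := su0.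
have [mu0 lmu0] := dual_law nu0 nu1 t ht u0 su0.
have smu0 := transported_solves_primal nu0 nu1 hnu0 hnu1 t ht u0 mu0 su0 lmu0.
split; first by exists mu0.
split.
  have -> : dual_value nu0 nu1 t = D%:E.
    apply/eqP; rewrite eq_le; apply/andP; split; first by apply: ereal_inf_lbound; exists u0.
    by apply: le_ereal_inf_tmp => _ [u au <-]; rewrite -uD0 um0.
  rewrite !integral_half_sqnorm // -!EFinB.
  rewrite -(transported_cost nu0 nu1 hnu0 hnu1 t ht u0 D mu0 s0 lmu0).
  have [hmu0 mmin] := smu0.
  apply/eqP; rewrite eq_le; apply/andP; split; first by apply: ereal_inf_lbound; exists mu0.
  by apply: le_ereal_inf_tmp => _ [mu hmu <-]; exact: mmin.
split=> [mu|u]; split.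
- move=> smu; exists u0; split => //; apply/pushforward_law => //.
  exact: solves_primal_transported nu0 nu1 hnu0 hnu1 t ht u0 mu su0 smu.
- move=> [u [su /pushforward_law lmu]].
  apply: (transported_solves_primal nu0 nu1 hnu0 hnu1 t ht u mu su).
  by apply: lmu => //; case: su.
- move=> su; have [mu lmu] := dual_law nu0 nu1 t ht u su; have [au _] := su.
  exists mu; split.
  + exact: transported_solves_primal nu0 nu1 hnu0 hnu1 t ht u mu su lmu.
  + exact: forward_brenier t ht u au nu1 mu hnu1 lmu.
  + exact: backward_brenier t ht u au nu0 nu1 mu hnu0 hnu1 lmu su.
- move=> [mu [smu _ bu]].
  have lmu := solves_primal_transported nu0 nu1 hnu0 hnu1 t ht u0 mu su0 smu.
  exact: brenier_solves_dual t ht u0 au0 nu0 nu1 mu hnu0 hnu1 lmu u su0 bu.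
Qed.
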